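(* Let $x\ge 0$ and $\varepsilon>0$ be fixed. 1. Let $(\alpha_n)_{n\ge0}$ be a sequence of positive numbers converging to zero and, for each $n$, let $u_n$ be an $\varepsilon$-optimal control for $V_{\alpha_n}(x)$. Then the sequence $(u_n)_{n\ge0}$ is bounded and any limit point of $(u_n)_{n\ge0}$ is an optimal control for $V_0$. 2. Let $(T_n)_{n\ge0}$ be a sequence of positive numbers such that $\lim_{n\to\infty}T_n=+\infty$ and, for each $n$, let $u_n$ be an $\varepsilon$-optimal control for $V(x,T_n)$. Then the sequence $(u_n)_{n\ge0}$ is bounded and any limit point of $(u_n)_{n\ge0}$ is an optimal control for $V_0$.
   Context: Let $H\in[\tfrac12,1)$ and let $W_H=(W_H(t))_{t\ge 0}$ be a fractional Brownian motion with Hurst parameter $H$: a continuous zero-mean Gaussian process with $W_H(0)=0$ and $\mathrm{Cov}(W_H(s),W_H(t))=\frac12\bigl[t^{2H}+s^{2H}-|t-s|^{2H}\bigr]$ for $s,t\ge 0$. For $x\ge 0$ and $u\ge 0$ define, for $t\ge 0$, $$L_x^u(t)=-\min\Bigl\{0,\min_{s\in[0,t]}\bigl(x-us+W_H(s)\bigr)\Bigr\},\qquad X_x^u(t)=x-ut+W_H(t)+L_x^u(t).$$ Standing assumptions: $p\ge 0$ is a constant; $h:[0,\infty)\to[0,\infty)$ is continuous, non-decreasing, with $\lim_{u\to\infty}h(u)=+\infty$; $C:[0,\infty)\to[0,\infty)$ is continuous, non-decreasing, and satisfies $C(y)\le K(1+y^\gamma)$ for all $y\ge0$, for some constants $K>0$,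 $\gamma>0$. Value functions: - Long-run average: $I(u,x)=h(u)+\limsup_{T\to\infty}\frac1T E\bigl(\int_0^T C(X_x^u(t))\,dt+p\,L_x^u(T)\bigr)$ and $V_0=\inf_{u>0}I(u,x)$ (both known not to depend on $x$). An optimal control for $V_0$ is a $u^*>0$ with $I(u^*,x)=V_0$. - Discounted, for $\alpha>0$: $J_\alpha(u,x)=E\bigl(\int_0^\infty e^{-\alpha t}[h(u)+C(X_x^u(t))]\,dt+p\int_0^\infty e^{-\alpha t}\,dL_x^u(t)\bigr)$ and $V_\alpha(x)=\inf_{u>0}J_\alpha(u,x)$. An $\varepsilon$-optimal control for $V_\alpha(x)$ is a $u>0$ with $J_\alpha(u,x)<V_\alpha(x)+\varepsilon$. - Finite horizon, for $T>0$: $I(u,x,T)=h(u)T+p\,E(L_x^u(T))+E\bigl(\int_0^T C(X_x^u(t))\,dt\bigr)$ and $V(x,T)=\inf_{u>0}I(u,x,T)$. An $\varepsilon$-optimal control for $V(x,T)$ is a $u>0$ with $I(u,x,T)<V(x,T)+\varepsilon$.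
   Formalization: As stated the claim fails (p=0, C=0, h(u)=u: V_0 is not attained and ε-optimal u_n can tend to 0). What is proved: each limit point l is an optimal control for V_0, or else l=0, C is bounded and I(0,x)=V_0. *)

(* Defs.v *)
From HB Require Import structures.
From mathcomp Require Import all_boot all_order all_algebra.
From mathcomp Require Import all_classical all_reals all_analysis.
From mathcomp Require Import lra.

Set Implicit Arguments.
Unset Strict Implicit.
Unset Printing Implicit Defensive.

Import Order.TTheory GRing.Theory Num.Theory.
Import numFieldNormedType.Exports.

Local Open Scope classical_set_scope.
Local Open Scope ring_scope.

Section gaussian.
Context {d : measure_display} {Omega : measurableType d} {R : realType}.
Variable P : probability Omega R.

(* Constants count as Gaussian: they need their own clause because
   [normal_prob m 0] is not the Dirac mass at [m] (it is uniform on [0, 1]). *)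
Definition gaussian_rv (X : Omega -> R) : Prop :=
  exists m s : R, forall A : set R, measurable A ->
    P (X @^-1` A) = if s == 0 then \d_m A else normal_prob m s A.

(* Processes are indexed by [R]; only the times [t >= 0] matter. *)
Definition gaussian_process (W : R -> {RV P >-> R}) : Prop :=
  forall (n : nat) (t a : 'I_n -> R), (forall i, 0 <= t i) ->
    gaussian_rv (fun w => \sum_(i < n) a i * W (t i) w).

Definition fractional_brownian_motion (H : R) (W : R -> {RV P >-> R}) : Prop :=
  [/\ gaussian_process W,
      forall t, 0 <= t -> ('E_P[W t] = 0)%E,
      forall s t, 0 <= s -> 0 <= t ->
        covariance P (W s) (W t) =
          (2^-1 * (t `^ (2 * H) + s `^ (2 * H) - `|t - s| `^ (2 * H)))%:E,
      forall w, W 0 w = 0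
    & forall w, {within `[0, +oo[, continuous (fun t => W t w)} ].

End gaussian.

Section reflection.
Context {R : realType}.
Implicit Types (x u t : R) (w : R -> R).

(* [L_x^u] and [X_x^u] along one driving path [w].  On a continuous path the
   infimum is the minimum.  For [t < 0] the set is empty, its [inf] is 0, and
   [regulator x u w t = 0]. *)
Definition regulator x u w t : R :=
  - Num.min 0 (inf [set x - u * s + w s | s in `[0, t]]).

Definition reflected x u w t : R := x - u * t + w t + regulator x u w t.

(* The measure dF, for [F] non-decreasing and right-continuous on the whole
   line (and the null measure otherwise); [regulator_cumulative] below shows
   that the junk value plays no role for regulators. *)
Definition stieltjes (F : R -> R) : {measure set (measurableTypeR R) -> \bar R} :=
  match pselect (exists G : cumulative R R, F = G) with
  | left FG => lebesgue_stieltjes_measure (projT1 (cid FG))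
  | right _ => mzero
  end.

Lemma regulator_nondecreasing_rc x u w : 0 <= x -> w 0 = 0 ->
  {within `[0, +oo[, continuous w} ->
  nondecreasing (regulator x u w) /\ right_continuous (regulator x u w).
Proof.
move=> x0 w0 cw.
pose f s := x - u * s + w s.
pose S t := [set f s | s in `[0, t]].
have SE t : regulator x u w t = - Num.min 0 (inf (S t)) by [].
have f00 : f 0 = x by rewrite /f mulr0 subr0 w0 addr0.
have cf : {within `[0, +oo[, continuous f}.
  move=> z; apply: (@cvgD _ R^o); last exact: cw.
  apply: (@continuous_subspaceT _ _ _ (fun s => x - u * s)) => s.
  apply: (@cvgB _ R^o); first exact: cvg_cst.
  by apply: cvgM; [exact: cvg_cst|exact: cvg_id].
have Slb t : has_lbound (S t).
  have [t0|t0] := leP 0 t; last first.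
    exists 0 => y [s /=]; rewrite in_itv/= => /andP[s0 st].
    by move: (le_lt_trans (le_trans s0 st) t0); rewrite ltxx.
  have cft : {within `[0, t], continuous f}.
    apply: continuous_subspaceW cf => s /=; rewrite !in_itv/= andbT.
    by move=> /andP[].
  have [c _ cmin] := EVT_min t0 cft.
  by exists (f c) => _ [s st <-]; exact: cmin.
have Sinf0 (t : R) : t < 0 -> inf (S t) = 0.
  move=> t0; rewrite (_ : S t = set0) ?inf0//; rewrite -subset0 => y [s /=].
  rewrite in_itv/= => /andP[s0 st] _.
  by move: (le_lt_trans (le_trans s0 st) t0); rewrite ltxx.
have Sf s t : 0 <= s <= t -> inf (S t) <= f s.
  by move=> st; apply: ge_inf => //; exists s => //=; rewrite in_itv.
have Sge t e : 0 <= t -> (forall s, 0 <= s <= t -> e <= f s) -> e <= inf (S t).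
  move=> t0 H; apply: lb_le_inf.
    by exists (f 0), 0 => //=; rewrite in_itv/= lexx.
  by move=> y [s /=]; rewrite in_itv/= => /H fs <-.
have nd : nondecreasing (regulator x u w).
  move=> s t st; rewrite !SE lerN2 le_min ge_min lexx/=.
  have [s0|s0] := ltP s 0; first by rewrite (Sinf0 s s0) ge_min lexx.
  rewrite ge_min; apply/orP; right; apply: Sge => // r /andP[r0 rs].
  by apply: Sf; rewrite r0 (le_trans rs).
split => // t.
have [t0|t0] := ltP t 0.
  apply: cvg_near_cst; have := nbhs_right_lt t0.
  by apply: filterS => s s0; rewrite !SE !Sinf0.
apply/(@cvgrPdist_le _ R^o) => e e0.
have : \forall s \near t^'+, `|f t - f s| <= e.
  have cft : f @ t^'+ --> f t.
    move/continuous_within_itvcyP : cf => [cfo cf0].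
    move: t0; rewrite le_eqVlt => /predU1P[<-//|t0].
    by apply: cvg_within_filter; apply: cfo; rewrite in_itv/= t0.
  by move/(@cvgrPdist_le _ R^o) : cft; exact.
move=> [/= r r0 rf]; exists r => //= s sr ts.
have st0 : 0 <= s := le_trans t0 (ltW ts).
have eS : inf (S t) - e <= inf (S s).
  apply: Sge => // q /andP[q0 qs].
  have [qt|tq] := leP q t.
    by rewrite (le_trans _ (Sf q t _)) ?q0//; lra.
  have /rf : `|t - q| < r.
    apply: le_lt_trans sr; rewrite !ltr0_norm ?subr_lt0//; lra.
  move=> /(_ tq); rewrite ler_norml => /andP[_].
  have := Sf t t; rewrite t0 lexx => /(_ isT); lra.
have Ss : inf (S s) <= inf (S t).
  apply: Sge => // q /andP[q0 qt]; apply: Sf.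
  by rewrite q0 (le_trans qt)// ltW.
rewrite !SE opprK ler_norml.
have := ltW e0; move: eS Ss; rewrite !minEle; move: (inf _) (inf _) => a b.
by case: ifPn; case: ifPn; rewrite -?ltNge => ? ? ? ? ?; apply/andP; split; lra.
Qed.

Lemma regulator_cumulative x u w : 0 <= x -> w 0 = 0 ->
  {within `[0, +oo[, continuous w} ->
  exists2 G : cumulative R R,
    regulator x u w = G & stieltjes (regulator x u w) = lebesgue_stieltjes_measure G.
Proof.
move=> x0 w0 cw; have [nd rc] := regulator_nondecreasing_rc u x0 w0 cw.
have FG : exists G : cumulative R R, regulator x u w = G.
  pose m := isCumulative.Build R _ R (regulator x u w) nd rc.
  by exists (HB.pack_for (cumulative R R) (regulator x u w) m).
rewrite /stieltjes; case: pselect => // FG'.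
by exists (projT1 (cid FG')) => //; exact: projT2 (cid FG').
Qed.

End reflection.

Section costs.
Context {d : measure_display} {Omega : measurableType d} {R : realType}.
Variables (P : probability Omega R) (W : R -> {RV P >-> R}).
Variables (p : R) (h C : R -> R).
Local Open Scope ereal_scope.

Local Notation mu := (@lebesgue_measure R).
Local Notation L x u w := (regulator x u (fun t => W t w)).
Local Notation X x u w := (reflected x u (fun t => W t w)).

Definition ergodic_cost (u x : R) : \bar R :=
  (h u)%:E + limf_esup (fun T : R => T^-1%:E *
    \int[P]_w ((\int[mu]_(t in `[0%R, T]) (C (X x u w t))%:E)
                + (p * L x u w T)%:E))
    (pinfty_nbhs R).

Definition discounted_cost (alpha u x : R) : \bar R :=
  \int[P]_w
    ((\int[mu]_(t in `[0%R, +oo[)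
        (expR (- (alpha * t)) * (h u + C (X x u w t)))%:E)
     + p%:E * \int[stieltjes (L x u w)]_(t in `[0%R, +oo[)
         (expR (- (alpha * t)))%:E).

Definition horizon_cost (u x T : R) : \bar R :=
  (h u * T)%:E + p%:E * 'E_P[fun w => L x u w T]
  + \int[P]_w \int[mu]_(t in `[0%R, T]) (C (X x u w t))%:E.

Definition ergodic_value (x : R) : \bar R :=
  ereal_inf [set ergodic_cost u x | u in [set u : R | (0 < u)%R]].

Definition discounted_value (alpha x : R) : \bar R :=
  ereal_inf [set discounted_cost alpha u x | u in [set u : R | (0 < u)%R]].

Definition horizon_value (x T : R) : \bar R :=
  ereal_inf [set horizon_cost u x T | u in [set u : R | (0 < u)%R]].

Definition ergodic_optimal (x u : R) : Prop :=
  (0 < u)%R /\ ergodic_cost u x = ergodic_value x.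

Definition discounted_eps_optimal (eps alpha x u : R) : Prop :=
  (0 < u)%R /\ discounted_cost alpha u x < discounted_value alpha x + eps%:E.

Definition horizon_eps_optimal (eps x T u : R) : Prop :=
  (0 < u)%R /\ horizon_cost u x T < horizon_value x T + eps%:E.

End costs.

(* Main.v *)
(** The regulator of the path x - u t + W is a running maximum, so by time reversal of
    the increments the reflected state started at 0 has at time t the law of
    max_(s <= t) (W s - u s).  Its expected cost G u t therefore increases with t and
    decreases with u, and it is bounded in t when u > 0 because a dyadic chaining bound
    makes all moments of that maximum finite uniformly in t.  Multiplied by the rate b
    (b = alpha, or b = 1 / T), the discounted and the finite horizon costs are averages
    of the expected running cost against a kernel bounded by b, plus p times the mean
    regulator rate.  Hence they are at least
    h u + p (u - b x) + (1 - b s) G u s for every s, and at most J u + o(1) as b -> 0,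
    where J u = h u + p u + sup_t G u t is the long-run average cost.  Multiplying by b
    turns eps into b eps, so near-optimal drifts u_n satisfy, for every v > 0,
    h u_n + p u_n + G u_n s <= J v + o(1): h tending to infinity bounds (u_n), and G
    being monotone and right continuous in u bounds J at the limit points.  A limit
    point 0 makes G 0 bounded in t, which forces C to be bounded because W t is
    symmetric and exceeds any given level in absolute value with probability at least
    1 / 2 for large t. *)
Require Import Defs.
From HB Require Import structures.
From mathcomp Require Import all_boot all_order all_algebra.
From mathcomp Require Import all_classical all_reals all_analysis.
From mathcomp Require Import measurable_realfun ring lra.

Set Implicit Arguments.
Unset Strict Implicit.
Unset Printing Implicit Defensive.

Import Order.TTheory GRing.Theory Num.Theory.
Import numFieldNormedType.Exports.

Local Open Scope classical_set_scope.
Local Open Scope ring_scope.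

(** * Regulated paths *)

(** The discounted and finite-horizon costs are never compared with each other. After multiplication
    by b each satisfies the same pair of estimates, [normalized_lower] and [normalized_upper], and
    the limit argument uses nothing else about them; the long-run cost is computed from the same
    pair with b = 1 / T, so no ergodic theorem is involved. The pair is asymmetric on purpose: the
    lower estimate is applied along the varying drifts u_n and must be explicit in the drift, while
    the upper one is applied at a fixed competitor v and may have constants depending on v. The main
    obstacle is that time reversal is an identity of covariances, whereas the cost needs the law of
    a maximum over an interval. Continuity reduces the maximum to countably many times, monotone
    limits to finitely many, and a finite orthant probability is determined by the laws of linear
    combinations, which are Gaussian and hence fixed by their variances. Drift 0 needs its own
    estimates, since the running maximum of a driftless path has no moment bound uniform in t:
    boundedness of C and the spreading of W t replace it. *)

Section dense_sequence.
Context {R : realType}.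

(** The rationals of the unit interval, enumerated through [unpickle]; clamping makes every index
    name a point of it. Scaled by t, they are the countably many times to which conditions on [0, t]
    are reduced. *)
Definition unit_rat (k : nat) : R :=
  Num.max 0 (Num.min 1 (ratr (odflt 0 (unpickle k : option rat)))).

Lemma unit_rat_itv k : 0 <= unit_rat k <= 1.
Proof. by rewrite /unit_rat le_max lexx ge_max ler01 ge_min lexx. Qed.

Lemma unit_rat_dense (s e : R) : 0 <= s <= 1 -> 0 < e ->
  exists k, `|unit_rat k - s| < e.
Proof.
move=> /andP[s0 s1] e0.
have /rat_in_itvoo[q] : s - e < s + e by lra.
rewrite in_itv/= => /andP[q1 q2].
exists (pickle q); rewrite /unit_rat pickleK/=.
by rewrite ltr_norml maxEle minEle; do 2 case: ifPn; rewrite -?ltNge => ? ?;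
  apply/andP; split; lra.
Qed.

End dense_sequence.

Section regulator_paths.
Context {R : realType}.
Implicit Types (x u t s y : R) (w : R -> R).

Lemma within_ge0_continuousP w : {within `[0, +oo[, continuous w} <->
  (forall s e, 0 <= s -> 0 < e -> exists2 d, 0 < d &
     forall r, 0 <= r -> `|r - s| < d -> `|w r - w s| < e).
Proof.
split=> [/subspace_continuousP cw s e s0 e0|cw].
  have /cw : [set` `[0, +oo[] s by rewrite /= in_itv/= s0.
  move/(@cvgrPdist_lt _ R^o) => /(_ _ e0); rewrite near_withinE.
  move=> [d/= d0 dw]; exists d => // r r0 rs; rewrite distrC; apply: dw.
    by rewrite /= distrC.
  by rewrite in_itv/= r0.
apply/subspace_continuousP => s /=; rewrite in_itv/= andbT => s0.
apply/(@cvgrPdist_lt _ R^o) => e e0; rewrite near_withinE.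
have [d d0 dw] := cw s e s0 e0.
by exists d => //= r rs; rewrite in_itv/= andbT => r0; rewrite distrC dw// distrC.
Qed.

Lemma regulator_cont x u w : {within `[0, +oo[, continuous w} ->
  {within `[0, +oo[, continuous (fun s => x - u * s + w s)}.
Proof.
move=> cw z; apply: (@cvgD _ R^o); last exact: cw.
apply: (@continuous_subspaceT _ _ _ (fun s => x - u * s)) => s.
apply: (@cvgB _ R^o); first exact: cvg_cst.
by apply: cvgM; [exact: cvg_cst|exact: cvg_id].
Qed.

Lemma regulator_ge0 x u w t : 0 <= regulator x u w t.
Proof. by rewrite /regulator oppr_ge0 ge_min lexx. Qed.

Section continuous_path.
Variable w : R -> R.
Hypotheses (w0 : w 0 = 0) (cw : {within `[0, +oo[, continuous w}).

(** Every later comparison of regulators goes through this equivalence, which trades the infimum for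
    linear inequalities on the path. Continuity enters through the existence of a lower bound. *)
Lemma regulator_leP x u t y : 0 <= t -> 0 <= y ->
  regulator x u w t <= y <-> (forall s, 0 <= s <= t -> u * s - w s - x <= y).
Proof.
move=> t0 y0.
have cf : {within `[0, t], continuous (fun s => x - u * s + w s)}.
  have cf := @regulator_cont x u w cw.
  apply: continuous_subspaceW cf => s /=.
  by rewrite !in_itv/= andbT => /andP[].
have [c ct cmin] := EVT_min t0 cf.
have Slb : has_lbound [set x - u * s + w s | s in `[0, t]].
  by exists (x - u * c + w c) => _ [s st <-]; exact: cmin.
rewrite /regulator lerNl le_min oppr_le0 y0/=; split => [yi s st|H].
  have : inf [set x - u * s + w s | s in `[0, t]] <= x - u * s + w s.
    by apply: ge_inf => //; exists s => //=; rewrite in_itv.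
  lra.
apply: lb_le_inf.
  by exists (x - u * c + w c), c.
by move=> _ [s /= + <-]; rewrite in_itv/= => /H; lra.
Qed.

Lemma regulator_ge x u t s : 0 <= s <= t -> u * s - w s - x <= regulator x u w t.
Proof.
move=> st; have t0 : 0 <= t by case/andP: st; exact: le_trans.
by have /regulator_leP := lexx (regulator x u w t); apply => //; exact: regulator_ge0.
Qed.

(** A violation at time s is strict, so by continuity it persists at some time t q with q
    rational. *)
Lemma regulator_le_ratP x u t y : 0 <= t -> 0 <= y ->
  regulator x u w t <= y <->
  (forall k, u * (t * unit_rat k) - w (t * unit_rat k) - x <= y).
Proof.
move=> t0 y0; rewrite regulator_leP//; split => [H k|H s /andP[s0 st]].
  have /andP[q0 q1] := unit_rat_itv (R := R) k.
  by apply: H; rewrite mulr_ge0//= ler_piMr.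
rewrite leNgt; apply/negP => ys.
(* The case t = 0 is apart because s / t is what gets approximated below. *)
move: t0; rewrite le_eqVlt => /predU1P[t0|t0].
  move: (H 0%N); rewrite -t0 mul0r => H0.
  have s00 : s = 0 by lra.
  by rewrite s00 in ys; lra.
have e0 : 0 < u * s - w s - x - y by lra.
have /within_ge0_continuousP := @regulator_cont x u w cw.
move=> /(_ s _ s0 e0)[d d0 dw].
have /unit_rat_dense : 0 <= s / t <= 1.
  by rewrite divr_ge0// ?(ltW t0)//= ler_pdivrMr// mul1r.
move=> /(_ (d / t))[|k kd]; first by rewrite divr_gt0.
have /andP[q0 q1] := unit_rat_itv (R := R) k.
have := dw (t * unit_rat k); rewrite mulr_ge0 ?(ltW t0)// => /(_ isT).
have -> : t * unit_rat k - s = t * (unit_rat k - s / t).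
  by rewrite mulrBr mulrCA divff ?gt_eqF// mulr1.
rewrite normrM gtr0_norm// mulrC -ltr_pdivlMr// => /(_ kd).
rewrite ltr_norml => /andP[_]; have := H k; lra.
Qed.

Lemma reflected_ge0 x u t : 0 <= t -> 0 <= reflected x u w t.
Proof.
move=> t0; rewrite /reflected; have := @regulator_ge x u t t.
by rewrite t0 lexx => /(_ isT); lra.
Qed.

Lemma regulator_le0 x u t : 0 <= x -> 0 <= t ->
  regulator x u w t <= regulator 0 u w t.
Proof.
move=> x0 t0; apply/regulator_leP => //; first exact: regulator_ge0.
by move=> s st; have := regulator_ge 0 u st; lra.
Qed.

Lemma reflected_ge0x x u t : 0 <= x -> 0 <= t ->
  reflected 0 u w t <= reflected x u w t.
Proof.
move=> x0 t0; rewrite /reflected.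
have : regulator 0 u w t <= regulator x u w t + x.
  apply/regulator_leP => //; first by rewrite addr_ge0// regulator_ge0.
  by move=> s st; have := regulator_ge x u st; lra.
lra.
Qed.

(** Until its first reflection the state started at x is the free path; from then on it agrees with
    the state started at 0. *)
Lemma reflected_le_max x u t : 0 <= x -> 0 <= t ->
  reflected x u w t <= Num.max (x - u * t + w t) (reflected 0 u w t).
Proof.
move=> x0 t0; rewrite /reflected.
have : regulator x u w t <= Num.max 0 (regulator 0 u w t - x).
  apply/regulator_leP => //; first by rewrite le_max lexx.
  by move=> s st; rewrite le_max; have := regulator_ge 0 u st => ?; apply/orP; right; lra.
by rewrite !le_max => /orP[?|?]; apply/orP; [left|right]; lra.
Qed.

Lemma regulator_nd_u x u v t : u <= v -> 0 <= t ->
  regulator x u w t <= regulator x v w t.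
Proof.
move=> uv t0; apply/regulator_leP => //; first exact: regulator_ge0.
move=> s st; have := regulator_ge x v st.
have : u * s <= v * s by rewrite ler_wpM2r//; case/andP: st.
lra.
Qed.

(** Changing the drift from u to v moves the path by at most (v - u) t on [0, t]. This Lipschitz
    bound is what makes the expected costs right continuous in the drift. *)
Lemma regulator_le_u x u v t : u <= v -> 0 <= t ->
  regulator x v w t <= regulator x u w t + (v - u) * t.
Proof.
move=> uv t0; apply/regulator_leP => //.
  by rewrite addr_ge0 ?regulator_ge0// mulr_ge0// subr_ge0.
move=> s /[dup] st /andP[s0 s1]; have := regulator_ge x u st.
have : (v - u) * s <= (v - u) * t by rewrite ler_wpM2l// subr_ge0.
by rewrite !mulrBl; lra.
Qed.

End continuous_path.

End regulator_paths.

(** * Centred Gaussian variables *)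

Section density.
Context d (T : measurableType d) (R : realType).
Variables (mu nu : {measure set T -> \bar R}) (f : T -> R).
Hypotheses (f0 : forall x, 0 <= f x) (mf : measurable_fun setT f).
Hypothesis nuE : forall A, measurable A -> nu A = (\int[mu]_(x in A) (f x)%:E)%E.
Local Open Scope ereal_scope.
Import HBNNSimple.

(** The density formula is given on sets, and a simple function is a finite combination of
    indicators; [ge0_integral_density] then passes to monotone limits. *)
Lemma nnsfun_integral_density (h : {nnsfun T >-> R}) :
  \int[nu]_x (h x)%:E = \int[mu]_x ((h x)%:E * (f x)%:E).
Proof.
have mE : measurable_fun setT (EFin \o f) by exact/measurable_EFinP.
have hE x : (h x)%:E = \sum_(y \in range h) (y * \1_(h @^-1` [set y]) x)%:E.
  by rewrite fsumEFin// -(fimfunE h x).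
have i0 y x : 0 <= (y * \1_(h @^-1` [set y]) x)%:E.
  exact: nnfun_muleindic_ge0.
have mi y : measurable_fun setT (fun x => (y * \1_(h @^-1` [set y]) x)%:E).
  apply/measurable_EFinP/measurable_funM => //.
transitivity (\sum_(y \in range h) \int[nu]_x (y * \1_(h @^-1` [set y]) x)%:E).
  rewrite -ge0_integral_fsum//.
  by apply: eq_integral => x _; rewrite hE.
transitivity (\sum_(y \in range h)
    \int[mu]_x ((y * \1_(h @^-1` [set y]) x)%:E * (f x)%:E)); last first.
  rewrite -ge0_integral_fsum//; first last.
  - by move=> y x _; rewrite mule_ge0// lee_fin.
  - by move=> y; exact: emeasurable_funM.
  by apply: eq_integral => x _; rewrite hE ge0_mule_fsuml.
apply: eq_fsbigr => y yh.
have y0 : (0 <= y)%R by move: yh; rewrite inE => -[x _ <-].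
under eq_integral do rewrite EFinM.
rewrite ge0_integralZl//; last first.
  exact/measurable_EFinP.
under [RHS]eq_integral do rewrite EFinM -muleA.
rewrite ge0_integralZl//; first last.
- by move=> x _; rewrite mule_ge0 ?lee_fin.
- by apply: emeasurable_funM => //; exact/measurable_EFinP.
congr (_ * _); rewrite integral_indic// setIT nuE//.
rewrite integral_mkcond; apply: eq_integral => x _.
by rewrite epatch_indic muleC.
Qed.

Lemma ge0_integral_density (g : T -> R) : (forall x, 0 <= g x)%R ->
    measurable_fun setT g ->
  \int[nu]_x (g x)%:E = \int[mu]_x ((g x)%:E * (f x)%:E).
Proof.
move=> g0 mg; have mG : measurable_fun setT (EFin \o g) by exact/measurable_EFinP.
have mE : measurable_fun setT (EFin \o f) by exact/measurable_EFinP.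
have G0 x : setT x -> 0 <= (EFin \o g) x by rewrite /= lee_fin.
pose h := nnsfun_approx measurableT mG.
have mh n : measurable_fun setT (fun x => (h n x)%:E).
  exact/measurable_EFinP.
have hg x : (h n x)%:E @[n --> \oo] --> (g x)%:E by exact: (cvg_nnsfun_approx measurableT mG G0).
have ndh x : {homo (fun n => (h n x)%:E) : n m / (n <= m)%N >-> n <= m}.
  by move=> n m nm; rewrite lee_fin; exact/lefP/nd_nnsfun_approx.
transitivity (limn (fun n => \int[nu]_x (h n x)%:E)).
  rewrite -monotone_convergence//; last by move=> n x _; rewrite lee_fin.
  by apply: eq_integral => x _; apply/esym/cvg_lim.
transitivity (limn (fun n => \int[mu]_x ((h n x)%:E * (f x)%:E))).
  by under eq_fun do rewrite nnsfun_integral_density.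
rewrite -monotone_convergence//.
- apply: eq_integral => x _; apply/cvg_lim => //.
  by apply: cvgeZr => //.
- by move=> n; exact: emeasurable_funM.
- by move=> n x _; rewrite mule_ge0// lee_fin.
- by move=> x _ n m nm; rewrite lee_wpmul2r ?lee_fin//; exact: ndh.
Qed.

End density.

Section normal_moments.
Context {R : realType}.
Local Notation mu := (@lebesgue_measure R).
Local Open Scope ereal_scope.
Local Notation N01 := (@normal_prob R 0 1).

Lemma integral_normal_prob (m s : R) (g : R -> R) :
    (forall x, 0 <= g x)%R -> measurable_fun setT g ->
  \int[normal_prob m s]_x (g x)%:E = \int[mu]_x ((g x)%:E * (normal_pdf m s x)%:E).
Proof.
move=> g0 mg; apply: ge0_integral_density => //.
- exact: normal_pdf_ge0.
- exact: measurable_normal_pdf.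
Qed.

Lemma normal_prob_norm (m s : R) : normal_prob m `|s| = normal_prob m s :> (set R -> \bar R).
Proof.
apply/funext => A; rewrite /normal_prob; apply: eq_integral => x _.
by rewrite /normal_pdf normr_eq0 /normal_peak /normal_fun real_normK// num_real.
Qed.

(** Substitution x = m + s z: the derivative s is absorbed by the normalising constant of the
    density. *)
Lemma integral_normal_prob_affine (m s : R) (g : R -> R) : (0 < s)%R ->
    (forall x, 0 <= g x)%R -> continuous g ->
  \int[normal_prob m s]_x (g x)%:E = \int[N01]_z (g (m + s * z)%R)%:E.
Proof.
move=> s0 g0 cg.
have s0' : s != 0%R by rewrite gt_eqF.
pose F (z : R) := (m + s * z)%R.
have cF : continuous F.
  move=> z; apply: (@cvgD _ R^o); first exact: cvg_cst.
  by apply: cvgM; [exact: cvg_cst|exact: cvg_id].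
have dF (z : R^o) : is_derive z (1%R : R^o) F s.
  rewrite /F; apply: is_derive_eq.
  by rewrite add0r mul1r -[_%:A]/(s * 1)%R mulr1.
have F'E : F^`()%classic = cst s.
  by apply/funext => z; rewrite derive1E derive_val.
have mg : measurable_fun setT g by exact: continuous_measurable_fun.
have mgF : measurable_fun setT (fun z => g (m + s * z)%R).
  by apply: continuous_measurable_fun => z; apply: continuous_comp; [exact: cF|exact: cg].
rewrite (integral_normal_prob m s g0 mg).
rewrite (@integral_normal_prob 0 1 (fun z => g (m + s * z)%R) (fun=> g0 _) mgF).
transitivity (\int[mu]_x (g x * normal_pdf m s x)%:E); first by [].
rewrite (@increasing_ge0_integration_by_substitutionT R F
   (fun x => g x * normal_pdf m s x)%R); first last.
- by move=> x; rewrite mulr_ge0// normal_pdf_ge0.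
- by move=> x; apply: cvgM; [exact: cg|exact: continuous_normal_pdf].
- apply/cvgryPge => A.
  apply: filterS (nbhs_pinfty_ge (num_real (s^-1 * (A - m))%R)) => z.
  by rewrite /F -lerBlDl -ler_pdivrMl.
- apply/cvgrNyPle => A.
  apply: filterS (nbhs_ninfty_le (num_real (s^-1 * (A - m))%R)) => z.
  by rewrite /F -lerBrDl -ler_pdivlMl.
- by move=> z; exact: ex_derive.
- by rewrite F'E; exact: is_cvg_cst.
- by rewrite F'E; exact: is_cvg_cst.
- by rewrite F'E => z; exact: cvg_cst.
- by move=> x y xy; rewrite /F ltrD2l ltr_pM2l.
apply: eq_integral => z _; rewrite -EFinM; congr EFin.
rewrite F'E !fctE/= -mulrA; congr (_ * _)%R.
rewrite !normal_pdfE ?oner_neq0// /normal_peak /normal_fun /F.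
have -> : (m + s * z - m = s * z)%R by lra.
rewrite subr0 mulrAC; congr (_ * _)%R; last first.
  by congr expR; rewrite expr1n; field.
rewrite expr1n mul1r -mulrnAr sqrtrM ?sqr_ge0// sqrtr_sqr gtr0_norm//.
by rewrite invfM mulrAC mulVf// mul1r.
Qed.

(** Half of the exponent pays for the power: y^k / k! <= e^y at y = z^2 / 4 gives z^(2k) e^(-z^2/4)
    <= 4^k k!. The other half, e^(-z^2/4), is up to a constant the density of variance 2, hence
    integrable. *)
Lemma normal_even_moment_fin k :
  \int[N01]_z (z ^+ k.*2)%:E < +oo.
Proof.
rewrite integral_normal_prob//; last by move=> x; rewrite exprn_even_ge0// odd_double.
pose s2 : R := Num.sqrt 2.
have s20 : s2 != 0%R by rewrite gt_eqF// sqrtr_gt0.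
pose c : R := (4 ^+ k * k`!%:R * (normal_peak 1 / normal_peak s2))%R.
have c0 : (0 <= c)%R by rewrite mulr_ge0// divr_ge0// normal_peak_ge0.
apply: (@le_lt_trans _ _ (\int[mu]_z (c%:E * (normal_pdf 0 s2 z)%:E))); last first.
  rewrite ge0_integralZl//.
  - by rewrite integral_normal_pdf mule1 ltry.
  - by apply/measurable_EFinP; exact: measurable_normal_pdf.
  - by move=> x _; rewrite lee_fin normal_pdf_ge0.
apply: ge0_le_integral => //.
- move=> z _; rewrite -EFinM lee_fin mulr_ge0 ?normal_pdf_ge0//.
  by rewrite exprn_even_ge0// odd_double.
- apply: emeasurable_funM; apply/measurable_EFinP => //.
  exact: measurable_normal_pdf.
- apply: emeasurable_funM; apply/measurable_EFinP => //.
  exact: measurable_normal_pdf.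
move=> z _; rewrite -!EFinM lee_fin !normal_pdfE ?oner_neq0// /normal_fun.
rewrite subr0 !expr1n sqr_sqrtr// /c.
set a := normal_peak 1; set b := normal_peak s2.
have a0 : (0 <= a)%R by exact: normal_peak_ge0.
have b0 : (0 < b)%R by exact: normal_peak_gt0.
have -> : (4 ^+ k * k`!%:R * (a / b) * (b * expR (- z ^+ 2 / (2 *+ 2))) =
  a * (4 ^+ k * k`!%:R * expR (- z ^+ 2 / (2 *+ 2))))%R by field; rewrite gt_eqF.
rewrite mulrCA ler_wpM2l//.
have -> : (- z ^+ 2 / (1 *+ 2) = - z ^+ 2 / (2 *+ 2) - z ^+ 2 / 4)%R.
  by rewrite -(mulr_natr 2 2); field.
rewrite expRD mulrCA [leRHS]mulrC ler_wpM2l ?expR_ge0//.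
rewrite expRN ler_pdivrMr ?expR_gt0//.
have z40 : (0 <= z ^+ 2 / 4)%R by rewrite divr_ge0// sqr_ge0.
apply: (@le_trans _ _ (4 ^+ k * k`!%:R * ((z ^+ 2 / 4) ^+ k / k`!%:R))%R).
  rewrite expr_div_n -exprM mul2n.
  have -> : (4 ^+ k * k`!%:R * (z ^+ k.*2 / 4 ^+ k / k`!%:R) = z ^+ k.*2 :> R)%R => //.
  by field; rewrite expf_neq0 ?pnatr_eq0//= -lt0n fact_gt0.
rewrite ler_wpM2l//; clear -z40; case: k z z40 => [|k] z z40.
  by rewrite expr0 fact0 divr1 -[leLHS]expR0 ler_expR.
by have := expR_ge1Dxn k z40; lra.
Qed.

End normal_moments.

Section standard_normal.
Context {R : realType}.
Local Notation mu := (@lebesgue_measure R).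
Local Notation N01 := (@normal_prob R 0 1).

Lemma integralT_even_split (G : R -> R) : continuous G -> (forall x, 0 <= G x) ->
  (\int[mu]_x (G x)%:E =
   \int[mu]_(x in `[0%R, +oo[) (G (- x))%:E + \int[mu]_(x in `[0%R, +oo[) (G x)%:E)%E.
Proof.
move=> cG G0.
have mG : measurable_fun setT (fun x => (G x)%:E).
  by apply/measurable_EFinP; exact: continuous_measurable_fun.
have := @ge0_integration_by_substitutionNy R G 0; rewrite oppr0 => <-; first last.
- by move=> x _; exact: G0.
- exact: continuous_subspaceT.
rewrite -(@setvU _ [set` Interval (BLeft (0:R)) +oo%O]) setCitvr ge0_integral_setU//=.
- congr (_ + _)%E; apply: integral_itv_bndo_bndc.
  exact: measurable_funTS.
- exact: measurable_funTS.
- by move=> x _; rewrite lee_fin.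
- rewrite disj_set2E; apply/eqP; rewrite -subset0 => x []/= /[!in_itv]/=.
  by rewrite andbT ltNge => /negP.
Qed.

Lemma integral_std_normalN (g : R -> R) : continuous g -> (forall x, 0 <= g x) ->
  (\int[N01]_x (g (- x))%:E = \int[N01]_x (g x)%:E)%E.
Proof.
move=> cg g0.
have cgN : continuous (fun x => g (- x)).
  by move=> x; apply: continuous_comp; [exact: opp_continuous|exact: cg].
have pN (x : R) : normal_pdf 0 1 (- x) = normal_pdf 0 1 x.
  by rewrite !normal_pdfE ?oner_neq0// /normal_fun !subr0 sqrrN.
rewrite !integral_normal_prob//; [|exact: continuous_measurable_fun..].
have sg f : (\int[mu]_x ((f x)%:E * (normal_pdf 0 1 x)%:E) =
    \int[mu]_x (f x * normal_pdf 0 1 x)%:E)%E by [].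
rewrite !sg integralT_even_split; first last.
- by move=> x; rewrite mulr_ge0 ?normal_pdf_ge0.
- by move=> x; apply: cvgM; [exact: cgN|apply: continuous_normal_pdf; rewrite oner_neq0].
rewrite [RHS]integralT_even_split; first last.
- by move=> x; rewrite mulr_ge0 ?normal_pdf_ge0.
- by move=> x; apply: cvgM; [exact: cg|apply: continuous_normal_pdf; rewrite oner_neq0].
rewrite addeC; apply: (f_equal2 adde).
  by apply: eq_integral => x _; rewrite pN.
by apply: eq_integral => x _; rewrite opprK pN.
Qed.

Lemma integral_std_normal_cst (r : R) : (\int[N01]_x r%:E = r%:E)%E.
Proof.
rewrite integral_cst//; transitivity (r%:E * 1)%E; last by rewrite mule1.
by congr (_ * _)%E; exact: probability_setT.
Qed.

(** The even moments stay unevaluated constants: only their finiteness and the positivity of the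
    second one matter. *)
Definition normal_moment k : R := fine (\int[N01]_z (z ^+ k.*2)%:E)%E.

Lemma normal_momentE k : (\int[N01]_z (z ^+ k.*2)%:E = (normal_moment k)%:E)%E.
Proof.
rewrite /normal_moment fineK// ge0_fin_numE ?normal_even_moment_fin//.
by apply: integral_ge0 => z _; rewrite lee_fin exprn_even_ge0// odd_double.
Qed.

Lemma normal_moment_ge0 k : 0 <= normal_moment k.
Proof.
by rewrite fine_ge0// integral_ge0// => z _; rewrite lee_fin exprn_even_ge0// odd_double.
Qed.

(** A zero second moment would concentrate the law on the origin, which has no mass. The moment is
    later the divisor that turns a variance into a squared scale. *)
Lemma normal_moment1_gt0 : 0 < normal_moment 1.
Proof.
rewrite lt_neqAle normal_moment_ge0 andbT eq_sym; apply/eqP => k0.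
have : (\int[N01]_z `|(z ^+ 2)%:E| = 0)%E.
  transitivity (\int[N01]_z (z ^+ 1.*2)%:E)%E; last by rewrite normal_momentE k0.
  apply: eq_integral => z _.
  by rewrite gee0_abs// lee_fin sqr_ge0.
move=> /ae_eq_integral_abs[]//.
  by apply/measurable_EFinP.
move=> N [mN N0 sN].
have : (N01 [set: R] <= N01 (N `|` [set 0%R]))%E.
  apply: le_measure; rewrite ?inE//.
    exact: measurableU.
  move=> z _; have [->|z0] := eqVneq z 0; first by right.
  left; apply: sN => /= /(_ I) [] /eqP.
  by rewrite expf_eq0 (negbTE z0) andbF.
rewrite probability_setT; apply/negP; rewrite -ltNge.
apply: (@le_lt_trans _ _ (N01 N + N01 [set 0%R])%E).
  exact: measureU2.
by rewrite N0 add0e /normal_prob integral_set1 lte01.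
Qed.

(** This expresses that the standard normal law has mean 0 through integrals of nonnegative
    functions only, for which the transfer formulas hold. *)
Lemma normal_first_moment :
  (\int[N01]_z (Num.max z 0)%:E = \int[N01]_z (Num.max (- z) 0)%:E)%E /\
  (\int[N01]_z (Num.max z 0)%:E < +oo)%E.
Proof.
have c0 : continuous (fun z : R => Num.max z 0).
  by move=> z; apply: continuous_max; [exact: cvg_id|exact: cvg_cst].
have m0 (z : R) : 0 <= Num.max z 0 by rewrite le_max lexx orbT.
split; first by rewrite -(integral_std_normalN c0).
apply: (@le_lt_trans _ _ (\int[N01]_z (1 + z ^+ 2)%:E)%E).
  apply: ge0_le_integral => //.
  - by move=> z _; rewrite lee_fin.
  - by apply/measurable_EFinP; exact: continuous_measurable_fun.
  - by apply/measurable_EFinP; apply: measurable_funD => //; exact: measurable_funX.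
  move=> z _; rewrite lee_fin ge_max.
  have : 0 <= (1 - z) ^+ 2 by exact: sqr_ge0.
  have : 0 <= z ^+ 2 by exact: sqr_ge0.
  by rewrite sqrrB expr1n mul1r => *; apply/andP; split; lra.
under eq_integral do rewrite EFinD.
rewrite ge0_integralD//.
- by rewrite integral_std_normal_cst (normal_momentE 1) ltry.
- by move=> z _; rewrite lee_fin sqr_ge0.
- by apply/measurable_EFinP; exact: measurable_funX.
Qed.

End standard_normal.

Section gaussian_law.
Context {d} {Omega : measurableType d} {R : realType}.
Variable P : probability Omega R.
Local Notation N01 := (@normal_prob R 0 1).
Implicit Types (Z : {RV P >-> R}).

(** One integral formula covers both clauses of [gaussian_rv]: for s = 0 the affine image m + s z is
    the constant m. The scale can be taken nonnegative since the normal law only depends on its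
    absolute value. *)
Lemma gaussian_transfer Z : gaussian_rv P Z ->
  exists m s : R, [/\ 0 <= s,
    forall A, measurable A ->
      P (Z @^-1` A) = if s == 0 then \d_m A else normal_prob m s A &
    forall g : R -> R, continuous g -> (forall x, 0 <= g x) ->
      (\int[P]_w (g (Z w))%:E = \int[N01]_z (g (m + s * z))%:E)%E].
Proof.
move=> [m [s ZE]]; exists m, `|s|; split; first exact: normr_ge0.
  move=> A mA; rewrite (ZE A mA) normr_eq0; case: (s == 0); first by [].
  exact: (congr1 (fun f => f A) (esym (normal_prob_norm m s))).
move=> g cg g0.
have mg : measurable_fun setT (EFin \o g).
  by apply/measurable_EFinP; exact: continuous_measurable_fun.
have [s0|s0] := eqVneq s 0.
  rewrite -[LHS](@ge0_integral_distribution _ _ _ _ _ P Z (EFin \o g))//.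
  rewrite (@eq_measure_integral _ _ _ _ (@dirac _ _ m R)); last first.
    by move=> A mA _; have := ZE A mA; rewrite s0 eqxx.
  rewrite integral_dirac// diracE in_setT mul1e.
  rewrite -[LHS]integral_std_normal_cst; apply: eq_integral => z _.
  by rewrite s0 normr0 mul0r addr0.
have mZ : @measurable_fun _ _ Omega (measurableTypeR R) setT Z.
  exact: (measurable_funPT Z).
rewrite -[LHS](@ge0_integral_pushforward _ _ _ (measurableTypeR R) _ _ mZ P setT (EFin \o g))//.
transitivity (\int[normal_prob m `|s|]_y (g y)%:E)%E.
  apply: (@eq_measure_integral _ _ _ _ (normal_prob m `|s|)) => A mA _.
  have := ZE A mA; rewrite (negbTE s0) => ZA.
  rewrite [LHS]ZA.
  exact: (congr1 (fun f => f A) (esym (normal_prob_norm m s))).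
apply: integral_normal_prob_affine; [by rewrite normr_gt0|exact: g0|exact: cg].
by move=> y _; rewrite lee_fin.
Qed.

(** A vanishing expectation equates the integrals of the positive and negative parts of m + s z.
    Since those parts of z balance as well, the positive and negative parts of m must agree. *)
Lemma centered_gaussian_transfer Z : gaussian_rv P Z -> ('E_P[Z] = 0)%E ->
  exists s : R, [/\ 0 <= s,
    forall A, measurable A ->
      P (Z @^-1` A) = if s == 0 then \d_(0 : R) A else normal_prob 0 s A &
    forall g : R -> R, continuous g -> (forall x, 0 <= g x) ->
      (\int[P]_w (g (Z w))%:E = \int[N01]_z (g (s * z))%:E)%E].
Proof.
move=> /gaussian_transfer[m [s [s0 ZE gE]]] EZ.
suff m0 : m = 0.
  exists s; split; [exact: s0|by move: ZE; rewrite m0|move=> g cg g0].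
  by rewrite gE// m0; under eq_integral do rewrite add0r.
have cp : continuous (fun z : R => Num.max z 0).
  by move=> z; apply: continuous_max; [exact: cvg_id|exact: cvg_cst].
have cn : continuous (fun z : R => Num.max (- z) 0).
  by move=> z; apply: continuous_max; [exact: opp_continuous|exact: cvg_cst].
have p0 (z : R) : 0 <= Num.max z 0 by rewrite le_max lexx orbT.
have pE (z : R) : ((Num.max z 0)%:E = maxe z%:E 0)%E by rewrite EFin_max.
have mp (f : R -> R) : continuous f -> measurable_fun setT (fun z => (f z)%:E).
  by move=> cf; apply/measurable_EFinP; exact: continuous_measurable_fun.
have [n1 n2] := @normal_first_moment R.
set a := (\int[N01]_z (Num.max (m + s * z) 0)%:E)%E.
set b := (\int[N01]_z (Num.max (- (m + s * z)) 0)%:E)%E.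
set c := (\int[N01]_z (Num.max z 0)%:E)%E in n1 n2.
have ca : continuous (fun z : R => m + s * z).
  move=> z; apply: (@cvgD _ R^o); first exact: cvg_cst.
  by apply: cvgM; [exact: cvg_cst|exact: cvg_id].
have cap : continuous (fun z => Num.max (m + s * z) 0).
  by move=> z; exact: (@continuous_comp _ _ _ (fun z => m + s * z)
    (fun z => Num.max z 0) z (ca z) (cp _)).
have can : continuous (fun z => Num.max (- (m + s * z)) 0).
  by move=> z; exact: (@continuous_comp _ _ _ (fun z => m + s * z)
    (fun z => Num.max (- z) 0) z (ca z) (cn _)).
have c_fin : c \is a fin_num.
  by rewrite ge0_fin_numE// integral_ge0// => z _; rewrite lee_fin.
have mx (u v : R) : Num.max (u + v) 0 <= Num.max u 0 + Num.max v 0.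
  by rewrite !maxEle; do 3 case: ifPn; rewrite -?ltNge => *; lra.
have sx (u : R) : Num.max (s * u) 0 = s * Num.max u 0.
  by rewrite maxr_pMr// mulr0.
have Zl (f : R -> R) : continuous f -> (forall z, 0 <= f z) ->
    (\int[N01]_z (s%:E * (f z)%:E) = s%:E * \int[N01]_z (f z)%:E)%E.
  move=> cf f0; rewrite ge0_integralZl//; first exact: mp.
  by move=> z _; rewrite lee_fin.
have fa (q : R) (f : R -> R) : continuous f -> (forall z, 0 <= f z) -> 
    (forall z, f z <= q + s * Num.max z 0 + s * Num.max (- z) 0) -> 0 <= q ->
    (\int[N01]_z (f z)%:E)%E \is a fin_num.
  move=> cf f0 fle q0.
  rewrite ge0_fin_numE ?integral_ge0//; last by move=> z _; rewrite lee_fin.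
  apply: (@le_lt_trans _ _ (\int[N01]_z (q%:E + s%:E * (Num.max z 0)%:E
     + s%:E * (Num.max (- z) 0)%:E))%E).
    apply: ge0_le_integral => //.
    - by move=> z _; rewrite lee_fin.
    - exact: mp.
    - apply: emeasurable_funD; first apply: emeasurable_funD => //.
        by apply: emeasurable_funM => //; exact: mp.
      by apply: emeasurable_funM => //; exact: mp.
    - by move=> z _; rewrite -!EFinM -!EFinD lee_fin.
  rewrite !ge0_integralD//; first last.
  - by apply: emeasurable_funM => //; exact: mp.
  - by move=> z _; rewrite -EFinM lee_fin mulr_ge0.
  - by apply: emeasurable_funD => //; apply: emeasurable_funM => //; exact: mp.
  - by move=> z _; rewrite -EFinM -EFinD lee_fin addr_ge0// mulr_ge0.
  - by apply: emeasurable_funM => //; exact: mp.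
  - by move=> z _; rewrite -EFinM lee_fin mulr_ge0.
  rewrite integral_std_normal_cst.
  by rewrite (Zl _ cp)// (Zl _ cn)// -/c -n1 -(fineK c_fin) -!EFinM -!EFinD ltry.
have a_fin : a \is a fin_num.
  apply: (fa (Num.max m 0)) => // z.
  apply: (le_trans (mx _ _)); rewrite sx lerDl mulr_ge0//.
have b_fin : b \is a fin_num.
  apply: (fa (Num.max (- m) 0)) => // z.
  rewrite opprD -mulrN; apply: (le_trans (mx _ _)); rewrite sx.
  by rewrite addrAC lerDl mulr_ge0.
have ab : a = b.
  have := EZ; rewrite unlock integralE.
  have -> : (\int[P]_w (((fun w => (Z w)%:E)^\+) w) = a)%E.
    rewrite /a -(gE (fun z => Num.max z 0))//; apply: eq_integral => w _.
    by rewrite funeposE pE.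
  have -> : (\int[P]_w (((fun w => (Z w)%:E)^\-) w) = b)%E.
    rewrite /b -(gE (fun z => Num.max (- z) 0))//; apply: eq_integral => w _.
    by rewrite funenegE pE EFinN.
  rewrite -(fineK a_fin) -(fineK b_fin) => -[] /eqP; rewrite subr_eq0 => /eqP.
  by move=> ->.
(* Integrated form of (m + s z)^+ + s z^- + m^- = (m + s z)^- + s z^+ + m^+; the symmetry [n1] lets
   both half moments of z be written c. *)
have : (a + s%:E * c + (Num.max (- m) 0)%:E = b + s%:E * c + (Num.max m 0)%:E)%E.
  have e (q : R) (f g : R -> R) : continuous f -> continuous g ->
     (forall z, 0 <= f z) -> (forall z, 0 <= g z) -> 0 <= q ->
     (\int[N01]_z (f z)%:E + s%:E * \int[N01]_z (g z)%:E + q%:E =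
      \int[N01]_z (f z + s * g z + q)%:E)%E.
    move=> cf cg f0 g0 q0.
    have mf := mp f cf; have mg : measurable_fun setT (fun z => s%:E * (g z)%:E)%E.
      by apply: emeasurable_funM => //; exact: mp.
    have f0' z : (0 <= (f z)%:E)%E by rewrite lee_fin.
    have g0' z : (0 <= s%:E * (g z)%:E)%E by rewrite -EFinM lee_fin mulr_ge0.
    transitivity (\int[N01]_z ((f z)%:E + s%:E * (g z)%:E + q%:E))%E; last first.
      by apply: eq_integral => z _; rewrite 2!EFinD EFinM.
    rewrite ge0_integralD//; [|by move=> z _; rewrite adde_ge0|exact: emeasurable_funD].
    rewrite ge0_integralD//.
    by rewrite integral_std_normal_cst Zl.
  rewrite {1}n1 /a /b e// e//; apply: eq_integral => z _; congr EFin.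
  have posneg (y : R) : Num.max y 0 = y + Num.max (- y) 0.
    by rewrite !maxEle; do 2 case: ifPn; rewrite -?ltNge => *; lra.
  rewrite -!sx mulrN; have := posneg (m + s * z); have := posneg (s * z); have := posneg m; lra.
rewrite ab -(fineK b_fin) -(fineK c_fin) -EFinM -!EFinD => -[].
by rewrite !maxEle; do 2 case: ifPn; rewrite -?ltNge => *; lra.
Qed.

End gaussian_law.

Section gaussian_consequences.
Context {d} {Omega : measurableType d} {R : realType}.
Variable P : probability Omega R.
Local Notation N01 := (@normal_prob R 0 1).
Implicit Types (Z : {RV P >-> R}).

Definition centered_gaussian Z := gaussian_rv P Z /\ ('E_P[Z] = 0)%E.

Lemma centered_gaussian_scale Z : centered_gaussian Z ->
  exists s : R, [/\ 0 <= s,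
    forall A, measurable A ->
      P (Z @^-1` A) = if s == 0 then \d_(0 : R) A else normal_prob 0 s A &
    forall k, (\int[P]_w (Z w ^+ k.*2)%:E = (s ^+ k.*2 * normal_moment k)%:E)%E].
Proof.
move=> [/centered_gaussian_transfer gZ /gZ[s [s0 ZE gE]]]; exists s; split=> // k.
have e0 (z : R) : 0 <= z ^+ k.*2 by rewrite exprn_even_ge0// odd_double.
rewrite (gE (fun z => z ^+ k.*2))//; last exact: exprn_continuous.
under eq_integral do rewrite exprMn EFinM.
rewrite ge0_integralZl//.
- by rewrite normal_momentE -EFinM.
- by apply/measurable_EFinP; exact: measurable_funX.
- by move=> z _; rewrite lee_fin.
- by rewrite lee_fin.
Qed.

(* The scale is recovered from the second moment. *)
Lemma centered_gaussian_law Z v : centered_gaussian Z ->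
    (\int[P]_w (Z w ^+ 2)%:E = v%:E)%E ->
  0 <= v /\
  let s := Num.sqrt (v / normal_moment 1) in
  (forall A, measurable A ->
     P (Z @^-1` A) = if s == 0 then \d_(0 : R) A else normal_prob 0 s A) /\
  forall k, (\int[P]_w (Z w ^+ k.*2)%:E = ((v / normal_moment 1) ^+ k * normal_moment k)%:E)%E.
Proof.
move=> /centered_gaussian_scale[s [s0 ZE mE]] Zv.
have k0 := @normal_moment1_gt0 R.
have := mE 1; rewrite Zv => -[] vE.
have -> : v / normal_moment 1 = s ^+ 2 by rewrite vE mulfK// gt_eqF.
rewrite sqrtr_sqr ger0_norm//; split.
  by rewrite vE mulr_ge0 ?sqr_ge0// ltW.
by split=> // k; rewrite mE -exprM mul2n.
Qed.

(** The constant precedes Z and v: it later serves all increments of the process at once. *)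
Lemma gaussian_moment_le k : exists2 c : R, 0 <= c & forall Z v,
  centered_gaussian Z -> (\int[P]_w (Z w ^+ 2)%:E = v%:E)%E ->
  (\int[P]_w (Z w ^+ k.*2)%:E = (c * v ^+ k)%:E)%E.
Proof.
have k0 := @normal_moment1_gt0 R.
exists (normal_moment k / normal_moment 1 ^+ k).
  by rewrite divr_ge0 ?exprn_ge0 ?normal_moment_ge0.
move=> Z v gZ /(centered_gaussian_law gZ)[_ [_ ->]].
congr EFin; rewrite expr_div_n; field; rewrite expf_neq0// gt_eqF//.
Qed.

(** A centred normal density of scale s is at most 1 / s, as sqrt(2 pi s^2) >= s, so an interval of
    length 2 c has mass at most 2 c / s. The summand 1 in [s0] keeps the scale positive when c =
    0. *)
Lemma gaussian_small_ball (c e : R) : 0 <= c -> 0 < e ->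
  exists V, forall Z v,
  centered_gaussian Z -> (\int[P]_w (Z w ^+ 2)%:E = v%:E)%E -> V <= v ->
  (P (Z @^-1` `[(- c)%R, c]) <= e%:E)%E.
Proof.
move=> c0 e0; have k0 := @normal_moment1_gt0 R.
pose s0 := (2 * c + 1) / e.
have s00 : 0 < s0 by rewrite divr_gt0//; lra.
exists (s0 ^+ 2 * normal_moment 1) => Z v gZ Zv Vv.
have [v0 [ZE _]] := centered_gaussian_law gZ Zv.
set s := Num.sqrt _ in ZE.
have s0s : s0 <= s.
  have vk0 : 0 <= v / normal_moment 1 by rewrite divr_ge0// ltW.
  by rewrite -(ger0_norm (ltW s00)) -sqrtr_sqr ler_sqrt// ler_pdivlMr.
have spos : 0 < s by exact: lt_le_trans s0s.
rewrite ZE// gt_eqF// /normal_prob.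
apply: (@le_trans _ _ (\int[@lebesgue_measure R]_(x in `[(- c)%R, c]) (s^-1)%:E)%E).
  apply: ge0_le_integral => //.
  - by move=> x _; rewrite lee_fin normal_pdf_ge0.
  - by apply/measurable_EFinP/measurable_funTS; exact: measurable_normal_pdf.
  move=> x _; rewrite lee_fin (le_trans (normal_pdf_ub _ _ _)) ?gt_eqF//.
  have q0 : 0 < s ^+ 2 * pi *+ 2 by rewrite mulrn_wgt0// mulr_gt0 ?pi_gt0// exprn_gt0.
  have sq : s <= Num.sqrt (s ^+ 2 * pi *+ 2).
    rewrite -[leLHS](ger0_norm (ltW spos)) -sqrtr_sqr ler_sqrt ?(ltW q0)//.
    rewrite -mulr_natr -mulrA ler_peMr ?sqr_ge0//.
    by have := pi_ge2 R; lra.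
  by rewrite /normal_peak lef_pV2 ?posrE// sqrtr_gt0.
rewrite integral_cst//= lebesgue_measure_itv/= lte_fin.
case: ifPn => [_|_]; last by rewrite mule0 lee_fin ltW.
rewrite -EFinB -EFinM lee_fin mulrC ler_pdivrMr// -ler_pdivrMl//.
rewrite mulrC opprK; apply: le_trans s0s; rewrite /s0 ler_pM2r ?invr_gt0//; lra.
Qed.

Lemma centered_gaussian_eq_law Z Z' v : centered_gaussian Z -> centered_gaussian Z' ->
  (\int[P]_w (Z w ^+ 2)%:E = v%:E)%E -> (\int[P]_w (Z' w ^+ 2)%:E = v%:E)%E ->
  forall A, measurable A -> P (Z @^-1` A) = P (Z' @^-1` A).
Proof.
move=> gZ gZ' Zv Z'v A mA.
have [_ [-> // _]] := centered_gaussian_law gZ Zv.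
by have [_ [-> // _]] := centered_gaussian_law gZ' Z'v.
Qed.

End gaussian_consequences.

Arguments centered_gaussian {d Omega R} P Z.

(** * Equality in law of finite families *)

Section sign_iterate.
Context {R : realType}.

(** An odd polynomial fixing -1, 0 and 1. Its iterates on [-1, 1] converge to the sign function
    while remaining polynomials. *)
Definition smoothstep (z : R) : R := (3 * z - z ^+ 3) / 2.

Lemma smoothstepN z : smoothstep (- z) = - smoothstep z.
Proof. by rewrite /smoothstep; field. Qed.

Lemma iter_smoothstepN m z : iter m smoothstep (- z) = - iter m smoothstep z.
Proof. by elim: m => //= m ->; rewrite smoothstepN. Qed.

(** The iterates y increase from z, and 1 - y is multiplied at each step by (1 - y) (2 + y) / 2 = 1
    - y / 2 - y^2 / 2, which is at most 1 - z / 2. *)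
Lemma iter_smoothstep_pos m z : 0 <= z <= 1 ->
  [/\ z <= iter m smoothstep z, iter m smoothstep z <= 1 &
      1 - iter m smoothstep z <= (1 - z / 2) ^+ m].
Proof.
move=> /andP[z0 z1]; elim: m => [|m [IH1 IH2 IH3]] /=.
  by rewrite lexx expr0; split=> //; lra.
set y := iter m smoothstep z in IH1 IH2 IH3 *.
have e : 1 - smoothstep y = (1 - y) * ((1 - y) * (2 + y) / 2).
  by rewrite /smoothstep; field.
have e' : smoothstep y - y = y * (1 - y) * (1 + y) / 2 by rewrite /smoothstep; field.
have y0 : 0 <= y by exact: le_trans IH1.
have p1 : 0 <= y * (1 - y) * (1 + y) / 2.
  by rewrite divr_ge0// mulr_ge0// ?mulr_ge0//; lra.
have p2 : 0 <= (1 - y) * ((1 - y) * (2 + y) / 2).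
  by rewrite mulr_ge0 ?divr_ge0 ?mulr_ge0//; lra.
split; [lra|lra|].
rewrite e exprSr; apply: ler_pM => //; first lra.
  by rewrite divr_ge0 ?mulr_ge0//; lra.
have : 0 <= y ^+ 2 by exact: sqr_ge0.
by rewrite (_ : (1 - y) * (2 + y) / 2 = 1 - y / 2 - y ^+ 2 / 2); [lra|field].
Qed.

Lemma iter_smoothstep_bound m z : `|z| <= 1 -> `|iter m smoothstep z| <= 1.
Proof.
wlog z0 : z / 0 <= z => [H z1|].
  have [/H->//|/ltW z0] := leP 0 z.
  by rewrite -[z]opprK iter_smoothstepN normrN H ?oppr_ge0// normrN.
rewrite ger0_norm// => z1.
have [] := @iter_smoothstep_pos m z; first by rewrite z0.
by move=> zi i1 _; rewrite ger0_norm// (le_trans z0).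
Qed.

Lemma cvg_iter_smoothstep z : `|z| <= 1 -> iter m smoothstep z @[m --> \oo] --> Num.sg z.
Proof.
have pos y : 0 < y <= 1 -> iter m smoothstep y @[m --> \oo] --> (1 : R).
  move=> /andP[y0 y1].
  have y01 : 0 <= y <= 1 by rewrite (ltW y0).
  apply: (@squeeze_cvgr _ _ _ _ (fun m => 1 - (1 - y / 2) ^+ m) (fun=> 1)).
  - near=> m; have [? ? ?] := iter_smoothstep_pos m y01.
    by apply/andP; split; lra.
  - rewrite -[X in _ --> X]subr0; apply: (@cvgB _ R^o); first exact: cvg_cst.
    by apply: cvg_expr; rewrite ger0_norm; lra.
  - exact: cvg_cst.
have [z0|z0|z0] := ltrgtP 0 z => z1.
- by rewrite gtr0_sg//; apply: pos; move: z1; rewrite gtr0_norm ?z0.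
- rewrite ltr0_sg//; rewrite (_ : (fun m => _) = fun m => - iter m smoothstep (- z)).
    apply: (@cvgN _ R^o); apply: pos; rewrite oppr_gt0 z0/=.
    by move: z1; rewrite ltr0_norm.
  by apply/funext => m; rewrite iter_smoothstepN opprK.
- rewrite -z0 sgr0 (_ : (fun m => _) = fun=> 0); first exact: cvg_cst.
  by apply/funext; elim=> //= m ->; rewrite /smoothstep; field.
Unshelve. all: by end_near. Qed.

End sign_iterate.

Section trigonometric_polynomials.
Context {R : realType} {n : nat}.
Implicit Types (F G : ('I_n -> R) -> R).

(** The phase makes sines and constants special cases, and the product formula for cosines closes
    the class under multiplication; hence a polynomial in members of the class is again a member. *)
Inductive trig_poly : (('I_n -> R) -> R) -> Prop :=
| trig_cos a b c : trig_poly (fun y => c * cos (\sum_(i < n) a i * y i + b))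
| trig_add F G : trig_poly F -> trig_poly G -> trig_poly (fun y => F y + G y).

Lemma trig_ext F G : (forall y, F y = G y) -> trig_poly F -> trig_poly G.
Proof. by move=> FG; have -> // : G = F by apply/funext. Qed.

Lemma trig_cst c : trig_poly (fun=> c).
Proof.
apply: (@trig_ext (fun y => c * cos (\sum_(i < n) (fun=> 0) i * y i + 0))).
  by move=> y; rewrite addr0 big1 ?cos0 ?mulr1// => i _; rewrite mul0r.
exact: trig_cos.
Qed.

Lemma trig_scale c F : trig_poly F -> trig_poly (fun y => c * F y).
Proof.
elim=> [a b c'|{}F G _ IHF _ IHG].
  by apply: trig_ext (trig_cos a b (c * c')) => y; rewrite mulrA.
by apply: trig_ext (trig_add IHF IHG) => y; rewrite mulrDr.
Qed.

Lemma trig_mul F G : trig_poly F -> trig_poly G -> trig_poly (fun y => F y * G y).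
Proof.
move=> tF tG; elim: tF => [a b c|{}F F' _ IHF _ IHF']; last first.
  by apply: trig_ext (trig_add IHF IHF') => y; rewrite mulrDl.
elim: tG => [a' b' c'|{}G G' _ IHG _ IHG']; last first.
  by apply: trig_ext (trig_add IHG IHG') => y; rewrite mulrDr.
apply: trig_ext (trig_add (trig_cos (fun i => a i + a' i) (b + b') (c * c' / 2))
  (trig_cos (fun i => a i - a' i) (b - b') (c * c' / 2))) => y.
set u := \sum_(i < n) a i * y i + b; set v := \sum_(i < n) a' i * y i + b'.
have -> : \sum_(i < n) (a i + a' i) * y i + (b + b') = u + v.
  by rewrite /u /v addrACA -big_split/=; congr (_ + _); apply: eq_bigr => i _; rewrite mulrDl.
have -> : \sum_(i < n) (a i - a' i) * y i + (b - b') = u - v.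
  rewrite /u /v opprD addrACA -sumrN -big_split/=; congr (_ + _).
  by apply: eq_bigr => i _; rewrite mulrBl.
by rewrite cosB cosD; field.
Qed.

Lemma trig_sin i N b : trig_poly (fun y => sin ((y i - b) / N)).
Proof.
apply: trig_ext (trig_cos (fun j => (j == i)%:R / N) (- (b / N) - pi / 2) 1) => y.
rewrite mul1r addrA cosBpihalf mulrBl (bigD1 i)//= eqxx mul1r big1 ?addr0; last first.
  by move=> j /negbTE ->; rewrite !mul0r.
by rewrite mulrC.
Qed.

Lemma trig_iter_smoothstep m F : trig_poly F ->
  trig_poly (fun y => iter m smoothstep (F y)).
Proof.
move=> tF; elim: m => //= m IH.
apply: trig_ext (trig_add (trig_scale (3 / 2) IH)
  (trig_scale (- 2^-1) (trig_mul IH (trig_mul IH IH)))) => y.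
by rewrite /smoothstep; field.
Qed.

Lemma trig_prod (f : 'I_n -> ('I_n -> R) -> R) : (forall i, trig_poly (f i)) ->
  trig_poly (fun y => \prod_(i < n) f i y).
Proof.
move=> tf; elim: (index_enum _) => [|i s IH].
  by apply: trig_ext (trig_cst 1) => y; rewrite big_nil.
by apply: trig_ext (trig_mul (tf i) IH) => y; rewrite big_cons.
Qed.

Lemma trig_bounded F : trig_poly F -> exists M, forall y, `|F y| <= M.
Proof.
elim=> [a b c|{}F G _ [M FM] _ [M' GM']].
  exists `|c| => y; rewrite normrM ler_piMr// ler_norml cos_geN1 cos_le1//.
by exists (M + M') => y; rewrite (le_trans (ler_normD _ _))// lerD.
Qed.

End trigonometric_polynomials.

(* The Cramer-Wold argument, with half-line indicators approximated by iterated
   smoothsteps of a sine, which are trigonometric polynomials. *)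
Section cramer_wold.
Context {d} {Omega : measurableType d} {R : realType}.
Variables (P : probability Omega R) (n : nat).
Variables (Y Y' : 'I_n -> Omega -> R).
Hypotheses (mY : forall i, measurable_fun setT (Y i))
           (mY' : forall i, measurable_fun setT (Y' i)).
Hypothesis same_cos : forall (a : 'I_n -> R) b,
  (\int[P]_w (cos (\sum_(i < n) a i * Y i w + b))%:E =
   \int[P]_w (cos (\sum_(i < n) a i * Y' i w + b))%:E)%E.

Definition same_expectation (F : ('I_n -> R) -> R) :=
  [/\ measurable_fun setT (fun w => F (Y ^~ w)),
      measurable_fun setT (fun w => F (Y' ^~ w)) &
      (\int[P]_w (F (Y ^~ w))%:E = \int[P]_w (F (Y' ^~ w))%:E)%E].

Lemma integrable_bounded_rv (f : Omega -> R) M : measurable_fun setT f ->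
  (forall w, `|f w| <= M) -> P.-integrable setT (EFin \o f).
Proof.
move=> mf fM; apply: measurable_bounded_integrable => //.
  by rewrite [ltLHS]probability_setT ltry.
by exists M; split; [exact: num_real|move=> x Mx w _ /=; rewrite (le_trans (fM w))// ltW].
Qed.

Lemma same_expectation_trig F : trig_poly F -> same_expectation F.
Proof.
elim=> [a b c|{}F G tF [m1 m2 e] tG [m1' m2' e']].
  have mc (Z : 'I_n -> Omega -> R) : (forall i, measurable_fun setT (Z i)) ->
      measurable_fun setT (fun w => cos (\sum_(i < n) a i * Z i w + b)).
    move=> mZ; apply: (measurableT_comp (f := cos)).
      by apply: continuous_measurable_fun; exact: continuous_cos.
    apply: measurable_funD => //; apply: measurable_sum => i.
    exact: measurable_funM.
  have ic (Z : 'I_n -> Omega -> R) (mZ : forall i, measurable_fun setT (Z i)) :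
      P.-integrable setT (EFin \o (fun w => cos (\sum_(i < n) a i * Z i w + b))).
    apply: (@integrable_bounded_rv _ 1); first exact: (mc Z mZ).
    by move=> w; rewrite ler_norml cos_geN1 cos_le1.
  split; [by apply: measurable_funM => //; exact: mc|
          by apply: measurable_funM => //; exact: mc|].
  under eq_integral do rewrite EFinM.
  under [RHS]eq_integral do rewrite EFinM.
  rewrite integralZl//; last exact: ic.
  by rewrite integralZl//; [rewrite same_cos|exact: ic].
have [M FM] := trig_bounded tF; have [M' GM'] := trig_bounded tG.
split; [exact: measurable_funD|exact: measurable_funD|].
have iF := integrable_bounded_rv m1 (fun w => FM (Y ^~ w)).
have iF' := integrable_bounded_rv m2 (fun w => FM (Y' ^~ w)).
have iG := integrable_bounded_rv m1' (fun w => GM' (Y ^~ w)).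
have iG' := integrable_bounded_rv m2' (fun w => GM' (Y' ^~ w)).
under eq_integral do rewrite EFinD.
under [RHS]eq_integral do rewrite EFinD.
rewrite [LHS](integralD_EFin measurableT iF iG).
by rewrite [RHS](integralD_EFin measurableT iF' iG') e e'.
Qed.

Lemma same_expectation_lim (F : nat -> ('I_n -> R) -> R) G :
  (forall m, same_expectation (F m)) -> (forall m y, `|F m y| <= 1) ->
  (forall y, F m y @[m --> \oo] --> G y) -> same_expectation G.
Proof.
move=> sF F1 FG.
have lim (Z : 'I_n -> Omega -> R) :
    (forall m, measurable_fun setT (fun w => F m (Z ^~ w))) ->
    measurable_fun setT (fun w => G (Z ^~ w)) /\
    ((\int[P]_w (F m (Z ^~ w))%:E)%E @[m --> \oo] --> (\int[P]_w (G (Z ^~ w))%:E)%E).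
  move=> mF.
  have mG : measurable_fun setT (fun w => G (Z ^~ w)).
    by apply: (measurable_fun_cvg mF) => w _; exact: FG.
  split=> //.
  have [|||||_ _] := @dominated_convergence _ _ _ P _ measurableT
    (fun m w => (F m (Z ^~ w))%:E) (fun w => (G (Z ^~ w))%:E) (cst 1%:E).
  - by move=> m; apply/measurable_EFinP.
  - by apply/measurable_EFinP.
  - by apply: aeW => w _; apply: cvg_EFin; [exact: nearW|exact: FG].
  - exact: finite_measure_integrable_cst.
  - by apply: aeW => w m _; rewrite abse_EFin lee_fin.
  - by [].
have [m1 l1] := lim Y (fun m => let: And3 a _ _ := sF m in a).
have [m2 l2] := lim Y' (fun m => let: And3 _ a _ := sF m in a).
split=> //; apply: (@cvg_unique _ (@ereal_hausdorff R) _ _ _ _ _ l2).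
have FE : (fun m => \int[P]_w (F m (Y ^~ w))%:E)%E = (fun m => \int[P]_w (F m (Y' ^~ w))%:E)%E.
  by apply/funext => m; have [] := sF m.
by rewrite -FE.
Qed.

(** Factors with values in [0, 1] keep the products uniformly bounded, so pointwise limits can be
    taken in all factors at once by dominated convergence. *)
Let admissible (f : 'I_n -> R -> R) := (forall i z, 0 <= f i z <= 1) /\
  same_expectation (fun y => \prod_(i < n) f i (y i)).

Let admissible_lim (f : nat -> 'I_n -> R -> R) g :
  (forall m, admissible (f m)) -> (forall i z, f m i z @[m --> \oo] --> g i z) ->
  admissible g.
Proof.
move=> af fg; split.
  move=> i z; have fgz := fg i z; apply/andP; split.
    apply: (cvgr_to_ge fgz).
    by apply: nearW => m; have [/(_ i z)/andP[]] := af m.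
  apply: (cvgr_to_le fgz).
  by apply: nearW => m; have [/(_ i z)/andP[]] := af m.
apply: (same_expectation_lim (F := fun m y => \prod_(i < n) f m i (y i))).
- by move=> m; have [] := af m.
- move=> m y; have [f01 _] := af m.
  rewrite normr_prod; apply: prodr_ile1 => i _.
  by have /andP[f0 f1] := f01 i (y i); rewrite normr_ge0 ger0_norm.
- move=> y; apply: cvg_big => [|i _]; last exact: fg.
  by move=> z; exact: mul_continuous.
Qed.

(** Two successive limits. As m grows, the iterated smoothstep of sin((z - b i) / (N + 1)) tends to
    the sign of that sine; as N grows, the argument enters (-pi, pi), where the sine has the sign of
    z - b i. *)
Let admissible_sgn (b : 'I_n -> R) : admissible (fun i z => (1 - Num.sg (z - b i)) / 2).
Proof.
have sin1 (z : R) : `|sin z| <= 1 by rewrite ler_norml sin_geN1 sin_le1.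
pose f N m (i : 'I_n) z : R := (1 - iter m smoothstep (sin ((z - b i) / N.+1%:R))) / 2.
pose g N (i : 'I_n) z : R := (1 - Num.sg (sin ((z - b i) / N.+1%:R))) / 2.
apply: (@admissible_lim g) => [N|i z].
  apply: (@admissible_lim (f N)) => [m|i z]; last first.
    apply: cvgM; last exact: cvg_cst.
    apply: (@cvgB _ R^o); first exact: cvg_cst.
    exact: cvg_iter_smoothstep.
  split=> [i z|].
    have := iter_smoothstep_bound m (sin1 ((z - b i) / N.+1%:R)).
    by rewrite ler_norml /f => /andP[? ?]; apply/andP; split; lra.
  apply/same_expectation_trig/trig_prod => i.
  apply: trig_ext (trig_add (trig_cst 2^-1) (trig_scale (- 2^-1)
    (trig_iter_smoothstep m (trig_sin i N.+1%:R (b i))))) => y.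
  by rewrite /f; field.
apply: cvgM; last exact: cvg_cst.
apply: (@cvgB _ R^o); first exact: cvg_cst.
apply: cvg_near_cst; near=> N.
have N0 : 0 < N.+1%:R :> R by [].
have zN : `|z - b i| < pi * N.+1%:R.
  rewrite mulrC -ltr_pdivrMr ?pi_gt0//.
  near: N; apply: filterS (nbhs_infty_gtr (`|z - b i| / pi)) => k kz.
  by rewrite (lt_trans kz)// ltr_nat.
have [z0|z0|z0] := ltrgtP 0 (z - b i).
- rewrite !gtr0_sg// sin_gt0_pi// divr_gt0//= ltr_pdivrMr//.
  by move: zN; rewrite gtr0_norm.
- rewrite !ltr0_sg//.
  rewrite -[_ / _]opprK sinN oppr_lt0 sin_gt0_pi// -mulNr divr_gt0 ?oppr_gt0//= ltr_pdivrMr//.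
  by move: zN; rewrite ltr0_norm.
- by rewrite -z0 mul0r sin0.
Unshelve. all: by end_near. Qed.

Lemma orthant_probability (b : 'I_n -> R) :
  P [set w | forall i, Y i w <= b i] = P [set w | forall i, Y' i w <= b i].
Proof.
(* At a jump (1 - sg) / 2 takes the value 1/2. Letting thresholds decrease to b i from above gives
   the closed half-line exactly. *)
have : admissible (fun i z => (z <= b i)%R%:R).
  apply: (@admissible_lim (fun k i z => (1 - Num.sg (z - (b i + k.+1%:R^-1))) / 2)) => [k|i z].
    exact: (admissible_sgn (fun i => b i + k.+1%:R^-1)).
  have [zb|bz] := leP z (b i).
    rewrite (_ : (fun k : nat => _) = fun=> 1); first exact: cvg_cst.
    apply/funext => k; rewrite ltr0_sg ?opprK; first lra.
    by rewrite subr_lt0 (le_lt_trans zb)// ltrDl invr_gt0.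
  apply: cvg_near_cst; near=> k; rewrite gtr0_sg ?subrr ?mul0r//.
  rewrite subr_gt0 -ltrBrDl -[ltRHS]invrK ltf_pV2 ?posrE ?invr_gt0 ?subr_gt0//.
  near: k; apply: filterS (nbhs_infty_gtr ((z - b i)^-1)) => k kz.
  by rewrite (lt_trans kz)// ltr_nat.
move=> [_ [_ _]].
have prodE (Z : 'I_n -> Omega -> R) w :
    \prod_(i < n) ((Z i w <= b i)%R%:R : R) = \1_[set w | forall i, Z i w <= b i] w.
  rewrite indicE; have [/set_mem H|/negP H] := boolP (w \in _).
    by rewrite big1// => i _; rewrite H.
  have /existsNP[i iZ] : ~ forall i, Z i w <= b i by move=> ?; apply: H; rewrite inE.
  by rewrite (bigD1 i)//= (negbTE (introN idP iZ)) mul0r.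
have mS (Z : 'I_n -> Omega -> R) : (forall i, measurable_fun setT (Z i)) ->
    measurable [set w | forall i, Z i w <= b i].
  move=> mZ; rewrite (_ : [set _ | _] = \bigcap_(i in [set: 'I_n]) (Z i @^-1` `]-oo, b i])).
    apply: fin_bigcap_measurable => // i _; rewrite -[X in measurable X]setTI.
    exact: mZ.
  apply/seteqP; split => w /= H i; first by move=> _; rewrite /= in_itv/=.
  by have := H i I; rewrite /= in_itv.
under eq_integral do rewrite prodE.
under [X in _ = X -> _]eq_integral do rewrite prodE.
rewrite !integral_indic ?setIT//; exact: mS.
Unshelve. all: by end_near. Qed.

End cramer_wold.

Section equality_in_law.
Context {d} {Omega : measurableType d} {R : realType}.
Variable P : probability Omega R.
Implicit Types Z : {RV P >-> R}.

Definition same_law Z Z' := forall A, measurable A -> P (Z @^-1` A) = P (Z' @^-1` A).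

Lemma measurable_rv_le (f : Omega -> R) :
  (forall y, measurable [set w | f w <= y]) -> measurable_fun setT f.
Proof.
move=> mf mD; apply: (measurability _ (RGenOInfty.measurableE R)) => //.
move=> /= _ [_ [y ->] <-]; rewrite setTI.
rewrite (_ : _ @^-1` _ = ~` [set w | f w <= y]); first exact: measurableC.
by apply/seteqP; split => w /=; rewrite in_itv/= andbT ltNge => /negP.
Qed.

(** Open right rays are stable under intersection and exhaust the line, and their probabilities are
    the complements of those in the hypothesis. *)
Lemma same_law_le Z Z' : (forall y, P [set w | Z w <= y] = P [set w | Z' w <= y]) ->
  same_law Z Z'.
Proof.
move=> ZZ' A mA.
have gtE (U : {RV P >-> R}) y : (P (U @^-1` [set` `]y, +oo[%R]) = 1 - P [set w | (U w <= y)%R])%E.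
  rewrite -probability_setC; last first.
    rewrite (_ : [set _ | _] = setT `&` U @^-1` [set` `]-oo, y]%R]).
      exact: measurable_funPT.
    by apply/seteqP; split => w /=; rewrite in_itv//= => -[].
  by congr (P _); apply/seteqP; split => w /=; rewrite in_itv/= andbT ltNge => /negP.
apply: (@measure_unique _ R R (@RGenOInfty.G R) (fun n => [set` `]- n%:R, +oo[%R]) _ _ _ _
   (distribution P Z) (distribution P Z')) => //.
- exact: RGenOInfty.measurableE.
- move=> _ _ [a ->] [b ->]; exists (Num.max a b).
  apply/seteqP; split => x /=; rewrite !in_itv/= !andbT gt_max; first by case=> -> ->.
  by move=> /andP.
- by move=> n; exists (- n%:R).
- rewrite -subTset => x _; have /archi_boundP := normr_ge0 x => xn.
  exists (Num.bound `|x|) => //=; rewrite in_itv/= andbT.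
  by rewrite ltrNl (le_lt_trans _ xn)// -normrN ler_norm.
- by move=> _ [y ->]; rewrite -[LHS]/(P _) -[RHS]/(P _) !gtE ZZ'.
- by move=> n; apply: le_lt_trans (probability_le1 _ _) _; rewrite ?ltry.
Qed.

Lemma same_law_ge0_integral Z Z' (f : R -> R) : same_law Z Z' ->
  measurable_fun setT f -> (forall x, 0 <= f x) ->
  (\int[P]_w (f (Z w))%:E = \int[P]_w (f (Z' w))%:E)%E.
Proof.
move=> ZZ' mf f0; have mE : measurable_fun setT (EFin \o f) by exact/measurable_EFinP.
rewrite -[LHS](@ge0_integral_distribution _ _ _ _ _ P Z (EFin \o f))//.
rewrite -[RHS](@ge0_integral_distribution _ _ _ _ _ P Z' (EFin \o f))//.
by apply: eq_measure_integral => A mA _; exact: ZZ'.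
Qed.

(** Adding 1 makes the cosine nonnegative, so that [same_law_ge0_integral] applies; finiteness
    allows it to be subtracted again. *)
Lemma same_law_cos Z Z' b : same_law Z Z' ->
  (\int[P]_w (cos (Z w + b))%:E = \int[P]_w (cos (Z' w + b))%:E)%E.
Proof.
move=> ZZ'.
have mcos : measurable_fun setT (fun z : R => cos (z + b)).
  apply: (measurableT_comp (f := cos)); last exact: measurable_funD.
  by apply: continuous_measurable_fun; exact: continuous_cos.
have icos U : P.-integrable setT (EFin \o (fun w => cos ((U : {RV P >-> R}) w + b))).
  apply: (@integrable_bounded_rv _ _ _ P _ 1).
    exact: (measurableT_comp mcos (measurable_funPT U)).
  by move=> w; rewrite ler_norml cos_geN1 cos_le1.
have i1 : P.-integrable setT (EFin \o (fun _ : Omega => 1 : R)).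
  exact: finite_measure_integrable_cst.
have e U : (\int[P]_w (cos ((U : {RV P >-> R}) w + b) + 1)%:E =
    \int[P]_w (cos (U w + b))%:E + 1)%E.
  under eq_integral do rewrite EFinD.
  rewrite [LHS](integralD_EFin measurableT (icos U) i1); congr (_ + _)%E.
  by rewrite /= integral_cst// [X in (_ * X)%E]probability_setT mule1.
have := @same_law_ge0_integral Z Z' (fun z => cos (z + b) + 1) ZZ'
  (measurable_funD mcos (measurable_cst _)).
have f0 x : 0 <= cos (x + b) + 1 by have := cos_geN1 (x + b); lra.
rewrite (e Z) (e Z') => /(_ f0).
have fin U := integrable_fin_num measurableT (icos U).
by rewrite -(fineK (fin Z)) -(fineK (fin Z')) -!EFinD => -[] /addIr ->.
Qed.

End equality_in_law.

(** * Fractional Brownian motion *)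

Section gaussian_process_moments.
Context {d} {Omega : measurableType d} {R : realType}.
Variables (P : probability Omega R) (W : R -> {RV P >-> R}).
Hypotheses (gW : gaussian_process W) (EW : forall t, 0 <= t -> ('E_P[W t] = 0)%E).

Lemma centered_gaussian_at t : 0 <= t -> centered_gaussian P (W t).
Proof.
move=> t0; split; last exact: EW.
have := gW (n := 1) (fun=> 1) (fun _ => t0).
by rewrite (_ : (fun w => _) = W t)//; apply/funext => w; rewrite big_ord1 mul1r.
Qed.

Lemma integrable_sqr t : 0 <= t -> P.-integrable setT (fun w => (W t w ^+ 2)%:E).
Proof.
move=> /centered_gaussian_at/centered_gaussian_scale[s [_ _ /(_ 1) m1]].
apply/integrableP; split; first by apply/measurable_EFinP; exact: measurable_funX.
under eq_integral do rewrite gee0_abs ?lee_fin ?sqr_ge0//.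
by rewrite m1 ltry.
Qed.

Lemma integrable_at t : 0 <= t -> P.-integrable setT (fun w => (W t w)%:E).
Proof.
move=> t0; apply: (@le_integrable _ _ _ P setT measurableT _
    (fun w => 1 + (W t w ^+ 2)%:E)%E).
- exact/measurable_EFinP.
- move=> w _; rewrite -EFinD !abse_EFin lee_fin.
  have : 0 <= (`|W t w| - 1) ^+ 2 by exact: sqr_ge0.
  rewrite sqrrB real_normK ?num_real// expr1n mulr1.
  have := sqr_ge0 (W t w); have := normr_ge0 (W t w) => ? ? ?.
  by rewrite (ger0_norm (_ : 0 <= 1 + W t w ^+ 2)); lra.
- apply: integrableD => //; [exact: finite_measure_integrable_cst|exact: integrable_sqr].
Qed.

Lemma integrable_mul s t : 0 <= s -> 0 <= t ->
  P.-integrable setT (fun w => (W s w * W t w)%:E).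
Proof.
move=> s0 t0; apply: (@le_integrable _ _ _ P setT measurableT _
    (fun w => (W s w ^+ 2)%:E + (W t w ^+ 2)%:E)%E).
- by apply/measurable_EFinP; exact: measurable_funM.
- move=> w _; rewrite -EFinD !abse_EFin lee_fin normrM.
  have : 0 <= (`|W s w| - `|W t w|) ^+ 2 by exact: sqr_ge0.
  rewrite sqrrB !real_normK ?num_real//.
  have := sqr_ge0 (W t w); have := sqr_ge0 (W s w) => ? ? ?.
  rewrite (ger0_norm (_ : 0 <= W s w ^+ 2 + W t w ^+ 2)); last lra.
  have : 0 <= `|W s w| * `|W t w| by rewrite mulr_ge0. lra.
- by apply: integrableD => //; exact: integrable_sqr.
Qed.

Lemma integral_mul s t : 0 <= s -> 0 <= t ->
  (\int[P]_w (W s w * W t w)%:E = covariance P (W s) (W t))%E.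
Proof.
move=> s0 t0; rewrite covariance.unlock !EW// expectation.unlock/=.
by apply: eq_integral => w _; rewrite !fctE/= !subr0.
Qed.

Section linear_combination.
Variables (n : nat) (t a : 'I_n -> R).

Definition lin_comb (w : Omega) : R := \sum_(i < n) a i * W (t i) w.

Lemma measurable_lin_comb : measurable_fun setT lin_comb.
Proof. by apply: measurable_sum => i; exact: measurable_funM. Qed.

HB.instance Definition _ := isMeasurableFun.Build _ _ _ _ lin_comb measurable_lin_comb.

Hypothesis t0 : forall i, 0 <= t i.

Lemma centered_gaussian_lin_comb : centered_gaussian P lin_comb.
Proof.
split; first exact: gW.
rewrite unlock.
under eq_integral do rewrite -sumEFin.
rewrite integral_sum//.
  rewrite big1// => i _; under eq_integral do rewrite EFinM.
  rewrite integralZl//; last exact: integrable_at.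
  by have := EW (t0 i); rewrite unlock => ->; rewrite mule0.
move=> i; under eq_fun do rewrite EFinM.
by apply: integrableZl => //; exact: integrable_at.
Qed.

Lemma second_moment_lin_comb (r : R -> R -> R) :
  (forall s u, 0 <= s -> 0 <= u -> covariance P (W s) (W u) = (r s u)%:E) ->
  (\int[P]_w (lin_comb w ^+ 2)%:E =
    (\sum_(i < n) \sum_(j < n) a i * a j * r (t i) (t j))%:E)%E.
Proof.
move=> rE.
transitivity (\int[P]_w \sum_(i < n) \sum_(j < n)
   ((a i * a j)%:E * (W (t i) w * W (t j) w)%:E))%E.
  apply: eq_integral => w _; rewrite /lin_comb expr2 big_distrl/= -sumEFin.
  apply: eq_bigr => i _; rewrite big_distrr/= -sumEFin.
  by apply: eq_bigr => j _; rewrite -EFinM; congr EFin; rewrite mulrACA.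
have iW i j : P.-integrable setT (fun w => ((a i * a j)%:E * (W (t i) w * W (t j) w)%:E)%E).
  by apply: integrableZl => //; exact: integrable_mul.
rewrite integral_sum//; last by move=> i; exact: integrable_sum.
rewrite -sumEFin; apply: eq_bigr => i _.
rewrite integral_sum// -sumEFin; apply: eq_bigr => j _.
rewrite integralZl//; last exact: integrable_mul.
by rewrite integral_mul// rE// -EFinM.
Qed.

End linear_combination.

End gaussian_process_moments.

Section fbm.
Context {d} {Omega : measurableType d} {R : realType}.
Variables (P : probability Omega R) (H : R) (W : R -> {RV P >-> R}).
Hypotheses (hH : 2^-1 <= H < 1) (hW : fractional_brownian_motion H W).

Let gW : gaussian_process W. Proof. by have [] := hW. Qed.
Let EW t : 0 <= t -> ('E_P[W t] = 0)%E. Proof. by have [_ + _ _ _] := hW; apply. Qed.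
Let W0 w : W 0 w = 0. Proof. by have [_ _ _ + _] := hW; apply. Qed.
Let cW w : {within `[0, +oo[, continuous (fun t => W t w)}.
Proof. by have [_ _ _ _] := hW; apply. Qed.
Let H0 : 2 * H != 0. Proof. by case/andP: hH => *; rewrite gt_eqF//; lra. Qed.

Definition fbm_cov s t : R :=
  2^-1 * (t `^ (2 * H) + s `^ (2 * H) - `|t - s| `^ (2 * H)).

Let rE s t : 0 <= s -> 0 <= t -> covariance P (W s) (W t) = (fbm_cov s t)%:E.
Proof. by have [_ _ + _ _] := hW; apply. Qed.

Lemma fbm_covC s t : fbm_cov s t = fbm_cov t s.
Proof. by rewrite /fbm_cov distrC [X in X - _]addrC. Qed.

Lemma fbm_covt t : 0 <= t -> fbm_cov t t = t `^ (2 * H).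
Proof. by move=> t0; rewrite /fbm_cov subrr normr0 powR0//; field. Qed.

(* Stationarity and time reversal of the increments, at the level of covariances. *)
Lemma fbm_cov_reversal T s t : s <= T -> t <= T -> 0 <= s -> 0 <= t ->
  fbm_cov T T - fbm_cov T (T - t) - fbm_cov (T - s) T + fbm_cov (T - s) (T - t) = fbm_cov s t.
Proof.
move=> sT tT s0 t0; rewrite /fbm_cov subrr normr0 powR0//.
have -> : T - t - T = - t by ring.
have -> : T - (T - s) = s by ring.
have -> : T - t - (T - s) = s - t by ring.
by rewrite normrN (ger0_norm t0) (ger0_norm s0) (distrC s t); field.
Qed.

Section reversal.
Variables (n : nat) (T : R) (s : 'I_n -> R).
Hypotheses (s0 : forall i, 0 <= s i) (sT : forall i, s i <= T) (T0 : 0 <= T).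

(** A combination of the n reversed increments W T - W (T - s j) is a combination of n + 1 values of
    W: index 0 carries time T, weighted by the sum of all coefficients. *)
Let rev_time (i : 'I_n.+1) : R := if unlift ord0 i is Some j then T - s j else T.
Let rev_coef (a : 'I_n -> R) (i : 'I_n.+1) : R :=
  if unlift ord0 i is Some j then - a j else \sum_(j < n) a j.

Let rev_time_ge0 i : 0 <= rev_time i.
Proof. by rewrite /rev_time; case: unlift => [j|//]; rewrite subr_ge0. Qed.

Let rev_lin_comb a w : lin_comb W rev_time (rev_coef a) w =
  \sum_(i < n) a i * (W T w - W (T - s i) w).
Proof.
rewrite /lin_comb big_ord_recl /rev_coef /rev_time unlift_none mulr_suml -big_split/=.
by apply: eq_bigr => i _; rewrite liftK mulNr mulrBr.
Qed.

(** The corner, first row and first column are spread into double sums over n indices; the four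
    blocks then recombine termwise into [fbm_cov_reversal]. *)
Let rev_second_moment a : \sum_(i < n.+1) \sum_(j < n.+1)
    rev_coef a i * rev_coef a j * fbm_cov (rev_time i) (rev_time j) =
  \sum_(i < n) \sum_(j < n) a i * a j * fbm_cov (s i) (s j).
Proof.
transitivity (\sum_(i < n) \sum_(j < n) a i * a j * (fbm_cov T T - fbm_cov T (T - s j)
   - fbm_cov (T - s i) T + fbm_cov (T - s i) (T - s j))); last first.
  by apply: eq_bigr => i _; apply: eq_bigr => j _; rewrite fbm_cov_reversal.
pose A := \sum_(i < n) a i.
have rc0 : rev_coef a ord0 = A by rewrite /rev_coef unlift_none.
have rcS j : rev_coef a (lift ord0 j) = - a j by rewrite /rev_coef liftK.
have rt0 : rev_time ord0 = T by rewrite /rev_time unlift_none.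
have rtS j : rev_time (lift ord0 j) = T - s j by rewrite /rev_time liftK.
have e1 : A * A * fbm_cov T T = \sum_(i < n) \sum_(j < n) a i * a j * fbm_cov T T.
  by rewrite 2!mulr_suml; apply: eq_bigr => i _; rewrite mulr_sumr mulr_suml.
have e2 : \sum_(j < n) A * - a j * fbm_cov T (T - s j) =
    \sum_(i < n) \sum_(j < n) - (a i * a j * fbm_cov T (T - s j)).
  rewrite exchange_big/=; apply: eq_bigr => j _; rewrite mulrN mulNr mulr_suml mulr_suml.
  by rewrite -sumrN.
have e3 i : - a i * A * fbm_cov (T - s i) T =
    \sum_(j < n) - (a i * a j * fbm_cov (T - s i) T).
  by rewrite mulr_sumr mulr_suml; apply: eq_bigr => j _; rewrite !mulNr.
rewrite big_ord_recl [X in X + _]big_ord_recl rc0 rt0 e1.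
under [X in _ + X + _]eq_bigr do rewrite rcS rtS.
rewrite e2 -addrA -!big_split/=; apply: eq_bigr => i _.
rewrite big_ord_recl rc0 rt0 rcS rtS e3.
under [X in _ + (_ + (_ + X))]eq_bigr do rewrite rcS rtS.
by rewrite -!big_split/=; apply: eq_bigr => j _; ring.
Qed.

(** Corresponding linear combinations of the two families are centred Gaussian with equal variances,
    so they have equal laws and equal cosine expectations, which is the input of
    [orthant_probability]. *)
Lemma fbm_orthant_reversal (b : 'I_n -> R) :
  P [set w | forall i, W (s i) w <= b i] =
  P [set w | forall i, W T w - W (T - s i) w <= b i].
Proof.
apply: (orthant_probability (Y := fun i => W (s i)) (Y' := fun i w => W T w - W (T - s i) w)).
- by [].
- by move=> i; exact: measurable_funB.
move=> a b'.
have law := centered_gaussian_eq_law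
  (centered_gaussian_lin_comb gW EW a s0)
  (centered_gaussian_lin_comb gW EW (rev_coef a) rev_time_ge0)
  (second_moment_lin_comb gW EW a s0 rE).
have {}law := law (etrans (second_moment_lin_comb gW EW _ rev_time_ge0 rE)
  (congr1 EFin (rev_second_moment a))).
have -> : (\int[P]_w (cos (\sum_(i < n) a i * (W T w - W (T - s i) w) + b'))%:E =
    \int[P]_w (cos (lin_comb W rev_time (rev_coef a) w + b'))%:E)%E.
  by apply: eq_integral => w _; rewrite rev_lin_comb.
exact: (@same_law_cos _ _ _ P (lin_comb W s a) (lin_comb W rev_time (rev_coef a))).
Qed.

End reversal.
Lemma fbm_increment_moment k : exists2 c : R, 0 <= c & forall s t, 0 <= s -> 0 <= t ->
  (\int[P]_w ((W t w - W s w) ^+ k.*2)%:E = (c * (`|t - s| `^ (2 * H)) ^+ k)%:E)%E.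
Proof.
have [c c0 cE] := @gaussian_moment_le _ _ _ P k; exists c => // s t s0 t0.
pose ts (i : 'I_2) : R := if i == ord0 then t else s.
pose a (i : 'I_2) : R := if i == ord0 then 1 else - 1.
have ts0 i : 0 <= ts i by rewrite /ts; case: ifP.
have lE w : lin_comb W ts a w = W t w - W s w.
  by rewrite /lin_comb big_ord_recl big_ord1 /a /ts/= mul1r mulN1r.
have -> : (\int[P]_w ((W t w - W s w) ^+ k.*2)%:E =
    \int[P]_w ((lin_comb W ts a w) ^+ k.*2)%:E)%E.
  by apply: eq_integral => w _; rewrite lE.
apply: (cE (lin_comb W ts a)); first exact: centered_gaussian_lin_comb.
rewrite (second_moment_lin_comb _ _ _ _ rE)//; congr EFin.
rewrite !big_ord_recl !big_ord0 /a /ts/= !fbm_covt// (fbm_covC s t) /fbm_cov.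
by rewrite distrC; field.
Qed.

Lemma fbm_symmetric t : 0 <= t -> forall A, measurable A ->
  P (W t @^-1` A) = P ((fun w => - W t w) @^-1` A).
Proof.
move=> t0; have t0' : forall i : 'I_1, 0 <= (fun=> t) i by [].
pose Z := lin_comb W (fun _ : 'I_1 => t) (fun=> - 1).
have ZE : (fun w => - W t w) = Z.
  by apply/funext => w; rewrite /Z /lin_comb big_ord1 mulN1r.
move=> A mA; rewrite ZE.
apply: (@centered_gaussian_eq_law _ _ _ P (W t)
  (lin_comb W (fun _ : 'I_1 => t) (fun=> - 1)) (fbm_cov t t)) => //.
- exact: centered_gaussian_at.
- exact: centered_gaussian_lin_comb.
- rewrite -(rE t0 t0) -(integral_mul EW)//.
- rewrite (second_moment_lin_comb gW EW _ t0' rE); congr EFin.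
  by rewrite !big_ord1 mulrNN !mul1r.
Qed.

(** For t >= 1 and 2 H >= 1 the variance t^(2H) is at least t, so it passes any threshold. *)
Lemma fbm_small_ball (c e : R) : 0 <= c -> 0 < e -> exists2 t0, 0 < t0 & forall t, t0 <= t ->
  (P (W t @^-1` `[(- c)%R, c]) <= e%:E)%E.
Proof.
move=> c0 e0; have [V VP] := gaussian_small_ball P c0 e0.
exists (Num.max V 1) => [|t]; first by rewrite lt_max ltr01 orbT.
rewrite ge_max => /andP[Vt t1].
have t0 : 0 <= t by lra.
apply: (VP (W t) (fbm_cov t t)).
- exact: centered_gaussian_at.
- by rewrite -(rE t0 t0) -(integral_mul EW).
- rewrite (le_trans Vt)// fbm_covt// -[leLHS]powRr1//; apply: ler_powR => //.
  by case/andP: hH => *; lra.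
Qed.

End fbm.

Section unit_rat_compl.
Context {R : realType}.

(** Time reversal sends t q to t (1 - q), so the countable set of times has to be symmetric. *)
Lemma unit_rat_compl k : exists k', @unit_rat R k' = 1 - unit_rat k.
Proof.
pose r : rat := odflt 0 (unpickle k : option rat).
exists (pickle (1 - r)); rewrite /unit_rat pickleK/= -/r rmorphB rmorph1.
by rewrite !maxEle !minEle; do 4 case: ifPn; rewrite -?ltNge => *; lra.
Qed.

Lemma unit_rat_eq1 : exists k, @unit_rat R k = 1.
Proof.
exists (pickle (1 : rat)); rewrite /unit_rat pickleK/= rmorph1 minxx.
by rewrite max_r.
Qed.

End unit_rat_compl.

Section random_paths.
Context {d} {Omega : measurableType d} {R : realType}.
Variables (V : R -> Omega -> R).
Hypotheses (mV : forall t, 0 <= t -> measurable_fun setT (V t))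
           (cV : forall w, {within `[0, +oo[, continuous (fun t => V t w)}).

(** By [regulator_le_ratP] a sublevel set is a countable intersection of conditions at single
    times. *)
Lemma measurable_regulator x u t : 0 <= t ->
  measurable_fun setT (fun w => regulator x u (V ^~ w) t).
Proof.
move=> t0; apply: measurable_rv_le => y.
have [y0|y0] := leP 0 y; last first.
  rewrite (_ : [set _ | _] = set0)// -subset0 => w /= wy.
  by have := regulator_ge0 x u (V ^~ w) t; lra.
rewrite (_ : [set _ | _] = \bigcap_k
    [set w | u * (t * unit_rat k) - V (t * unit_rat k) w - x <= y]).
  apply: bigcap_measurable => // k _.
  have -> : [set w | u * (t * unit_rat k) - V (t * unit_rat k) w - x <= y] =
      setT `&` (V (t * unit_rat k)) @^-1` `[u * (t * unit_rat k) - x - y, +oo[.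
    apply/seteqP; split => w /=; rewrite in_itv/= andbT; first by move=> ?; split=> //; lra.
    by case=> _ ?; lra.
  apply: mV => //; rewrite mulr_ge0//.
  by have /andP[] := @unit_rat_itv R k.
apply/seteqP; split => w /=.
  by move=> /(regulator_le_ratP (@cV w) x u t0 y0) H k _; exact: H.
by move=> H; apply/(regulator_le_ratP (@cV w) x u t0 y0) => k; exact: H.
Qed.

End random_paths.

(** * Reversal of time: the state started at 0 and the running maximum *)

Section running_maximum.
Context {R : realType}.
Implicit Types (w : R -> R) (u t y : R).

(** The maximum over s <= t of w s - u s, written as the regulator of -w with drift -u started at 0
    so that all lemmas on regulators apply to it. *)
Definition running_max u w t := regulator 0 (- u) (fun s => - w s) t.

Lemma oppr_within_continuous w : {within `[0, +oo[, continuous w} ->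
  {within `[0, +oo[, continuous (fun s => - w s)}.
Proof. by move=> cw z; apply: (@cvgN _ R^o); exact: cw. Qed.

Variables (w : R -> R).
Hypotheses (w0 : w 0 = 0) (cw : {within `[0, +oo[, continuous w}).

Lemma running_max_leP u t y : 0 <= t -> 0 <= y ->
  running_max u w t <= y <-> (forall s, 0 <= s <= t -> w s - u * s <= y).
Proof.
move=> t0 y0; rewrite /running_max (regulator_leP (oppr_within_continuous cw))//.
by split=> H s /H; lra.
Qed.

Lemma running_max_ge u t s : 0 <= s <= t -> w s - u * s <= running_max u w t.
Proof.
by move=> /(regulator_ge (oppr_within_continuous cw) 0 (- u)); rewrite -/(running_max _ _ _); lra.
Qed.

Lemma running_max_nd u s t : 0 <= s -> s <= t -> running_max u w s <= running_max u w t.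
Proof.
move=> s0 st; apply/running_max_leP => //; first exact: regulator_ge0.
by move=> r /andP[r0 rs]; apply: running_max_ge; rewrite r0 (le_trans rs).
Qed.

(* Points of the form [t - t q] are used so that they match the reversed increments. *)
Lemma running_max_le_ratP u t y : 0 <= t -> 0 <= y ->
  running_max u w t <= y <-> (forall k, w (t - t * unit_rat k) - u * (t - t * unit_rat k) <= y).
Proof.
move=> t0 y0; rewrite /running_max (regulator_le_ratP (oppr_within_continuous cw))//.
split=> H k; have [k' kE] := @unit_rat_compl R k; have := H k'; rewrite kE.
  by rewrite mulrBr mulr1; lra.
by rewrite (_ : t - t * (1 - unit_rat k) = t * unit_rat k); [lra|ring].
Qed.

(** The state started at 0 is the maximum over s <= t of w t - w s - u (t - s), the expression that
    reversal of the increments turns into the running maximum. *)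
Lemma reflected_le_ratP u t y : 0 <= t -> 0 <= y ->
  reflected 0 u w t <= y <->
  (forall k, w t - w (t * unit_rat k) - u * (t - t * unit_rat k) <= y).
Proof.
move=> t0 y0; rewrite /reflected; split=> [H k|H].
  have := @regulator_ge _ _ cw 0 u t (t * unit_rat k).
  have /andP[q0 q1] := @unit_rat_itv R k.
  by rewrite mulr_ge0//= ler_piMr// => /(_ isT); lra.
suff : regulator 0 u w t <= y + u * t - w t by lra.
(* Time 0, obtained as the complement of 1, gives the nonnegativity of y + u t - w t that
   [regulator_le_ratP] asks for. *)
have [k1 k1E] := @unit_rat_eq1 R; have [k0 k0E] := @unit_rat_compl R k1.
apply/(regulator_le_ratP cw) => //.
  by have := H k0; rewrite k0E k1E subrr mulr0 w0; lra.
by move=> k; have := H k; rewrite mulrBr; lra.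
Qed.

End running_maximum.

Section reflected_law.
Context {d} {Omega : measurableType d} {R : realType}.
Variables (P : probability Omega R) (H : R) (W : R -> {RV P >-> R}).
Hypotheses (hH : 2^-1 <= H < 1) (hW : fractional_brownian_motion H W).

Let W0 w : W 0 w = 0. Proof. by have [_ _ _ + _] := hW; apply. Qed.
Let cW w : {within `[0, +oo[, continuous (fun t => W t w)}.
Proof. by have [_ _ _ _] := hW; apply. Qed.

Lemma measurable_running_max u t : 0 <= t ->
  measurable_fun setT (fun w => running_max u (W ^~ w) t).
Proof.
move=> t0; apply: (measurable_regulator (V := fun s w => - W s w)) => //.
  by move=> s _; apply: measurable_funN.
by move=> w; apply: oppr_within_continuous; exact: cW.
Qed.

Lemma measurable_regulator_fbm x u t : 0 <= t ->
  measurable_fun setT (fun w => regulator x u (W ^~ w) t).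
Proof. by move=> t0; exact: (measurable_regulator (V := fun s w => W s w)). Qed.

Lemma measurable_reflected_fbm x u t : 0 <= t ->
  measurable_fun setT (fun w => reflected x u (W ^~ w) t).
Proof.
move=> t0; apply: measurable_funD; last exact: measurable_regulator_fbm.
exact: measurable_funD.
Qed.

(** Both events are decreasing limits of events on the first n rational times. These have equal
    probabilities by [fbm_orthant_reversal] at the times t - t q, and continuity from above passes
    to the limit. *)
Lemma reflected_same_cdf u t y : 0 <= t ->
  P [set w | reflected 0 u (W ^~ w) t <= y] = P [set w | running_max u (W ^~ w) t <= y].
Proof.
move=> t0; have [y0|y0] := leP 0 y; last first.
  rewrite (_ : [set _ | _] = set0); last first.
    rewrite -subset0 => w /=; have := reflected_ge0 (@cW w) 0 u t0; lra.
  rewrite (_ : [set w | running_max _ _ _ <= _] = set0)// -subset0 => w /=.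
  by have := regulator_ge0 0 (- u) (fun s => - W s w) t; rewrite -/(running_max _ _ _); lra.
pose E k := [set w | W t w - W (t * unit_rat k) w <= y + u * (t - t * unit_rat k)].
pose E' k := [set w | W (t - t * unit_rat k) w <= y + u * (t - t * unit_rat k)].
have q0 k : 0 <= t * @unit_rat R k.
  by rewrite mulr_ge0//; have /andP[] := @unit_rat_itv R k.
have q1 k : t * @unit_rat R k <= t.
  by rewrite ler_piMr//; have /andP[] := @unit_rat_itv R k.
have mW f y' : measurable_fun setT f -> measurable [set w : Omega | f w <= y' :> R].
  move=> mf; rewrite (_ : [set _ | _] = setT `&` f @^-1` [set` `]-oo, y']%R]).
    exact: mf.
  by apply/seteqP; split => w /=; rewrite in_itv//= => -[].
have mE k : measurable (E k) by apply: mW; exact: measurable_funB.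
have mE' k : measurable (E' k) by exact: mW.
rewrite (_ : [set _ | _] = \bigcap_k \bigcap_(i < k) E i); last first.
  apply/seteqP; split => w /=.
    by move=> /(reflected_le_ratP (W0 w) (@cW w) u t0 y0) Hk n _ k _; have := Hk k; rewrite /E/=; lra.
  move=> Hk; apply/(reflected_le_ratP (W0 w) (@cW w) u t0 y0) => k.
  by have := Hk k.+1 I k (ltnSn k); rewrite /E/=; lra.
rewrite (_ : [set w | running_max _ _ _ <= _] = \bigcap_k \bigcap_(i < k) E' i); last first.
  apply/seteqP; split => w /=.
    by move=> /(running_max_le_ratP (@cW w) u t0 y0) Hk n _ k _; have := Hk k; rewrite /E'/=; lra.
  move=> Hk; apply/(running_max_le_ratP (@cW w) u t0 y0) => k.
  by have := Hk k.+1 I k (ltnSn k); rewrite /E'/=; lra.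
have cvgP (F : nat -> set Omega) : (forall k, measurable (F k)) ->
    P (\bigcap_(i < n) F i) @[n --> \oo] --> P (\bigcap_k \bigcap_(i < k) F i).
  move=> mF; have mI n : measurable (\bigcap_(i < n) F i).
    by apply: fin_bigcap_measurable => //; exact: finite_II.
  apply: nonincreasing_cvg_mu.
  - by rewrite (le_lt_trans (probability_le1 _ _)) ?ltry//; exact: mI.
  - exact: mI.
  - exact: bigcapT_measurable.
  - move=> n m nm; apply/subsetPset => w Fw i /= im; apply: Fw => /=.
    exact: leq_trans nm.
apply: (@cvg_unique _ (@ereal_hausdorff R) _ _ _ _ (cvgP _ mE)).
rewrite (_ : (fun n => P (\bigcap_(i < n) E i)) = (fun n => P (\bigcap_(i < n) E' i))).
  exact: cvgP.
apply/funext => n.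
have := @fbm_orthant_reversal _ _ _ P H W hH hW n t (fun i : 'I_n => t - t * unit_rat i)
  _ _ t0 (fun i => y + u * (t - t * unit_rat i)).
rewrite (_ : [set w | forall i : 'I_n, _ <= _] = \bigcap_(i < n) E' i); last first.
  apply/seteqP; split => w /= Hw i => [i_n|]; first exact: (Hw (Ordinal i_n)).
  exact: (Hw i (ltn_ord i)).
rewrite (_ : [set w | forall i : 'I_n, _ <= _] = \bigcap_(i < n) E i); last first.
  have tt (i : nat) : t - (t - t * @unit_rat R i) = t * unit_rat i by ring.
  apply/seteqP; split => w /= Hw i => [i_n|].
    by have := Hw (Ordinal i_n); rewrite /E/= tt.
  by have := Hw i (ltn_ord i); rewrite /E/= tt.
move=> -> // i; first by rewrite subr_ge0.
by rewrite lerBlDr lerDl.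
Qed.

Lemma reflected_integral (f : R -> R) u t : 0 <= t -> measurable_fun setT f ->
  (forall x, 0 <= f x) ->
  (\int[P]_w (f (reflected 0 u (W ^~ w) t))%:E =
   \int[P]_w (f (running_max u (W ^~ w) t))%:E)%E.
Proof.
move=> t0 mf f0.
pose Z := @isMeasurableFun.Build _ _ _ _ _ (measurable_reflected_fbm 0 u t0).
pose Z' := @isMeasurableFun.Build _ _ _ _ _ (measurable_running_max u t0).
pose X : {RV P >-> R} := HB.pack (fun w => reflected 0 u (W ^~ w) t) Z.
pose X' : {RV P >-> R} := HB.pack (fun w => running_max u (W ^~ w) t) Z'.
apply: (@same_law_ge0_integral _ _ _ P X X') => //.
by apply: same_law_le => y; exact: reflected_same_cdf.
Qed.

End reflected_law.

(** * Moments of the running maximum *)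

Section chaining.
Context {R : realType}.
Variables (w : R -> R).
Hypothesis cw : {within `[0, +oo[, continuous w}.

Definition dyadic_incr (n j i : nat) : R :=
  w (n%:R + i.+1%:R / 2 ^+ j) - w (n%:R + i%:R / 2 ^+ j).

(** A point of level J + 1 is either of level J or one increment away from such a point, so the
    distances add up to b times the sum of (3/4)^j over j <= J, which is 4 b (1 - (3/4)^(J+1)). *)
Lemma dyadic_chaining (b : R) n : 0 <= b ->
  (forall j i, (i < 2 ^ j)%N -> `|dyadic_incr n j i| <= b * (3 / 4) ^+ j) ->
  forall J i, (i <= 2 ^ J)%N ->
    `|w (n%:R + i%:R / 2 ^+ J) - w n%:R| <= 4 * b * (1 - (3 / 4) ^+ J.+1).
Proof.
move=> b0 bD; elim=> [i i1|J IH i iJ].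
  rewrite expr0 divr1 expr1; case: i i1 => [_|[_|//]].
    by rewrite addr0 subrr normr0; lra.
  by have := bD 0%N 0%N isT; rewrite /dyadic_incr expr0 !divr1 addr0 mulr1; lra.
have i2 : i = (odd i + i./2 * 2)%N by rewrite muln2 odd_double_half.
have half : (i./2 * 2)%:R / 2 ^+ J.+1 = i./2%:R / 2 ^+ J :> R.
  by rewrite natrM exprS; field; rewrite expf_neq0.
have := IH i./2; rewrite -(leq_pmul2r (isT : 0 < 2)%N) -expnSr => /(_ _)IH'.
have e : 4 * b * (1 - (3 / 4) ^+ J.+1) + b * (3 / 4) ^+ J.+1 = 4 * b * (1 - (3 / 4) ^+ J.+2).
  by rewrite [in RHS]exprS; field.
have p0 : 0 <= b * (3 / 4) ^+ J.+1 by rewrite mulr_ge0// exprn_ge0; lra.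
have IHi : `|w (n%:R + i./2%:R / 2 ^+ J) - w n%:R| <= 4 * b * (1 - (3 / 4) ^+ J.+1).
  by apply: IH'; rewrite (leq_trans _ iJ)// [leqRHS]i2 leq_addl.
case: (boolP (odd i)) i2 => [_|_]; rewrite ?add1n ?add0n => i2; last first.
  by rewrite i2 half; lra.
have := bD J.+1 (i./2 * 2)%N; rewrite /dyadic_incr -i2 half => /(_ iJ) D.
rewrite -e (_ : w (n%:R + i%:R / 2 ^+ J.+1) - w n%:R =
  (w (n%:R + i./2%:R / 2 ^+ J) - w n%:R) +
  (w (n%:R + i%:R / 2 ^+ J.+1) - w (n%:R + i./2%:R / 2 ^+ J))); last by ring.
by rewrite (le_trans (ler_normD _ _))// lerD.
Qed.

Lemma unit_interval_oscillation (b : R) n s : 0 <= b ->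
  (forall j i, (i < 2 ^ j)%N -> `|dyadic_incr n j i| <= b * (3 / 4) ^+ j) ->
  n%:R <= s <= n.+1%:R -> `|w s - w n%:R| <= 4 * b.
Proof.
move=> b0 bD /andP[ns sn]; apply/ler_addgt0Pr => e e0.
have s0 : 0 <= s by exact: le_trans ns.
have [d d0 dw] := (within_ge0_continuousP w).1 cw s e s0 e0.
have [J Jd] : exists J, 1 / 2 ^+ J < d.
  have [J _ /(_ J (leqnn _))] : \forall J \near \oo, `|0 - (1 / 2 : R) ^+ J| < d.
    have /(@cvgrPdist_lt _ R^o) : (1 / 2 : R) ^+ J @[J --> \oo] --> (0 : R).
      by apply: cvg_expr; rewrite ger0_norm; lra.
    exact.
  have h12 : 0 <= (1 / 2 : R) by lra.
  rewrite sub0r normrN ger0_norm ?exprn_ge0//.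
  by rewrite expr_div_n expr1n => ?; exists J.
have p2 : 0 < 2 ^+ J :> R by rewrite exprn_gt0.
have sg0 : 0 <= (s - n%:R) * 2 ^+ J by rewrite mulr_ge0 ?subr_ge0// ltW.
have /andP[i1 i2] := truncn_itv sg0.
set i := Num.truncn _ in i1 i2.
have iJ : (i <= 2 ^ J)%N.
  rewrite -(ler_nat R) (le_trans i1)// natrX ler_piMl ?(ltW p2)//.
  by move: sn; rewrite -natr1; lra.
have := dyadic_chaining b0 bD iJ; set si := n%:R + i%:R / 2 ^+ J => H.
have si0 : 0 <= si by rewrite addr_ge0// divr_ge0// ltW.
have sis : `|si - s| < d.
  apply: le_lt_trans Jd; rewrite /si ler_norml.
  have h1 : i%:R / 2 ^+ J <= s - n%:R by rewrite ler_pdivrMr.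
  have h2 : s - n%:R < i.+1%:R / 2 ^+ J by rewrite ltr_pdivlMr.
  have h3 : i.+1%:R / 2 ^+ J = i%:R / 2 ^+ J + 1 / 2 ^+ J :> R by rewrite -natr1 mulrDl.
  by apply/andP; split; lra.
have := dw _ si0 sis; have p3 : 0 <= (3 / 4 : R) ^+ J.+1 by rewrite exprn_ge0//; lra.
have : 4 * b * (1 - (3 / 4) ^+ J.+1) <= 4 * b.
  by rewrite ler_piMr ?mulr_ge0//; lra.
move=> h1; rewrite distrC => h2.
rewrite (_ : w s - w n%:R = (w s - w si) + (w si - w n%:R)); last by ring.
by rewrite (le_trans (ler_normD _ _))// addrC lerD// ?(ltW h2)// (le_trans H).
Qed.

(** One large dyadic increment has to account for the whole oscillation. Its power can then be
    replaced by a sum over all increments, whose expectation is computable, unlike that of a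
    supremum. *)
Lemma unit_interval_oscillation_pow m n s : ~~ odd m -> (0 < m)%N ->
  n%:R <= s <= n.+1%:R -> w s != w n%:R ->
  exists j i, (i < 2 ^ j)%N /\
    `|w s - w n%:R| ^+ m <= 8 ^+ m * ((4 / 3) ^+ (j * m) * dyadic_incr n j i ^+ m).
Proof.
move=> mo m0 ns wsn; set z := `|w s - w n%:R|.
have z0 : 0 < z by rewrite normr_gt0 subr_eq0.
apply: contrapT => noji.
(* If every increment of level j were at most (z / 8) (3/4)^j, chaining would give z <= z / 2. *)
suff : z <= 4 * (z / 8) by lra.
apply: (unit_interval_oscillation (b := z / 8)) ns; first lra.
move=> j i ij; rewrite leNgt; apply/negP => big; apply: noji; exists j, i; split=> //.
have r0 : 0 < (3 / 4 : R) ^+ j by rewrite exprn_gt0//; lra.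
have : (z / 8 * (3 / 4) ^+ j) ^+ m <= dyadic_incr n j i ^+ m.
  rewrite -[leRHS](@ger0_norm _ (dyadic_incr n j i ^+ m)) ?exprn_even_ge0// normrX.
  apply: lerXn2r; rewrite ?nnegrE//; last exact: ltW.
  by rewrite mulr_ge0 ?(ltW r0)//; lra.
rewrite exprMn -exprM => h.
have e : (4 / 3 : R) ^+ (j * m) * (3 / 4) ^+ (j * m) = 1.
  by rewrite -exprMn (_ : 4 / 3 * (3 / 4) = 1 :> R) ?expr1n//; field.
have -> : z ^+ m = 8 ^+ m * (z / 8) ^+ m.
  by rewrite -exprMn; congr (_ ^+ _); field.
have p0 : 0 <= (4 / 3 : R) ^+ (j * m) by rewrite exprn_ge0//; lra.
apply: ler_wpM2l; first exact: exprn_ge0.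
rewrite -[leLHS]mul1r -[X in X * _ <= _]e -mulrA; apply: ler_wpM2l => //.
by rewrite mulrC.
Qed.

End chaining.

Section series_bounds.
Context {R : realType}.

Lemma nneseries_le_partial (f : nat -> \bar R) (B : \bar R) :
  (forall n, 0 <= f n)%E -> (forall N, \sum_(0 <= n < N) f n <= B)%E ->
  (\sum_(0 <= n <oo) f n <= B)%E.
Proof.
move=> f0 fB; apply: lime_le; first by apply: is_cvg_nneseries => n _ _.
exact: nearW.
Qed.

Lemma nneseries_ge_term (f : nat -> \bar R) n : (forall n, 0 <= f n)%E ->
  (f n <= \sum_(0 <= i <oo) f i)%E.
Proof.
move=> f0; apply: (@le_trans _ _ (\sum_(0 <= i < n.+1) f i)%E).
  by rewrite big_nat_recr//= leeDr// sume_ge0.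
exact: nneseries_lim_ge.
Qed.

Lemma nneseries_geometric_le (c z : R) : 0 <= c -> 0 <= z < 1 ->
  (\sum_(0 <= j <oo) (c * z ^+ j)%:E <= (c / (1 - z))%:E)%E.
Proof.
move=> c0 /andP[z0 z1]; apply: nneseries_le_partial => [j|N].
  by rewrite lee_fin mulr_ge0// exprn_ge0.
have := @geometric_seriesE R c z; rewrite (lt_eqF z1) => /(_ isT)/(congr1 (fun f => f N)).
rewrite /series/= sumEFin lee_fin => ->.
rewrite ler_wpM2r ?invr_ge0 ?subr_ge0 ?(ltW z1)// ler_piMr// gerBl.
exact: exprn_ge0.
Qed.

(** Telescoping through 1 / (n+2)^2 <= 1 / (n+1) - 1 / (n+2). *)
Lemma nneseries_inv_sqr_le (c : R) : 0 <= c ->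
  (\sum_(0 <= n <oo) (c / n.+1%:R ^+ 2)%:E <= (2 * c)%:E)%E.
Proof.
move=> c0; apply: nneseries_le_partial => [n|N]; first by rewrite lee_fin divr_ge0// exprn_ge0.
rewrite sumEFin lee_fin.
case: N => [|N]; first by rewrite big_nil mulr_ge0.
suff : \sum_(0 <= n < N.+1) c / n.+1%:R ^+ 2 <= 2 * c - c / N.+1%:R.
  by move/le_trans; apply; rewrite gerBl divr_ge0.
elim: N => [|N IH]; first by rewrite big_nat1 expr1n divr1; lra.
rewrite big_nat_recr//=; apply: le_trans (lerD IH (lexx _)) _.
have a0 : 0 < N.+1%:R :> R by [].
suff : c / N.+2%:R ^+ 2 <= c / N.+1%:R - c / N.+2%:R.
  by move: (c / N.+2%:R ^+ 2) (c / N.+1%:R) (c / N.+2%:R) => b1 b2 b3; lra.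
rewrite -mulrBr ler_wpM2l// -[N.+2%:R]natr1.
move: (N.+1%:R : R) a0 => a a0.
have -> : a^-1 - (a + 1)^-1 = (a * (a + 1))^-1 by field; rewrite !gt_eqF//; lra.
have a1 : 0 < a + 1 by lra.
have p1 : 0 < a * (a + 1) by rewrite mulr_gt0.
have p2 : 0 < (a + 1) ^+ 2 by rewrite exprn_gt0.
rewrite lef_pV2 ?posrE// expr2; apply: ler_wpM2r; lra.
Qed.

End series_bounds.

Section running_max_attained.
Context {R : realType}.
Variables (w : R -> R).
Hypotheses (w0 : w 0 = 0) (cw : {within `[0, +oo[, continuous w}).

Lemma running_max_attained u t : 0 <= t ->
  exists2 s, 0 <= s <= t & running_max u w t = w s - u * s.
Proof.
move=> t0.
have cf : {within `[0, t], continuous (fun s => w s - u * s)}.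
  have cf0 := @regulator_cont R 0 u w cw.
  have -> : (fun s => w s - u * s) = (fun s => 0 - u * s + w s).
    by apply/funext => s; ring.
  apply: continuous_subspaceW cf0 => s /=.
  by rewrite !in_itv/= andbT => /andP[].
have [c ct cmax] := EVT_max t0 cf.
move: ct; rewrite in_itv/= => ct; exists c => //.
apply/eqP; rewrite eq_le running_max_ge// andbT.
have := cmax 0; rewrite in_itv/= lexx t0 w0 mulr0 subr0 => /(_ isT) fc.
apply/(running_max_leP cw u t0 fc).
by move=> s st; apply: cmax; rewrite in_itv.
Qed.

(** For even m, and up to the factor 8^m, a measurable majorant of the m-th power of the oscillation
    on [n, n + 1]. *)
Definition oscillation_series m n : \bar R :=
  (\sum_(0 <= j <oo) ((4 / 3) ^+ (j * m) * \sum_(i < 2 ^ j) dyadic_incr w n j i ^+ m)%:E)%E.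

Lemma oscillation_term_ge0 m n j : ~~ odd m ->
  (0 <= ((4 / 3) ^+ (j * m) * \sum_(i < 2 ^ j) dyadic_incr w n j i ^+ m)%:E)%E.
Proof.
move=> mo; rewrite lee_fin mulr_ge0 ?exprn_ge0 ?divr_ge0//.
by apply: sumr_ge0 => i _; rewrite exprn_even_ge0.
Qed.

Lemma oscillation_le m n s : ~~ odd m -> (0 < m)%N -> n%:R <= s <= n.+1%:R ->
  ((`|w s - w n%:R| ^+ m)%:E <= (8 ^+ m)%:E * oscillation_series m n)%E.
Proof.
move=> mo m0 ns; have t0 := fun j => oscillation_term_ge0 n j mo.
have [->|wsn] := eqVneq (w s) (w n%:R).
  rewrite subrr normr0 expr0n gt_eqF//= mule_ge0 ?lee_fin ?exprn_ge0//.
  exact: nneseries_ge0.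
have [j [i [ij]]] := unit_interval_oscillation_pow cw mo m0 ns wsn.
rewrite -lee_fin EFinM => /le_trans; apply.
rewrite lee_wpmul2l ?lee_fin ?exprn_ge0//.
apply: le_trans (nneseries_ge_term j t0); rewrite lee_fin ler_wpM2l ?exprn_ge0 ?divr_ge0//.
rewrite (bigD1 (Ordinal ij))//= lerDl; apply: sumr_ge0 => k _.
by rewrite exprn_even_ge0.
Qed.

(** Let the maximum M be attained at s in [n, n + 1], and put A = 1 + |w n| + |w s - w n|. Then M <=
    A, and M >= 0 forces 1 + u n <= A, so M^q (1 + u n)^N <= A^(q+N). The index n depends on the
    path; summing over all n removes it. *)
Lemma running_max_pow_le u t q N : 0 < u -> 0 <= t -> ~~ odd (q + N) -> (0 < q + N)%N ->
  ((running_max u w t ^+ q)%:E <=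
   \sum_(0 <= n <oo) ((3 ^+ (q + N) / (1 + u * n%:R) ^+ N)%:E *
     (1 + (w n%:R ^+ (q + N))%:E + (8 ^+ (q + N))%:E * oscillation_series (q + N) n)))%E.
Proof.
move=> u0 t0 mo m0; have [s /andP[s0 st] Ms] := running_max_attained u t0.
have Q0 n : (0 <= oscillation_series (q + N) n)%E.
  by apply: nneseries_ge0 => j _ _; exact: oscillation_term_ge0.
have k0 n : 0 <= 3 ^+ (q + N) / (1 + u * n%:R) ^+ N :> R.
  by rewrite divr_ge0 ?exprn_ge0// addr_ge0// mulr_ge0// ltW.
have wn0 n : 0 <= w n%:R ^+ (q + N) by rewrite exprn_even_ge0.
pose n := Num.truncn s; have /andP[n1 n2] : n%:R <= s < n.+1%:R by exact: truncn_itv.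
have ns : n%:R <= s <= n.+1%:R by rewrite n1 ltW.
have := nneseries_ge_term n (f := fun n => ((3 ^+ (q + N) / (1 + u * n%:R) ^+ N)%:E *
     (1 + (w n%:R ^+ (q + N))%:E + (8 ^+ (q + N))%:E * oscillation_series (q + N) n))%E).
move=> /(_ _)/(le_trans _); apply; last first.
  move=> i; rewrite mule_ge0 ?lee_fin// adde_ge0//.
    by rewrite -EFinD lee_fin addr_ge0.
  by rewrite mule_ge0// lee_fin exprn_ge0.
rewrite Ms; set M := w s - u * s in Ms *.
have M0 : 0 <= M by rewrite -Ms; exact: regulator_ge0.
set a := `|w n%:R|; set z := `|w s - w n%:R|.
have un : u * n%:R <= u * s by rewrite ler_wpM2l// ltW.
have un0 : 0 <= u * n%:R by rewrite mulr_ge0// ltW.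
have aw : w n%:R <= a by exact: ler_norm.
have zw : w s - w n%:R <= z by exact: ler_norm.
have a0 : 0 <= a by exact: normr_ge0.
have z0 : 0 <= z by exact: normr_ge0.
have MA : M <= 1 + a + z by rewrite /M; lra.
have nA : 1 + u * n%:R <= 1 + a + z by rewrite /M in M0; lra.
have key : M ^+ q * (1 + u * n%:R) ^+ N <= 3 ^+ (q + N) * (1 + a ^+ (q + N) + z ^+ (q + N)).
  apply: (@le_trans _ _ ((1 + a + z) ^+ (q + N))).
    rewrite exprD; apply: ler_pM; rewrite ?exprn_ge0//; first lra.
    - by apply: lerXn2r => //; rewrite nnegrE; lra.
    - by apply: lerXn2r => //; rewrite nnegrE; lra.
  (* The sum of three terms is at most three times the largest, whose power is at most the sum of
     the powers. *)
  have mx : exists2 b, [\/ b = 1, b = a | b = z] & 1 + a + z <= 3 * b.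
    have [az|za] := leP a z.
      have [z1|z1] := leP 1 z; [exists z; [exact: Or33|lra]|exists 1; [exact: Or31|lra]].
    have [a1|a1] := leP 1 a; [exists a; [exact: Or32|lra]|exists 1; [exact: Or31|lra]].
  have [b hb bA] := mx.
  have b0 : 0 <= b by case: hb => ->.
  apply: (@le_trans _ _ ((3 * b) ^+ (q + N))).
    by apply: lerXn2r => //; rewrite nnegrE; lra.
  rewrite exprMn ler_wpM2l ?exprn_ge0//.
  have := exprn_ge0 (q + N) a0; have := exprn_ge0 (q + N) z0.
  by case: hb => ->; rewrite ?expr1n; lra.
have p0 : 0 < (1 + u * n%:R) ^+ N by rewrite exprn_gt0//; lra.
apply: (@le_trans _ _ ((3 ^+ (q + N) / (1 + u * n%:R) ^+ N) *
   (1 + a ^+ (q + N) + z ^+ (q + N)))%:E).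
  by rewrite lee_fin mulrAC ler_pdivlMr.
rewrite EFinM lee_wpmul2l ?lee_fin// 2!EFinD.
apply: leeD; last exact: oscillation_le.
by rewrite -!EFinD lee_fin lerD// /a -normrX ger0_norm.
Qed.

End running_max_attained.

Section moment_bound.
Context {d} {Omega : measurableType d} {R : realType}.
Variables (P : probability Omega R) (H : R) (W : R -> {RV P >-> R}).
Hypotheses (hH : 2^-1 <= H < 1) (hW : fractional_brownian_motion H W).

Let W0 w : W 0 w = 0. Proof. by have [_ _ _ + _] := hW; apply. Qed.
Let cW w : {within `[0, +oo[, continuous (fun t => W t w)}.
Proof. by have [_ _ _ _] := hW; apply. Qed.

Let mdy n j i : measurable_fun setT (fun w => dyadic_incr (W ^~ w) n j i).
Proof. exact: measurable_funB. Qed.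

Lemma measurable_oscillation m n : ~~ odd m ->
  measurable_fun setT (fun w => oscillation_series (W ^~ w) m n).
Proof.
move=> mo; apply: ge0_emeasurable_sum => [j w _ _|j _].
  exact: oscillation_term_ge0.
apply/measurable_EFinP/measurable_funM => //.
by apply: measurable_sum => i; apply: measurable_funX; exact: mdy.
Qed.

Lemma oscillation_expectation_fin k : (6 <= k)%N ->
  exists2 B : R, 0 <= B & forall n,
    (\int[P]_w oscillation_series (W ^~ w) k.*2 n <= B%:E)%E.
Proof.
move=> k6; have [c c0 cE] := fbm_increment_moment hH hW k.
(* There are 2^j increments at level j, of 2k-th moment at most c 2^(-jk), with weight (4/3)^(2jk). *)
pose z : R := 2 * (8 / 9) ^+ k.
have z0 : 0 <= z by rewrite mulr_ge0// exprn_ge0// divr_ge0.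
have z1 : z < 1.
  (* The exponent 6 is the least one for which 2 (8/9)^k is below 1. *)
  have : (8 / 9 : R) ^+ k <= (8 / 9) ^+ 6.
    by apply: ler_wiXn2l => //; lra.
  by rewrite /z !exprSr expr0; lra.
have mo : ~~ odd k.*2 by rewrite odd_double.
exists (c / (1 - z)) => [|n]; first by rewrite divr_ge0// subr_ge0 ltW.
rewrite integral_nneseries//; first last.
- by move=> j w _; exact: oscillation_term_ge0.
- move=> j; apply/measurable_EFinP/measurable_funM => //.
  by apply: measurable_sum => i; apply: measurable_funX; exact: mdy.
apply: (@le_trans _ _ (\sum_(0 <= j <oo) (c * z ^+ j)%:E)%E); last first.
  by apply: nneseries_geometric_le; rewrite ?z0.
apply: lee_nneseries => [j _ _|j _].
  by apply: integral_ge0 => w _; exact: oscillation_term_ge0.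
under eq_integral do rewrite EFinM.
rewrite ge0_integralZl//; first last.
- by move=> w _; rewrite lee_fin; apply: sumr_ge0 => i _; rewrite exprn_even_ge0.
- apply/measurable_EFinP; apply: measurable_sum => i.
  by apply: measurable_funX; exact: mdy.
under eq_integral do rewrite -sumEFin.
rewrite ge0_integral_sum//; first last.
- by move=> i w _; rewrite lee_fin exprn_even_ge0.
- by move=> i; apply/measurable_EFinP/measurable_funX; exact: mdy.
have p2 : 0 < 2 ^+ j :> R by rewrite exprn_gt0.
have term (i : 'I_(2 ^ j)) : (\int[P]_w (dyadic_incr (W ^~ w) n j i ^+ k.*2)%:E <=
    (c * (1 / 2 ^+ j) ^+ k)%:E)%E.
  rewrite /dyadic_incr cE; first last.
  - by rewrite addr_ge0// divr_ge0// ltW.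
  - by rewrite addr_ge0// divr_ge0// ltW.
  rewrite lee_fin ler_wpM2l//; apply: lerXn2r; rewrite ?nnegrE ?powR_ge0 ?divr_ge0 ?(ltW p2)//.
  have -> : n%:R + i.+1%:R / 2 ^+ j - (n%:R + i%:R / 2 ^+ j) = 1 / 2 ^+ j :> R.
    by rewrite -natr1; field; rewrite gt_eqF.
  have q0 : 0 < 1 / 2 ^+ j :> R by rewrite divr_gt0.
  (* The time step is at most 1 and 2 H >= 1, so the variance of an increment is at most the step
     itself. *)
  rewrite gtr0_norm// -[leRHS]powRr1 ?(ltW q0)//; apply: ger_powR.
    by rewrite q0/= ler_pdivrMr// mul1r exprn_ege1// ler1n.
  by case/andP: hH => *; lra.
apply: (@le_trans _ _ (((4 / 3) ^+ (j * k.*2))%:E * \sum_(i < 2 ^ j) (c * (1 / 2 ^+ j) ^+ k)%:E)%E).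
  rewrite lee_wpmul2l ?lee_fin ?exprn_ge0 ?divr_ge0//.
  by apply: lee_sum => i _; exact: term.
rewrite sumEFin -EFinM lee_fin sumr_const card_ord -[X in _ * X <= _]mulr_natl natrX.
rewrite le_eqVlt; apply/orP; left; apply/eqP.
rewrite /z [in RHS]exprMn -[in RHS]exprM [in RHS](mulnC k j).
have -> : (1 / 2 ^+ j) ^+ k = (1 / 2 : R) ^+ (j * k).
  by rewrite [RHS]exprM; congr (_ ^+ _); rewrite expr_div_n expr1n.
have -> : (4 / 3) ^+ (j * k.*2) = (16 / 9 : R) ^+ (j * k).
  by rewrite -mul2n mulnCA exprM; congr (_ ^+ _); rewrite exprSr expr1; field.
have -> : (8 / 9 : R) ^+ (j * k) = (16 / 9) ^+ (j * k) * (1 / 2) ^+ (j * k).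
  by rewrite -exprMn; congr (_ ^+ _); field.
by ring.
Qed.

(* Since H < 1, for large k the power (u n)^(2k - q) beats the growth n^(2Hk) of the
   2k-th moment of W n by a summable factor. *)
Lemma running_max_moment u q : 0 < u ->
  exists2 B : R, 0 <= B & forall t, 0 <= t ->
    (\int[P]_w (running_max u (W ^~ w) t ^+ q)%:E <= B%:E)%E.
Proof.
move=> u0; have /andP[H1 H2] := hH.
(* With N = 2 k - q, the condition q + 2 <= 2 (1 - H) k says 2 H k <= N - 2, so that dividing by (1
   + u n)^N leaves a factor of order (n + 1)^(-2). *)
pose k := maxn 7 (Num.bound ((q%:R + 2) / (2 * (1 - H)))).
have k6 : (6 <= k)%N by rewrite (leq_trans _ (leq_maxl _ _)).
have kH : q%:R + 2 <= 2 * (1 - H) * k%:R.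
  have h0 : 0 < 2 * (1 - H) by lra.
  rewrite mulrC -ler_pdivrMr//.
  have /archi_boundP/ltW/le_trans : 0 <= (q%:R + 2) / (2 * (1 - H)) by rewrite divr_ge0// ?ltW// addr_ge0.
  by apply; rewrite ler_nat leq_maxr.
have qk : (q + 2 <= k.*2)%N.
  rewrite -(ler_nat R) natrD (le_trans kH)// -mul2n natrM ler_wpM2r//; lra.
pose N := (k.*2 - q)%N.
have qN : (q + N = k.*2)%N by rewrite subnKC// (leq_trans _ qk)// leq_addr.
have N2 : (2 <= N)%N by rewrite leq_subRL ?(leq_trans _ qk)// leq_addr.
have mo : ~~ odd k.*2 by rewrite odd_double.
have m0 : (0 < k.*2)%N by rewrite double_gt0 (leq_trans _ k6).
have [B B0 BE] := oscillation_expectation_fin k6.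
have [c c0 cE] := fbm_increment_moment hH hW k.
(* Chosen so that v (n + 1) <= 1 + u n for every n, including n = 0. *)
pose v := Num.min 1 u.
have v0 : 0 < v by rewrite lt_min ltr01.
pose c1 := 3 ^+ k.*2 / v ^+ N * (1 + c + 8 ^+ k.*2 * B).
have c10 : 0 <= c1.
  rewrite mulr_ge0 ?divr_ge0 ?exprn_ge0 ?(ltW v0)// !addr_ge0// mulr_ge0// exprn_ge0//.
exists (2 * c1) => [|t t0]; first by rewrite mulr_ge0.
pose D w n := ((3 ^+ k.*2 / (1 + u * n%:R) ^+ N)%:E *
  (1 + (W n%:R w ^+ k.*2)%:E + (8 ^+ k.*2)%:E * oscillation_series (W ^~ w) k.*2 n))%E.
have Q0 w n : (0 <= oscillation_series (W ^~ w) k.*2 n)%E.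
  by apply: nneseries_ge0 => j _ _; exact: oscillation_term_ge0.
have un (n : nat) : 0 < 1 + u * n%:R by rewrite ltr_pwDl// mulr_ge0// ltW.
have k0 (n : nat) : 0 <= 3 ^+ k.*2 / (1 + u * n%:R) ^+ N :> R.
  by rewrite divr_ge0 ?exprn_ge0// ltW.
have wn0 w (n : nat) : 0 <= W n%:R w ^+ k.*2 by rewrite exprn_even_ge0.
have e0 w n : (0 <= 1 + (W n%:R w ^+ k.*2)%:E + (8 ^+ k.*2)%:E * oscillation_series (W ^~ w) k.*2 n)%E.
  apply: adde_ge0; last by rewrite mule_ge0// lee_fin exprn_ge0.
  by apply: adde_ge0; [exact: lee01|rewrite lee_fin].
have D0 w n : (0 <= D w n)%E by rewrite mule_ge0// lee_fin.
have mWn (n : nat) : measurable_fun setT (fun w => (W n%:R w ^+ k.*2)%:E).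
  by apply/measurable_EFinP; exact: measurable_funX.
have mWn1 (n : nat) : measurable_fun setT (fun w => (1 + (W n%:R w ^+ k.*2)%:E)%E).
  exact: emeasurable_funD.
have mQ (n : nat) : measurable_fun setT (fun w => ((8 ^+ k.*2)%:E * oscillation_series (W ^~ w) k.*2 n)%E).
  by apply: emeasurable_funM => //; exact: measurable_oscillation.
have mS (n : nat) : measurable_fun setT (fun w =>
    (1 + (W n%:R w ^+ k.*2)%:E + (8 ^+ k.*2)%:E * oscillation_series (W ^~ w) k.*2 n)%E).
  exact: emeasurable_funD.
have mD n : measurable_fun setT (fun w => D w n) by exact: emeasurable_funM.
apply: (@le_trans _ _ (\int[P]_w \sum_(0 <= n <oo) D w n)%E).
  apply: ge0_le_integral => //.
  - by move=> w _; rewrite lee_fin exprn_ge0// regulator_ge0.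
  - by apply/measurable_EFinP/measurable_funX; exact: (measurable_running_max hW).
  - by apply: ge0_emeasurable_sum.
  - move=> w _; have := @running_max_pow_le R (W ^~ w) (W0 w) (@cW w) u t q N u0 t0.
    by rewrite qN => /(_ mo m0).
rewrite integral_nneseries//.
apply: le_trans (nneseries_inv_sqr_le c10).
apply: lee_nneseries => [n _ _|n _]; first by apply: integral_ge0.
rewrite /D ge0_integralZl//; last by rewrite lee_fin.
rewrite ge0_integralD//; first last.
- by move=> w _; rewrite mule_ge0// lee_fin exprn_ge0.
- by move=> w _; apply: adde_ge0; [exact: lee01|rewrite lee_fin].
rewrite ge0_integralD//; last by move=> w _; rewrite lee_fin.
rewrite ge0_integralZl//; last exact: measurable_oscillation.
rewrite integral_cst// [X in (1 * X)%E]probability_setT mule1.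
have Wn : (\int[P]_w (W n%:R w ^+ k.*2)%:E <= (c * n.+1%:R ^+ (N - 2))%:E)%E.
  have := cE 0 n%:R (lexx _) (ler0n _ _).
  under eq_integral do rewrite W0 subr0.
  move=> ->; rewrite lee_fin ler_wpM2l// subr0 ger0_norm//.
  rewrite -powR_mulrn ?powR_ge0// -powRrM -powR_mulrn//.
  apply: (@le_trans _ _ (n.+1%:R `^ (2 * H * k%:R))).
    by apply: ge0_ler_powR; rewrite ?nnegrE ?ler_nat// mulr_ge0//; lra.
  apply: ler_powR; first by rewrite ler1n.
  rewrite natrB// natrB ?(leq_trans _ qk) ?leq_addr// -mul2n natrM.
  by move: kH; rewrite mulrBr mulrBl mulr1; lra.
apply: (@le_trans _ _ ((3 ^+ k.*2 / (1 + u * n%:R) ^+ N)%:E *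
    (1 + (c * n.+1%:R ^+ (N - 2))%:E + (8 ^+ k.*2)%:E * B%:E))%E).
  rewrite lee_wpmul2l ?lee_fin//; apply: leeD; first exact: leeD.
  by rewrite lee_wpmul2l ?lee_fin ?exprn_ge0.
rewrite -!EFinM lee_fin /c1.
have n1 : 1 <= n.+1%:R ^+ (N - 2) :> R by rewrite exprn_ege1// ler1n.
have p0 : 0 < n.+1%:R ^+ (N - 2) :> R by rewrite exprn_gt0.
have q0 : 0 < n.+1%:R ^+ 2 :> R by rewrite exprn_gt0.
have eN : n.+1%:R ^+ N = n.+1%:R ^+ (N - 2) * n.+1%:R ^+ 2 :> R by rewrite -exprD subnK.
have vu : (v * n.+1%:R) ^+ N <= (1 + u * n%:R) ^+ N.
  apply: lerXn2r; rewrite ?nnegrE ?mulr_ge0 ?(ltW v0) ?(ltW (un n))//.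
  rewrite -natr1 mulrDr mulr1 addrC lerD//; first by rewrite ge_min lexx.
  by rewrite ler_wpM2r// ge_min lexx orbT.
have B8 : 0 <= 8 ^+ k.*2 * B by rewrite mulr_ge0// exprn_ge0.
apply: (@le_trans _ _ (3 ^+ k.*2 / (v * n.+1%:R) ^+ N *
   ((1 + c + 8 ^+ k.*2 * B) * n.+1%:R ^+ (N - 2)))).
  apply: ler_pM => //.
  - by rewrite addr_ge0// addr_ge0// mulr_ge0// ltW.
  - by rewrite ler_wpM2l ?exprn_ge0// lef_pV2// posrE exprn_gt0// mulr_gt0.
  - rewrite !mulrDl mul1r; have : 8 ^+ k.*2 * B <= 8 ^+ k.*2 * B * n.+1%:R ^+ (N - 2) by rewrite ler_peMr.
    lra.
rewrite exprMn eN le_eqVlt; apply/orP; left; apply/eqP.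
field; rewrite !gt_eqF// exprn_gt0//.
Qed.

End moment_bound.

(** * Time averages *)

Section joint_measurability.
Context {d} {Omega : measurableType d} {R : realType}.
Local Notation TR := (measurableTypeR R).

(* Right continuity makes f the pointwise limit of the step processes
   (t, w) |-> f ((floor (N t) + 1) / N) w. *)
Lemma joint_measurable (f : R -> Omega -> R) :
  (forall t, 0 <= t -> measurable_fun setT (f t)) ->
  (forall w t e, 0 <= t -> 0 < e -> exists2 d, 0 < d &
     forall s, t < s -> s < t + d -> `|f s w - f t w| < e) ->
  measurable_fun setT (fun z : TR * Omega => f (Num.max 0 z.1) z.2).
Proof.
move=> mf rc.
pose s N k : R := k.+1%:R / N.+1%:R.
pose idx N (t : R) := Num.truncn (N.+1%:R * Num.max 0 t).
have s0 N k : 0 <= s N k by rewrite divr_ge0.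
apply: (@measurable_fun_cvg _ _ _ _ (fun N (z : TR * Omega) => f (s N (idx N z.1)) z.2)).
  move=> N _ B mB; rewrite setTI.
  rewrite (_ : _ @^-1` _ = \bigcup_k ((idx N @^-1` [set k]) `*` (f (s N k) @^-1` B))); last first.
    apply/seteqP; split => [[t w] /= ?|[t w] [k _ [/= <-]]] //.
    by exists (idx N t).
  apply: bigcupT_measurable => k; apply: measurableX; last first.
    by rewrite -[X in measurable X]setTI; exact: mf.
  have mh : measurable_fun setT (fun t : R => N.+1%:R * Num.max 0 t).
    by apply: measurable_funM => //; exact: measurable_maxr.
  have -> : idx N @^-1` [set k] = setT `&` (fun t : R => N.+1%:R * Num.max 0 t) @^-1` [set` `[k%:R, k.+1%:R[%R].
    apply/seteqP; split => t /=; rewrite in_itv/=.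
      by move=> <-; split=> //; apply: truncn_itv; rewrite mulr_ge0// le_max lexx.
    by move=> [_ /truncn_def]; rewrite /idx => ->.
  exact: mh.
move=> [t w] _ /=; set t' := Num.max 0 t; have t0 : 0 <= t' by rewrite le_max lexx.
apply/(@cvgrPdist_lt _ R^o) => e e0; have [δ d0 dP] := rc w t' e t0 e0.
near=> N; rewrite distrC; apply: dP.
  rewrite /s ltr_pdivlMr// mulrC.
  by have /andP[] : (idx N t)%:R <= N.+1%:R * t' < (idx N t).+1%:R by apply: truncn_itv; rewrite mulr_ge0.
have /andP[i1 _] : (idx N t)%:R <= N.+1%:R * t' < (idx N t).+1%:R by apply: truncn_itv; rewrite mulr_ge0.
rewrite /s ltr_pdivrMr// -[(idx N t).+1%:R]natr1 mulrDl ler_ltD//.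
  by rewrite mulrC.
rewrite -ltr_pdivrMl// mulr1 (@lt_trans _ _ N%:R) ?ltr_nat//.
by near: N; exact: nbhs_infty_gtr.
Unshelve. all: by end_near. Qed.

Lemma tonelli_time (P : probability Omega R) (nu : {sigma_finite_measure set TR -> \bar R})
    (D : set TR) (g : R -> Omega -> R) :
  measurable D -> measurable_fun setT (fun z : TR * Omega => g z.1 z.2) ->
  (forall t w, 0 <= g t w) ->
  [/\ (\int[P]_w \int[nu]_(t in D) (g t w)%:E = \int[nu]_(t in D) \int[P]_w (g t w)%:E)%E,
      measurable_fun setT (fun w => \int[nu]_(t in D) (g t w)%:E)%E &
      measurable_fun setT (fun t : TR => \int[P]_w (g t w)%:E)%E].
Proof.
move=> mD mg g0.
pose f (z : TR * Omega) := ((\1_D z.1 : R) * g z.1 z.2)%:E.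
have mi : measurable_fun setT (fun z : TR * Omega => (\1_D z.1 : R)).
  by apply: (measurableT_comp (f := (\1_D : TR -> R))); [exact: measurable_indic|exact: measurable_fst].
have mf : measurable_fun setT f by apply/measurable_EFinP; exact: measurable_funM.
have f0 z : (0 <= f z)%E by rewrite lee_fin mulr_ge0// indicE.
have mE : measurable_fun setT (fun z : TR * Omega => (g z.1 z.2)%:E) by exact/measurable_EFinP.
have gE0 (z : TR * Omega) : (0 <= (g z.1 z.2)%:E)%E by rewrite lee_fin.
have inE' w : (\int[nu]_(t in D) (g t w)%:E = \int[nu]_t f (t, w))%E.
  rewrite integral_mkcond; apply: eq_integral => t _.
  by rewrite epatch_indic /f/= EFinM muleC.
split.
- under eq_integral do rewrite inE'.
  rewrite -(fubini_tonelli f)// [RHS]integral_mkcond; apply: eq_integral => t _.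
  rewrite epatch_indic /f/=.
  under eq_integral do rewrite EFinM.
  rewrite ge0_integralZl//; first by rewrite muleC.
  - by apply/measurable_EFinP; exact: (measurableT_comp mg (measurable_pair1 t)).
  - by move=> w _; rewrite lee_fin.
- under eq_fun do rewrite inE'.
  exact: (measurable_fun_fubini_tonelli_G f).
- exact: (measurable_fun_fubini_tonelli_F (fun z : TR * Omega => (g z.1 z.2)%:E)).
Qed.

End joint_measurability.

Section exponential_kernel.
Context {R : realType}.
Local Notation mu := (@lebesgue_measure R).
Local Notation TR := (measurableTypeR R).
Variable a : R.
Hypothesis a0 : 0 < a.

Definition exp_kernel t : R := a * expR (- (a * t)).

Lemma exp_kernel_ge0 t : 0 <= exp_kernel t.
Proof. by rewrite mulr_ge0 ?expR_ge0// ltW. Qed.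

Lemma measurable_exp_kernel : measurable_fun setT exp_kernel.
Proof.
apply: measurable_funM => //; apply: measurableT_comp => //.
by apply: measurable_funN; exact: measurable_funM.
Qed.

Lemma integral_exp_kernel : (\int[mu]_(t in `[0%R, +oo[) (exp_kernel t)%:E = 1)%E.
Proof.
rewrite -(integral_exponential_pdf a0) integral_mkcond; apply: eq_integral => t _.
by rewrite /exponential_pdf !patchE; case: ifP => // _; rewrite /exp_kernel mulNr.
Qed.

Lemma integral_exp_kernel_tail s : 0 <= s ->
  (\int[mu]_(t in `[s, +oo[) (exp_kernel t)%:E = (expR (- (a * s)))%:E)%E.
Proof.
move=> s0; have := integral_exp_kernel.
have mk (D : set TR) : measurable_fun D (fun t : TR => (exp_kernel t)%:E).
  by apply/measurable_EFinP/measurable_funTS; exact: measurable_exp_kernel.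
have k0 t : (0 <= (exp_kernel t)%:E)%E by rewrite lee_fin exp_kernel_ge0.
move: s0; rewrite le_eqVlt => /predU1P[<- ->|s0]; first by rewrite mulr0 oppr0 expR0.
have -> : [set` `[0%R, +oo[] = [set` `[0, s]%R] `|` [set` `]s, +oo[%R].
  apply/seteqP; split => t /=; rewrite !in_itv/= !andbT.
    by move=> ->/=; case: (leP t s) => ?; [left|right].
  by move=> [/andP[]//|]; move/ltW; apply: le_trans; exact: ltW.
have dj : [disjoint [set` `[0, s]%R] & [set` `]s, +oo[%R]].
  rewrite disj_set2E; apply/eqP; rewrite -subset0 => t []/=.
  by rewrite !in_itv/= andbT => /andP[_ ts] /(le_lt_trans ts); rewrite ltxx.
rewrite ge0_integral_setU//.
rewrite [X in (X + _)%E](_ : _ = (1 - (expR (- (a * s)))%:E)%E); last first.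
  rewrite -mulNr -(exponential_prob_itv0c a s0) /exponential_prob.
  apply: eq_integral => t; rewrite inE/= in_itv/= => /andP[t0 _].
  by rewrite exponential_pdfE// /exp_kernel mulNr.
rewrite integral_itv_obnd_cbnd; last exact: mk.
set I := integral _ _ _.
have I0 : (0 <= I)%E by apply: integral_ge0.
case: I I0 => [r| |]// _; rewrite -EFinB -EFinD => -[] ?; congr EFin; lra.
Qed.

(* Tonelli: e^(-a t) is the kernel mass of [t, +oo[. *)
Lemma integral_exp_stieltjes (nu : {sigma_finite_measure set TR -> \bar R}) (F : R -> R) :
  (forall s, 0 <= s -> nu [set` `[0, s]%R] = (F s)%:E) ->
  (\int[nu]_(t in `[0%R, +oo[) (expR (- (a * t)))%:E =
   \int[mu]_(s in `[0%R, +oo[) (exp_kernel s * F s)%:E)%E.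
Proof.
move=> nuF.
pose f (z : TR * TR) : \bar R :=
  ((\1_[set z : TR * TR | 0 <= z.1 <= z.2] z : R) * exp_kernel z.2)%:E.
have mS : measurable [set z : TR * TR | 0 <= z.1 <= z.2].
  rewrite (_ : [set _ | _] = (setT `&` (fun z : TR * TR => z.1) @^-1` [set` `[0, +oo[%R]) `&`
     (setT `&` (fun z : TR * TR => z.2 - z.1) @^-1` [set` `[0, +oo[%R])).
    apply: measurableI.
      by apply: (measurable_fst : measurable_fun setT (fst : TR * TR -> TR)).
    have : measurable_fun setT (fun z : TR * TR => z.2 - z.1 : R).
      by apply: measurable_funB; [exact: measurable_snd|exact: measurable_fst].
    by apply.
  apply/seteqP; split => z /=; rewrite !in_itv/= !andbT subr_ge0; first by move=> /andP[].
  by move=> [[_ ->] [_ ->]].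
have mf : measurable_fun setT f.
  apply/measurable_EFinP; apply: measurable_funM; first exact: measurable_indic.
  by apply: (measurableT_comp (f := exp_kernel)); [exact: measurable_exp_kernel|exact: measurable_snd].
have f0 z : (0 <= f z)%E by rewrite lee_fin mulr_ge0 ?exp_kernel_ge0// indicE.
have mi (x y : R) : (y \in [set` `[x, +oo[%R]) = (x <= y) by rewrite mem_setE in_itv/= andbT.
have fE (t s : R) : f (t, s) = (((0 <= t <= s)%R%:R : R) * exp_kernel s)%:E.
  rewrite /f indicE (_ : (_ \in _) = (0 <= t <= s)%R)//.
  by apply/idP/idP; rewrite inE.
transitivity (\int[nu]_t \int[mu]_s f (t, s))%E.
  rewrite integral_mkcond; apply: eq_integral => t _; rewrite patchE mi; case: ifPn => t0.
    rewrite -integral_exp_kernel_tail// integral_mkcond; apply: eq_integral => s _.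
    by rewrite fE patchE mi t0/=; case: (t <= s); rewrite ?mul1r ?mul0r.
  rewrite -[LHS](@integral0 _ _ _ mu setT); apply: eq_integral => s _.
  by rewrite fE (negbTE t0) mul0r.
rewrite (fubini_tonelli f)// [RHS]integral_mkcond; apply: eq_integral => s _.
rewrite patchE mi; case: ifPn => s0; last first.
  rewrite -[RHS](@integral0 _ _ _ nu setT); apply: eq_integral => t _.
  rewrite fE (_ : (0 <= t <= s) = false) ?mul0r//.
  by apply/negP => /andP[t0 ts]; rewrite (le_trans t0 ts) in s0.
rewrite EFinM -nuF// -[X in (_ * nu X)%E](setIT) -[in RHS]integral_indic//.
rewrite -ge0_integralZl//.
- apply: eq_integral => t _; rewrite fE -EFinM mulrC; congr (_ * _)%:E.
  by rewrite indicE mem_setE in_itv.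
- by apply/measurable_EFinP; exact: measurable_indic.
- by rewrite lee_fin exp_kernel_ge0.
Qed.

(** The mean of the exponential law, read off from [integral_exp_stieltjes] with Lebesgue measure as
    the Stieltjes measure. *)
Lemma integral_exp_kernel_id :
  (\int[mu]_(s in `[0%R, +oo[) (exp_kernel s * s)%:E = (a^-1)%:E)%E.
Proof.
have muF s : 0 <= s -> mu [set` `[0, s]%R] = (idfun s)%:E.
  rewrite lebesgue_measure_itv/= lte_fin le_eqVlt => /predU1P[<-|s0].
    by rewrite ltxx.
  by rewrite s0 -EFinB subr0.
rewrite -[LHS](integral_exp_stieltjes muF).
transitivity (\int[mu]_(s in `[0%R, +oo[) ((a^-1)%:E * (exp_kernel s)%:E))%E.
  by apply: eq_integral => s _; rewrite -EFinM /exp_kernel mulKf// gt_eqF.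
rewrite ge0_integralZl//.
- by rewrite integral_exp_kernel mule1.
- by apply/measurable_EFinP/measurable_funTS; exact: measurable_exp_kernel.
- by move=> s _; rewrite lee_fin exp_kernel_ge0.
- by rewrite lee_fin invr_ge0 ltW.
Qed.

End exponential_kernel.

(** * Expected costs *)

Section cost_function.
Context {R : realType}.
Variables (C : R -> R) (K gamma : R).
Hypotheses (C_ge0 : forall y, 0 <= y -> 0 <= C y)
  (C_cont : {within `[0, +oo[, continuous C})
  (C_nd : forall y z, 0 <= y -> y <= z -> C y <= C z)
  (hK : 0 < K) (hgamma : 0 < gamma)
  (C_growth : forall y, 0 <= y -> C y <= K * (1 + y `^ gamma)).

(** Freezing C on the negative axis makes it continuous, hence measurable, on the whole line; states
    and running maxima never see the difference, being nonnegative. *)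
Definition extended_cost y := C (Num.max 0 y).
Local Notation Cp := extended_cost.

Let max0 (y : R) : 0 <= Num.max 0 y. Proof. by rewrite le_max lexx. Qed.

Lemma extended_costE y : 0 <= y -> Cp y = C y.
Proof. by move=> y0; rewrite /extended_cost max_r. Qed.

Lemma extended_cost_ge0 y : 0 <= Cp y. Proof. exact: C_ge0. Qed.

Lemma extended_cost_nd y z : y <= z -> Cp y <= Cp z.
Proof. by move=> yz; apply: C_nd => //; rewrite ge_max max0/= le_max yz orbT. Qed.

Lemma extended_cost_continuous : continuous Cp.
Proof.
move=> y; apply/(@cvgrPdist_lt _ R^o) => e e0.
have [d d0 dC] := (within_ge0_continuousP C).1 C_cont _ e (max0 y) e0.
exists d => //= z yz; rewrite distrC; apply: dC => //.
apply: le_lt_trans yz; have h1 := ler_norm (y - z); have := ler_norm (z - y).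
rewrite distrC; move: (`|y - z|) h1 => r h1 h2; rewrite ler_norml.
by rewrite !maxEle; do 2 case: ifPn; rewrite -?ltNge => *; apply/andP; split; lra.
Qed.

Lemma measurable_extended_cost : measurable_fun setT Cp.
Proof. by apply: continuous_measurable_fun; exact: extended_cost_continuous. Qed.

(** An integer exponent above gamma, since [running_max_moment] concerns integer powers. *)
Definition cost_degree := Num.bound gamma.

Lemma extended_cost_growth y : 0 <= y -> Cp y <= 2 * K * (1 + y) ^+ cost_degree.
Proof.
move=> y0; rewrite extended_costE// (le_trans (C_growth y0))//.
rewrite -mulrA mulrCA ler_pM2l//.
have y1 : 1 <= (1 + y) ^+ cost_degree by rewrite exprn_ege1// lerDl.
have : y `^ gamma <= (1 + y) ^+ cost_degree; last lra.
apply: (@le_trans _ _ ((1 + y) `^ gamma)).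
  by apply: ge0_ler_powR; rewrite ?nnegrE ?(ltW hgamma)//; lra.
rewrite -powR_mulrn; last lra.
apply: ler_powR; first lra.
by apply/ltW/archi_boundP/ltW.
Qed.

End cost_function.

Section expected_costs.
Context {d} {Omega : measurableType d} {R : realType}.
Variables (P : probability Omega R) (H : R) (W : R -> {RV P >-> R}).
Variables (C : R -> R) (K gamma x : R).
Hypotheses (hH : 2^-1 <= H < 1) (hW : fractional_brownian_motion H W).
Hypotheses (C_ge0 : forall y, 0 <= y -> 0 <= C y)
  (C_cont : {within `[0, +oo[, continuous C})
  (C_nd : forall y z, 0 <= y -> y <= z -> C y <= C z)
  (hK : 0 < K) (hgamma : 0 < gamma)
  (C_growth : forall y, 0 <= y -> C y <= K * (1 + y `^ gamma))
  (hx : 0 <= x).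
Local Notation Cp := (extended_cost C).
Local Notation M u t w := (running_max u (W ^~ w) t).
Local Notation L u t w := (regulator x u (W ^~ w) t).
Local Notation Xx u t w := (reflected x u (W ^~ w) t).
Local Notation X0 u t w := (reflected 0 u (W ^~ w) t).

Let W0 w : W 0 w = 0. Proof. by have [_ _ _ + _] := hW; apply. Qed.
Let cW w : {within `[0, +oo[, continuous (fun t => W t w)}.
Proof. by have [_ _ _ _] := hW; apply. Qed.
Let gW : gaussian_process W. Proof. by have [] := hW. Qed.
Let EW t : 0 <= t -> ('E_P[W t] = 0)%E. Proof. by have [_ + _ _ _] := hW; apply. Qed.
Let Cp0 y : 0 <= Cp y. Proof. exact: extended_cost_ge0. Qed.
Let mC : measurable_fun setT Cp. Proof. exact: measurable_extended_cost. Qed.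
Let mM u t : 0 <= t -> measurable_fun setT (fun w => M u t w).
Proof. by move=> t0; exact: (measurable_running_max hW). Qed.
Let mX u t : 0 <= t -> measurable_fun setT (fun w => Xx u t w).
Proof. by move=> t0; exact: (measurable_reflected_fbm hW). Qed.
Let mX0 u t : 0 <= t -> measurable_fun setT (fun w => X0 u t w).
Proof. by move=> t0; exact: (measurable_reflected_fbm hW). Qed.
Let mL u t : 0 <= t -> measurable_fun setT (fun w => L u t w).
Proof. by move=> t0; exact: (measurable_regulator_fbm hW). Qed.
Let mCE (f : Omega -> R) : measurable_fun setT f -> measurable_fun setT (fun w => (Cp (f w))%:E).
Proof. by move=> mf; apply/measurable_EFinP; exact: (measurableT_comp mC mf). Qed.
Let M0 u t w : 0 <= M u t w. Proof. exact: regulator_ge0. Qed.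

(** The function G. By [reflected_max_cost] it is also the expected cost of the state started at 0,
    a form in which its monotonicity in t is not visible. *)
Definition max_cost u t : \bar R := (\int[P]_w (Cp (M u t w))%:E)%E.
Definition state_cost u t : \bar R := (\int[P]_w (Cp (Xx u t w))%:E)%E.

Lemma max_cost_ge0 u t : (0 <= max_cost u t)%E.
Proof. by apply: integral_ge0 => w _; rewrite lee_fin. Qed.

Lemma state_cost_ge0 u t : (0 <= state_cost u t)%E.
Proof. by apply: integral_ge0 => w _; rewrite lee_fin. Qed.

Lemma reflected_max_cost u t : 0 <= t -> (\int[P]_w (Cp (X0 u t w))%:E = max_cost u t)%E.
Proof. by move=> t0; exact: (reflected_integral hH hW). Qed.

Lemma max_cost_nd u s t : 0 <= s -> s <= t -> (max_cost u s <= max_cost u t)%E.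
Proof.
move=> s0 st; have t0 := le_trans s0 st.
apply: ge0_le_integral => //.
- by move=> w _; rewrite lee_fin.
- exact/mCE/mM.
- exact/mCE/mM.
- move=> w _; rewrite lee_fin; apply: extended_cost_nd => //.
  exact: (running_max_nd (@cW w)).
Qed.

Lemma max_cost_ni u v t : 0 <= t -> u <= v -> (max_cost v t <= max_cost u t)%E.
Proof.
move=> t0 uv; apply: ge0_le_integral => //.
- by move=> w _; rewrite lee_fin.
- exact/mCE/mM.
- exact/mCE/mM.
- move=> w _; rewrite lee_fin; apply: extended_cost_nd => //.
  apply: regulator_nd_u => //; last by rewrite lerN2.
  exact: (oppr_within_continuous (@cW w)).
Qed.

(** As v decreases to l the running maximum increases, and differs from its limit by at most (v - l)
    t. Monotone convergence then applies whether or not G l t is finite. *)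
Lemma max_cost_right_limit l t (y : \bar R) : 0 <= t ->
  (forall v, (l < v)%R -> max_cost v t <= y)%E -> (max_cost l t <= y)%E.
Proof.
move=> t0 Hy; pose v k : R := l + k.+1%:R^-1.
have cvgv w : (Cp (M (v k) t w))%:E @[k --> \oo] --> (Cp (M l t w))%:E.
  apply: cvg_EFin; first exact: nearW.
  apply: (cvg_comp (fun k => M (v k) t w) Cp); last exact: extended_cost_continuous.
  apply/(@cvgrPdist_le _ R^o) => e e0; near=> k.
  have kt : k.+1%:R^-1 * t <= e.
    rewrite mulrC ler_pdivrMr// -ler_pdivrMl// (@le_trans _ _ k%:R) ?ler_nat//.
    by near: k; apply: nbhs_infty_ger.
  have k0 : 0 <= (k.+1%:R : R)^-1 by rewrite invr_ge0.
  have lv : - v k <= - l by rewrite lerN2 lerDl.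
  have cN := oppr_within_continuous (@cW w).
  have h1 : M (v k) t w <= M l t w := regulator_nd_u cN 0 lv t0.
  have h2 : M l t w <= M (v k) t w + (- l - - v k) * t := regulator_le_u cN 0 lv t0.
  rewrite (_ : - l - - v k = k.+1%:R^-1) in h2; last by rewrite /v; ring.
  move: h1 h2 kt; rewrite ler_norml; set a := M l t w; set b := M (v k) t w.
  by move: (k.+1%:R^-1 * t) => c *; apply/andP; split; lra.
have -> : max_cost l t = limn (fun k => max_cost (v k) t).
  rewrite /max_cost -monotone_convergence//.
  - by apply: eq_integral => w _; apply/esym/cvg_lim => //; exact: cvgv.
  - by move=> k; exact/mCE/mM.
  - by move=> k w _; rewrite lee_fin.
  - move=> w _ j k jk; rewrite lee_fin; apply: extended_cost_nd => //.
    apply: regulator_nd_u => //; first exact: (oppr_within_continuous (@cW w)).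
    by rewrite lerN2 lerD2l lef_pV2 ?posrE// ler_nat ltnS.
apply: lime_le.
  apply: ereal_nondecreasing_is_cvgn => j k jk; apply: max_cost_ni => //.
  by rewrite lerD2l lef_pV2 ?posrE// ler_nat ltnS.
by apply: nearW => k; apply: Hy; rewrite ltrDl invr_gt0.
Unshelve. all: by end_near. Qed.

Let add_pow_le (a b : R) m : 0 <= a -> 0 <= b -> (a + b) ^+ m <= 2 ^+ m * a ^+ m + 2 ^+ m * b ^+ m.
Proof.
move=> a0 b0; wlog ab : a b a0 b0 / a <= b => [hwlog|].
  by have [ab|/ltW ba] := leP a b; [exact: hwlog|rewrite addrC [leRHS]addrC hwlog].
rewrite -!exprMn (@le_trans _ _ ((2 * b) ^+ m))//.
  by apply: lerXn2r; rewrite ?nnegrE; lra.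
by rewrite lerDr exprn_ge0// mulr_ge0.
Qed.

Let shifted_moment y m v : 0 <= y -> 0 < v -> exists2 B : R, 0 <= B &
  forall t, 0 <= t -> (\int[P]_w ((y + M v t w) ^+ m)%:E <= B%:E)%E.
Proof.
move=> y0 v0; have [B B0 BE] := running_max_moment hH hW m v0.
exists (2 ^+ m * y ^+ m + 2 ^+ m * B) => [|t t0].
  by rewrite addr_ge0// mulr_ge0// exprn_ge0.
apply: (@le_trans _ _ (\int[P]_w ((2 ^+ m * y ^+ m)%:E + (2 ^+ m)%:E * (M v t w ^+ m)%:E))%E).
  apply: ge0_le_integral => //.
  - by move=> w _; rewrite lee_fin exprn_ge0// addr_ge0.
  - by apply/measurable_EFinP/measurable_funX; apply: measurable_funD => //; exact: mM.
  - apply: emeasurable_funD => //; apply: emeasurable_funM => //.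
    by apply/measurable_EFinP/measurable_funX; exact: mM.
  - by move=> w _; rewrite -EFinM -EFinD lee_fin add_pow_le.
have mMm : measurable_fun setT (fun w => (M v t w ^+ m)%:E).
  by apply/measurable_EFinP/measurable_funX; exact: mM.
rewrite ge0_integralD//; first last.
- by apply: emeasurable_funM.
- by move=> w _; rewrite -EFinM lee_fin mulr_ge0// exprn_ge0.
- by move=> w _; rewrite lee_fin mulr_ge0// exprn_ge0.
rewrite integral_cst// [X in (_ * X)%E]probability_setT mule1 ge0_integralZl//; last first.
  by move=> w _; rewrite lee_fin exprn_ge0.
rewrite EFinD EFinM leeD// EFinM lee_wpmul2l ?lee_fin ?exprn_ge0//.
exact: BE.
Qed.

Lemma max_cost_bounded u : 0 < u -> exists2 B : R, 0 <= B &
  forall t, 0 <= t -> (max_cost u t <= B%:E)%E.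
Proof.
move=> u0; have [B B0 BE] := @shifted_moment 1 (cost_degree gamma) u ler01 u0.
exists (2 * K * B) => [|t t0]; first by rewrite mulr_ge0// mulr_ge0// ltW.
have k0 : 0 <= 2 * K by rewrite mulr_ge0// ltW.
have mMm : measurable_fun setT (fun w => ((1 + M u t w) ^+ cost_degree gamma)%:E).
  by apply/measurable_EFinP/measurable_funX; apply: measurable_funD => //; exact: mM.
apply: (@le_trans _ _ (\int[P]_w ((2 * K)%:E * ((1 + M u t w) ^+ cost_degree gamma)%:E))%E).
  apply: ge0_le_integral => //.
  - by move=> w _; rewrite lee_fin.
  - exact/mCE/mM.
  - exact: emeasurable_funM.
  - move=> w _; rewrite -EFinM lee_fin.
    exact: (extended_cost_growth hK hgamma C_growth).
rewrite ge0_integralZl//; last by move=> w _; rewrite lee_fin exprn_ge0// addr_ge0.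
by rewrite [leRHS]EFinM lee_wpmul2l ?lee_fin// BE.
Qed.

Lemma state_cost_lower u t : 0 <= t -> (max_cost u t <= state_cost u t)%E.
Proof.
move=> t0; rewrite -reflected_max_cost//.
apply: ge0_le_integral => //.
- by move=> w _; rewrite lee_fin.
- exact/mCE/mX0.
- exact/mCE/mX.
- move=> w _; rewrite lee_fin; apply: extended_cost_nd => //.
  exact: (reflected_ge0x (@cW w)).
Qed.

(* On the event that the started path has not yet been reflected, the running
   maximum for half the drift is of order t; the moments make this event negligible. *)
Lemma state_cost_upper_pos u : 0 < u -> exists2 B : R, 0 <= B &
  forall t, 0 <= t -> (state_cost u t <= max_cost u t + (B / (1 + u / 2 * t))%:E)%E.
Proof.
move=> u0; pose v := u / 2; have v0 : 0 < v by rewrite divr_gt0.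
pose q := cost_degree gamma.
have x1 : 0 <= 1 + x by rewrite addr_ge0.
have [B B0 BE] := @shifted_moment (1 + x) q.+1 v x1 v0.
exists (2 * K * B) => [|t t0]; first by rewrite mulr_ge0// mulr_ge0// ltW.
have vt : 0 < 1 + v * t by rewrite ltr_pwDl// mulr_ge0// ltW.
pose k := 2 * K / (1 + v * t).
have k0 : 0 <= k by rewrite divr_ge0 ?mulr_ge0 ?ltW.
have mMm : measurable_fun setT (fun w => ((1 + x + M v t w) ^+ q.+1)%:E).
  by apply/measurable_EFinP/measurable_funX; apply: measurable_funD => //; exact: mM.
have A0 w : 0 <= 1 + x + M v t w by rewrite addr_ge0.
apply: (@le_trans _ _ (\int[P]_w ((Cp (X0 u t w))%:E + k%:E * ((1 + x + M v t w) ^+ q.+1)%:E))%E).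
  apply: ge0_le_integral => //.
  - by move=> w _; rewrite lee_fin.
  - exact/mCE/mX.
  - by apply: emeasurable_funD; [exact/mCE/mX0|exact: emeasurable_funM].
  - move=> w _; rewrite -EFinM -EFinD lee_fin.
    have e0 : 0 <= k * (1 + x + M v t w) ^+ q.+1 by rewrite mulr_ge0// exprn_ge0.
    have := reflected_le_max (@cW w) u hx t0; rewrite le_max => /orP[Xa|X0']; last first.
      by have := extended_cost_nd C_nd X0'; lra.
    set a := x - u * t + W t w in Xa.
    have Xp := reflected_ge0 (@cW w) x u t0.
    have a0 : 0 <= a by exact: le_trans Xa.
    have Mv : W t w - v * t <= M v t w.
      by apply: (running_max_ge (@cW w)); rewrite t0 lexx.
    have aA : 1 + a <= 1 + x + M v t w.
      have : v * t <= u * t by rewrite ler_wpM2r// /v; lra.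
      rewrite /a; lra.
    have tA : 1 + v * t <= 1 + x + M v t w.
      have uv : u * t = v * t + v * t by rewrite /v; field.
      by move: a0; rewrite /a uv; lra.
    have h1 : Cp (Xx u t w) <= 2 * K * (1 + x + M v t w) ^+ q.
      apply: le_trans (extended_cost_nd C_nd Xa) _.
      apply: le_trans (extended_cost_growth hK hgamma C_growth a0) _.
      rewrite ler_wpM2l ?mulr_ge0 ?(ltW hK)//.
      by apply: lerXn2r => //; rewrite nnegrE; lra.
    (* Here A = 1 + x + M is at least 1 + v t, so one more power of A pays for the decaying factor 1
       / (1 + v t). *)
    have h2 : 2 * K * (1 + x + M v t w) ^+ q <= k * (1 + x + M v t w) ^+ q.+1.
      set A := 1 + x + M v t w in tA *.
      have r1 : 1 <= A / (1 + v * t) by rewrite ler_pdivlMr// mul1r.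
      have -> : k * A ^+ q.+1 = 2 * K * A ^+ q * (A / (1 + v * t)).
        by rewrite /k exprS; field; rewrite gt_eqF.
      by rewrite ler_peMr// mulr_ge0 ?mulr_ge0 ?(ltW hK)// exprn_ge0// A0.
    have := Cp0 (X0 u t w); lra.
rewrite ge0_integralD//; first last.
- exact: emeasurable_funM.
- by move=> w _; rewrite -EFinM lee_fin mulr_ge0// exprn_ge0.
- exact/mCE/mX0.
- by move=> w _; rewrite lee_fin.
rewrite reflected_max_cost// ge0_integralZl//; last by move=> w _; rewrite lee_fin exprn_ge0.
rewrite leeD2l//; apply: (@le_trans _ _ (k%:E * B%:E)%E).
  by rewrite lee_wpmul2l ?lee_fin// BE.
by rewrite -EFinM lee_fin /k mulrAC.
Qed.

Let measurable_large t c : 0 <= t -> measurable [set w | c < W t w].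
Proof.
move=> t0; rewrite (_ : [set _ | _] = setT `&` (W t @^-1` [set` `]c, +oo[%R])).
  exact: measurable_funPT.
by apply/seteqP; split => w /=; rewrite in_itv/= andbT; [move=> ?; split|case].
Qed.

(** Take y with C y within e / 2 of the supremum of C, and c = max x y. If W t < -c the free path is
    negative, so the state is bounded by the one started at 0. If W t > c, the state started at 0
    exceeds y and its cost is already almost maximal. The remaining event |W t| <= c becomes
    rare. *)
Lemma state_cost_upper_0 Cm : (forall y, 0 <= y -> C y <= Cm) ->
  forall e, 0 < e -> exists2 t0, 0 <= t0 & forall t, t0 <= t ->
    (state_cost 0 t <= max_cost 0 t + e%:E)%E.
Proof.
move=> CCm e e0; have Cm0 : 0 <= Cm by apply: le_trans (CCm 0 (lexx _)); exact: C_ge0.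
have [y y0 Cy] : exists2 y, 0 <= y & forall z, 0 <= z -> C z <= C y + e / 2.
  pose S := [set C z | z in [set z : R | 0 <= z]].
  have hS : has_sup S.
    by split; [exists (C 0), 0 => /=|exists Cm => _ [z /= z0 <-]; exact: CCm].
  have e20 : 0 < e / 2 by rewrite divr_gt0.
  have [_ [y /= y0 <-] yS] := sup_adherent e20 hS.
  exists y => // z z0.
  have : C z <= sup S by apply: ub_le_sup; [exact: hS.2|exists z].
  by move: yS; lra.
pose c := Num.max x y; have c0 : 0 <= c by rewrite le_max hx.
(* This probability times Cm is at most e / 2; adding 1 avoids dividing by zero. *)
have d0 : 0 < e / 2 / (Cm + 1) by rewrite !divr_gt0//; lra.
have [t0 t00 tP] := fbm_small_ball hH hW c0 d0.
exists t0 => [|t tt]; first exact: ltW.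
have t0' : 0 <= t by apply: le_trans (ltW t00) tt.
pose A := W t @^-1` [set` `[- c, c]%R].
have mA : measurable A by rewrite -[A]setTI; exact: measurable_funPT.
apply: (@le_trans _ _ (\int[P]_w ((Cp (X0 0 t w))%:E + ((e / 2)%:E + Cm%:E * (\1_A w)%:E)))%E).
  apply: ge0_le_integral => //.
  - by move=> w _; rewrite lee_fin.
  - exact/mCE/mX.
  - apply: emeasurable_funD; first exact/mCE/mX0.
    apply: emeasurable_funD => //; apply: emeasurable_funM => //.
    by apply/measurable_EFinP; exact: measurable_indic.
  - move=> w _; rewrite -EFinM -!EFinD lee_fin.
    have i0 : 0 <= Cm * (\1_A w : R) by rewrite mulr_ge0// indicE.
    have X0p := reflected_ge0 (@cW w) 0 0 t0'.
    have Xp := reflected_ge0 (@cW w) x 0 t0'.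
    have e2 : 0 < e / 2 by rewrite divr_gt0.
    have [wA|/negP wA] := boolP (w \in A).
      rewrite indicE wA mulr1 (@le_trans _ _ Cm)//.
        by rewrite extended_costE// CCm.
      have := Cp0 (X0 0 t w); lra.
    have [wc|cw] := ltP (W t w) (- c).
      have := reflected_le_max (@cW w) 0 hx t0'; rewrite le_max => /orP[Xa|X0'].
        have xc : x <= c by rewrite le_max lexx.
        by exfalso; move: Xp Xa; rewrite mul0r; lra.
      by have := extended_cost_nd C_nd X0'; lra.
    have {}cw : c < W t w.
      rewrite ltNge; apply/negP => wc; apply: wA; rewrite inE /A/= in_itv/=.
      by rewrite cw wc.
    have yX : y <= X0 0 t w.
      rewrite /reflected; have := regulator_ge0 0 0 (W ^~ w) t.
      have yc : y <= c by rewrite le_max lexx orbT.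
      by rewrite mul0r; lra.
    have := Cy _ Xp; have := extended_cost_nd C_nd yX.
    rewrite (extended_costE C y0) (extended_costE C Xp); lra.
have m1 : measurable_fun setT (fun w => Cm%:E * (\1_A w)%:E)%E.
  by apply: emeasurable_funM => //; apply/measurable_EFinP; exact: measurable_indic.
have i0 w : (0 <= Cm%:E * (\1_A w)%:E)%E by rewrite mule_ge0// lee_fin indicE.
have e20 : (0 <= (e / 2)%:E)%E by rewrite lee_fin divr_ge0// ltW.
rewrite ge0_integralD//; first last.
- exact: emeasurable_funD.
- by move=> w _; rewrite adde_ge0.
- exact/mCE/mX0.
- by move=> w _; rewrite lee_fin.
rewrite reflected_max_cost// leeD2l// ge0_integralD//.
rewrite integral_cst// [X in (_ * X)%E]probability_setT mule1.
rewrite ge0_integralZl//; last first.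
  by apply/measurable_EFinP; exact: measurable_indic.
rewrite integral_indic// setIT.
apply: (@le_trans _ _ ((e / 2)%:E + Cm%:E * (e / 2 / (Cm + 1))%:E)%E).
  by rewrite leeD2l// lee_wpmul2l ?lee_fin// tP.
rewrite -EFinM -EFinD lee_fin.
have : Cm * (e / 2 / (Cm + 1)) <= e / 2; last by move=> ?; lra.
rewrite mulrA ler_pdivrMr ?ltr_wpDl// mulrC ler_wpM2l//; lra.
Qed.

(** When |W t| <= y has probability at most 1/2, symmetry gives W t > y probability at least 1/4,
    and there the running maximum exceeds y. This is the origin of the factor 4. *)
Lemma max_cost_0_bounded (B : R) : (forall t, (0 <= t)%R -> max_cost 0 t <= B%:E)%E ->
  forall y, 0 <= y -> C y <= 4 * B.
Proof.
move=> GB y y0.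
have h2 : 0 < 2^-1 :> R by rewrite invr_gt0.
have [t0 t00 tP] := fbm_small_ball hH hW y0 h2.
have t0' := ltW t00; have {tP} := tP _ (lexx _).
pose A := W t0 @^-1` [set` `[- y, y]%R].
pose D1 := [set w | y < W t0 w]; pose D2 := [set w | y < - W t0 w].
rewrite -/A => PA.
have mA : measurable A by rewrite -[A]setTI; exact: measurable_funPT.
have m1 : measurable D1 by exact: measurable_large.
have D2E : D2 = setT `&` (W t0 @^-1` [set` `]-oo, - y[%R]).
  apply/seteqP; split => w /=; rewrite in_itv/= ltrNr; first by move=> ?; split.
  by case.
have m2 : measurable D2 by rewrite D2E; exact: measurable_funPT.
have P12 : P D1 = P D2.
  have := @fbm_symmetric _ _ _ P H W hW t0 t0' [set` `]y, +oo[%R] (measurable_itv _).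
  rewrite (_ : W t0 @^-1` _ = D1); last by apply/seteqP; split => w /=; rewrite in_itv/= andbT.
  by rewrite (_ : _ @^-1` _ = D2)//; apply/seteqP; split => w /=; rewrite in_itv/= andbT.
have cover : (1 <= P A + (P D1 + P D2))%E.
  rewrite -(@probability_setT _ _ _ P).
  apply: (@le_trans _ _ (P (A `|` (D1 `|` D2)))); last first.
    apply: le_trans (measureU2 _ _ _) _ => //; first exact: measurableU.
    by rewrite leeD2l//; exact: measureU2.
  apply: le_measure; rewrite ?inE//; first by apply: measurableU => //; exact: measurableU.
  move=> w _; have [wy|wy] := leP (W t0 w) y; last by right; left.
  have [yw|yw] := leP (- y) (W t0 w); first by left; rewrite /A/= in_itv/= yw wy.
  by right; right; rewrite /D2/= ltrNr.
have quarter : ((4^-1 : R)%:E <= P D1)%E.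
  have fA : P A \is a fin_num by exact: fin_num_measure.
  have f1 : P D1 \is a fin_num by exact: fin_num_measure.
  move: cover PA; rewrite -P12 -(fineK fA) -(fineK f1) -!EFinD !lee_fin; lra.
suff : ((C y)%:E * P D1 <= B%:E)%E.
  have f1 : P D1 \is a fin_num by exact: fin_num_measure.
  move: quarter; rewrite -(fineK f1) -EFinM !lee_fin => q1 q2.
  have : C y * 4^-1 <= C y * fine (P D1) by rewrite ler_wpM2l// C_ge0.
  by lra.
apply: le_trans (GB t0 t0').
have -> : ((C y)%:E * P D1 = \int[P]_w ((C y)%:E * (\1_D1 w)%:E))%E.
  rewrite ge0_integralZl//.
  - by rewrite integral_indic// setIT.
  - by apply/measurable_EFinP; exact: measurable_indic.
  - by rewrite lee_fin C_ge0.
apply: ge0_le_integral => //.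
- by move=> w _; rewrite mule_ge0// lee_fin ?C_ge0// indicE.
- by apply: emeasurable_funM => //; apply/measurable_EFinP; exact: measurable_indic.
- exact/mCE/mM.
- move=> w _; rewrite -EFinM lee_fin indicE; have [wD|_] := boolP (w \in D1); last by rewrite mulr0.
  rewrite mulr1 -(extended_costE C y0); apply: extended_cost_nd => //.
  have : W t0 w - 0 * t0 <= M 0 t0 w by apply: (running_max_ge (@cW w)); rewrite t0' lexx.
  by move: wD; rewrite inE /D1/= mul0r; lra.
Qed.

(** Nonnegativity of the state reads L >= u t - x - W t, and W t has mean 0. An infinite mean of L
    is split off so that L is integrable in the main case. *)
Lemma regulator_mean_lower u t : 0 <= t -> ((u * t - x)%:E <= \int[P]_w (L u t w)%:E)%E.
Proof.
move=> t0; set I := integral _ _ _.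
have [Ioo|] := eqVneq I +oo%E; first by rewrite Ioo leey.
rewrite -ltey => Ifin.
have iL : P.-integrable setT (fun w => (L u t w)%:E).
  apply/integrableP; split; first by apply/measurable_EFinP; exact: mL.
  by under eq_integral do rewrite gee0_abs ?lee_fin ?regulator_ge0//.
have iW := integrable_at gW EW t0.
have EW0 : (\int[P]_w (W t w)%:E = 0)%E by have := EW t0; rewrite expectation.unlock.
rewrite -[I]adde0 -EW0 -(integralD_EFin measurableT iL iW).
rewrite -[leLHS]mule1 -[X in (_ * X)%E](@probability_setT _ _ _ P) -integral_cst//.
apply: le_integral => //.
- exact: finite_measure_integrable_cst.
- exact: integrableD.
- move=> w _; rewrite /= -EFinD lee_fin.
  have := @regulator_ge _ _ (@cW w) x u t t; rewrite t0 lexx => /(_ isT); lra.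
Qed.

(** The regulator grows with the drift and shrinks with x, so it is at most the one for v and 0,
    which equals v t - W t plus the state started at 0. That state has bounded mean because v > 0;
    passing to v keeps u = 0 within reach. *)
Lemma regulator_mean_upper u v : u <= v -> 0 < v -> exists2 B : R, 0 <= B &
  forall t, 0 <= t -> (\int[P]_w (L u t w)%:E <= (v * t + B)%:E)%E.
Proof.
move=> uv v0; have [B B0 BE] := @shifted_moment 0 1 v (lexx _) v0.
exists B => // t t0.
have cp : continuous (fun z : R => Num.max z 0).
  by move=> z; apply: continuous_max; [exact: cvg_id|exact: cvg_cst].
have X0p w := reflected_ge0 (@cW w) 0 v t0.
have EX : (\int[P]_w (X0 v t w)%:E <= B%:E)%E.
  have := @reflected_integral _ _ _ P H W hH hW (fun z => Num.max z 0) v t t0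
    (continuous_measurable_fun cp) (fun z => _).
  have p0 (z : R) : 0 <= Num.max z 0 by rewrite le_max lexx orbT.
  move=> /(_ p0) XM; apply: le_trans (BE t t0).
  rewrite (_ : (\int[P]_w (X0 v t w)%:E = \int[P]_w (Num.max (X0 v t w) 0)%:E)%E); last first.
    by apply: eq_integral => w _; rewrite max_l.
  by rewrite XM; under eq_integral do rewrite max_l//; under [leRHS]eq_integral do rewrite add0r expr1.
have iX : P.-integrable setT (fun w => (X0 v t w)%:E).
  apply/integrableP; split; first by apply/measurable_EFinP; exact: mX0.
  under eq_integral do rewrite gee0_abs ?lee_fin//.
  by apply: le_lt_trans EX _; rewrite ltry.
have iW := integrable_at gW EW t0.
have EW0 : (\int[P]_w (W t w)%:E = 0)%E by have := EW t0; rewrite expectation.unlock.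
have ic : P.-integrable setT (fun=> (v * t)%:E) by exact: finite_measure_integrable_cst.
apply: (@le_trans _ _ (\int[P]_w (((v * t)%:E + (X0 v t w)%:E) - (W t w)%:E))%E).
  apply: ge0_le_integral => //.
  - by move=> w _; rewrite lee_fin regulator_ge0.
  - by apply/measurable_EFinP; exact: mL.
  - apply: emeasurable_funB; last by apply/measurable_EFinP.
    by apply: emeasurable_funD => //; apply/measurable_EFinP; exact: mX0.
  - move=> w _; rewrite -[leRHS]/((v * t + X0 v t w - W t w)%:E) lee_fin.
    have := regulator_le0 (@cW w) u hx t0; have := regulator_nd_u (@cW w) 0 uv t0.
    by rewrite /reflected; lra.
rewrite integralB//; last exact: integrableD.
rewrite EW0 sube0 integralD//.
rewrite integral_cst// [X in (_ * X)%E]probability_setT mule1 EFinD.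
by rewrite leeD2l.
Qed.

End expected_costs.

(** * Averages against a kernel of total mass 1 bounded by b *)

Section averaging_kernel.
Context {R : realType}.
Local Notation mu := (@lebesgue_measure R).
Local Notation TR := (measurableTypeR R).
Variables (D : set TR) (k : R -> R) (b : R).
Hypotheses (mD : measurable D) (D0 : forall t, D t -> 0 <= t)
  (mk : measurable_fun setT k) (k0 : forall t, 0 <= k t) (kb : forall t, D t -> k t <= b)
  (k1 : (\int[mu]_(t in D) (k t)%:E = 1)%E) (b0 : 0 <= b).

Let mkE (A : set TR) : measurable_fun A (fun t : TR => (k t)%:E).
Proof. by apply/measurable_EFinP/measurable_funTS. Qed.

Lemma kernel_initial_mass s : 0 <= s ->
  (\int[mu]_(t in D `&` [set` `[0%R, s[]) (k t)%:E <= (b * s)%:E)%E.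
Proof.
move=> s0; have mI : measurable ([set` `[0, s[%R] : set TR) by exact: measurable_itv.
apply: (@le_trans _ _ (\int[mu]_(t in [set` `[0%R, s[]) b%:E)%E); last first.
  rewrite integral_cst//= lebesgue_measure_itv/= lte_fin.
  by case: ifP => _; rewrite ?mule0 ?oppr0 ?adde0 ?lee_fin ?mulr_ge0.
apply: (@le_trans _ _ (\int[mu]_(t in D `&` [set` `[0%R, s[]) b%:E)%E).
  apply: ge0_le_integral => //.
  - exact: measurableI.
  - by move=> t _; rewrite lee_fin.
  - by move=> t [Dt _]; rewrite lee_fin kb.
apply: ge0_subset_integral => //.
exact: measurableI.
Qed.

(** Since the kernel is at most b, the initial interval [0, s[ takes at most b s of the total mass
    1. *)
Lemma kernel_tail_mass s : 0 <= s ->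
  ((1 - b * s)%:E <= \int[mu]_(t in D `&` [set` `[s, +oo[%R]) (k t)%:E)%E.
Proof.
move=> s0; have mI : measurable ([set` `[0, s[%R] : set TR) by exact: measurable_itv.
have mJ : measurable ([set` `[s, +oo[%R] : set TR) by exact: measurable_itv.
have DE : D = (D `&` [set` `[0%R, s[]) `|` (D `&` [set` `[s, +oo[%R]).
  apply/seteqP; split => t; last by case=> -[].
  move=> Dt; have [ts|st] := ltP t s; [left|right]; split=> //=; rewrite in_itv/= ?andbT//.
  by rewrite D0.
have dj : [disjoint D `&` [set` `[0%R, s[] & D `&` [set` `[s, +oo[%R]].
  rewrite disj_set2E; apply/eqP; rewrite -subset0 => t [[_ /=] + [_ /=]].
  by rewrite !in_itv/= andbT => /andP[_ ts] /(lt_le_trans ts); rewrite ltxx.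
have m1 : measurable (D `&` [set` `[0%R, s[]) by exact: measurableI.
have m2 : measurable (D `&` [set` `[s, +oo[%R]) by exact: measurableI.
have := k1; rewrite {1}DE ge0_integral_setU//; last by move=> t _; rewrite lee_fin.
have := kernel_initial_mass s0.
set I := integral _ _ _; set J := integral _ _ _ => Ib IJ.
have J0 : (0 <= J)%E by apply: integral_ge0 => t _; rewrite lee_fin.
have I0 : (0 <= I)%E by apply: integral_ge0 => t _; rewrite lee_fin.
have fI : I \is a fin_num by rewrite ge0_fin_numE// (le_lt_trans Ib)// ltry.
have fJ : J \is a fin_num.
  by rewrite ge0_fin_numE// (le_lt_trans _ (ltry 1))// -IJ leeDr.
move: Ib IJ; rewrite -(fineK fI) -(fineK fJ) -EFinD !lee_fin => ib [ij].
by lra.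
Qed.

Lemma kernel_average_lower (f : TR -> \bar R) s (y : \bar R) : 0 <= s -> b * s <= 1 ->
  measurable_fun setT f -> (forall t, (0 <= f t)%E) -> (0 <= y)%E ->
  (forall t, s <= t -> (y <= f t)%E) ->
  ((1 - b * s)%:E * y <= \int[mu]_(t in D) ((k t)%:E * f t))%E.
Proof.
move=> s0 bs mf f0 y0 yf.
have mJ : measurable (D `&` [set` `[s, +oo[%R]).
  by apply: measurableI => //; exact: measurable_itv.
have kf0 t : (0 <= (k t)%:E * f t)%E by rewrite mule_ge0// lee_fin.
have mkf (A : set TR) : measurable_fun A (fun t : TR => ((k t)%:E * f t)%E).
  by apply: emeasurable_funM; [exact: mkE|exact: measurable_funTS].
apply: (@le_trans _ _ (\int[mu]_(t in D `&` [set` `[s, +oo[%R]) ((k t)%:E * f t))%E); last first.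
  exact: ge0_subset_integral.
apply: (@le_trans _ _ (\int[mu]_(t in D `&` [set` `[s, +oo[%R]) ((k t)%:E * y))%E); last first.
  apply: ge0_le_integral => //.
  - by move=> t _; rewrite mule_ge0// lee_fin.
  - by apply: emeasurable_funM.
  - move=> t [_ /=]; rewrite in_itv/= andbT => st.
    by rewrite lee_wpmul2l ?lee_fin// yf.
rewrite ge0_integralZr//; last by move=> t _; rewrite lee_fin.
by rewrite lee_wpmul2r// kernel_tail_mass.
Qed.

(** The integrand is at most y plus B on [0, s[, where the kernel has mass at most b s. *)
Lemma kernel_average_upper (f : TR -> \bar R) s (y B : R) : 0 <= s -> 0 <= B -> 0 <= y ->
  measurable_fun setT f -> (forall t, (0 <= f t)%E) ->
  (forall t, 0 <= t -> (f t <= B%:E)%E) -> (forall t, s <= t -> (f t <= y%:E)%E) ->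
  (\int[mu]_(t in D) ((k t)%:E * f t) <= (y + B * (b * s))%:E)%E.
Proof.
move=> s0 B0 y0 mf f0 fB fy.
have mI : measurable ([set` `[0, s[%R] : set TR) by exact: measurable_itv.
apply: (@le_trans _ _ (\int[mu]_(t in D) (y%:E * (k t)%:E +
    B%:E * ((k t)%:E * (\1_[set` `[0%R, s[] t)%:E)))%E).
  apply: ge0_le_integral => //.
  - by move=> t _; rewrite mule_ge0// lee_fin.
  - by apply: emeasurable_funM; [exact: mkE|exact: measurable_funTS].
  - apply: emeasurable_funD; apply: emeasurable_funM => //.
    apply: emeasurable_funM => //; apply/measurable_EFinP.
    by apply: measurable_funTS; exact: measurable_indic.
  - move=> t Dt; have [ts|st] := ltP t s.
      rewrite indicE mem_set/=; last by rewrite in_itv/= D0.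
      rewrite mulr1n mule1 [leRHS]addeC muleC.
      apply: (@le_trans _ _ (B%:E * (k t)%:E)%E).
        by rewrite lee_wpmul2r ?lee_fin// fB// D0.
      by rewrite leeDl// mule_ge0// lee_fin.
    rewrite indicE memNset/=; last by rewrite in_itv/= => /andP[_]; rewrite ltNge st.
    by rewrite mulr0n !mule0 adde0 muleC lee_wpmul2r ?lee_fin// fy.
have m1 : measurable_fun D (fun t : TR => ((k t)%:E * (\1_[set` `[0%R, s[] t)%:E)%E).
  apply: emeasurable_funM => //; apply/measurable_EFinP.
  by apply: measurable_funTS; exact: measurable_indic.
have i0 t : (0 <= (k t)%:E * (\1_[set` `[0%R, s[] t)%:E)%E.
  by rewrite mule_ge0// lee_fin// indicE.
rewrite ge0_integralD//; first last.
- exact: emeasurable_funM.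
- by move=> t _; rewrite mule_ge0// lee_fin.
- exact: emeasurable_funM.
- by move=> t _; rewrite mule_ge0// lee_fin.
rewrite ge0_integralZl//; last by move=> t _; rewrite lee_fin.
rewrite ge0_integralZl// k1 mule1 EFinD leeD2l//.
rewrite EFinM lee_wpmul2l ?lee_fin//; apply: le_trans (kernel_initial_mass s0).
rewrite [leRHS]integral_mkcondr le_eqVlt; apply/orP; left; apply/eqP.
by apply: eq_integral => t _; rewrite epatch_indic.
Qed.

End averaging_kernel.

(** * Two-sided bounds for averaged running costs *)

Section normalized_costs.
Context {d} {Omega : measurableType d} {R : realType}.
Variables (P : probability Omega R) (H : R) (W : R -> {RV P >-> R}).
Variables (p : R) (h C : R -> R) (K gamma x : R).
Hypotheses (hH : 2^-1 <= H < 1) (hW : fractional_brownian_motion H W).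
Hypotheses (C_ge0 : forall y, 0 <= y -> 0 <= C y)
  (C_cont : {within `[0, +oo[, continuous C})
  (C_nd : forall y z, 0 <= y -> y <= z -> C y <= C z)
  (hK : 0 < K) (hgamma : 0 < gamma)
  (C_growth : forall y, 0 <= y -> C y <= K * (1 + y `^ gamma))
  (hx : 0 <= x).
Local Notation mu := (@lebesgue_measure R).
Local Notation TR := (measurableTypeR R).
Local Notation Cp := (extended_cost C).
Local Notation LL u t w := (regulator x u (W ^~ w) t).
Local Notation Xx u t w := (reflected x u (W ^~ w) t).
Local Notation pos t := (Num.max 0 t).
Local Notation G u t := (max_cost W C u t).

Let W0 w : W 0 w = 0. Proof. by have [_ _ _ + _] := hW; apply. Qed.
Let cW w : {within `[0, +oo[, continuous (fun t => W t w)}.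
Proof. by have [_ _ _ _] := hW; apply. Qed.
Let pos0 (t : R) : 0 <= pos t. Proof. by rewrite le_max lexx. Qed.
Let posE (t : R) : 0 <= t -> pos t = t. Proof. by move=> t0; rewrite max_r. Qed.
Let mC : measurable_fun setT Cp. Proof. exact: measurable_extended_cost. Qed.
Let Cp0 y : 0 <= Cp y. Proof. exact: extended_cost_ge0. Qed.

(** Paths are extended to negative times by their value at 0, so that measurability can be stated on
    the whole product; the time sets used below are nonnegative, where the extension changes
    nothing. *)
Lemma joint_measurable_regulator u :
  measurable_fun setT (fun z : TR * Omega => LL u (pos z.1) z.2).
Proof.
apply: (joint_measurable (f := fun t w => LL u t w)) => [t t0|w t e t0 e0].
  exact: (measurable_regulator_fbm hW).
have [_ rc] := regulator_nondecreasing_rc u hx (W0 w) (@cW w).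
move/(@cvgrPdist_lt _ R^o) : (rc t) => /(_ _ e0)[δ /= δ0 dP].
exists δ => // s ts std; rewrite distrC; apply: dP => //=.
by rewrite ltr0_norm; lra.
Qed.

Lemma joint_measurable_reflected u :
  measurable_fun setT (fun z : TR * Omega => Xx u (pos z.1) z.2).
Proof.
have mW : measurable_fun setT (fun z : TR * Omega => W (pos z.1) z.2).
  apply: (joint_measurable (f := fun t w => W t w)) => [t t0|w t e t0 e0] //.
  have [δ δ0 dP] := (within_ge0_continuousP _).1 (@cW w) t e t0 e0.
  by exists δ => // s ts std; apply: dP; [lra|rewrite gtr0_norm; lra].
have mp : measurable_fun setT (fun z : TR * Omega => pos z.1 : R).
  by apply: measurable_maxr => //; exact: measurable_fst.
apply: measurable_funD; last exact: joint_measurable_regulator.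
apply: measurable_funD => //; apply: measurable_funB => //.
exact: measurable_funM.
Qed.

Lemma measurable_state_path (D : set TR) u w : measurable D -> (forall t, D t -> 0 <= t) ->
  measurable_fun D (fun t : TR => Cp (Xx u t w)).
Proof.
move=> mD D0.
have mX : measurable_fun setT (fun t : TR => Cp (Xx u (pos t) w)).
  by apply: (measurableT_comp mC); exact: (measurableT_comp (joint_measurable_reflected u) (measurable_pair2 w)).
apply: eq_measurable_fun (measurable_funTS mX) => t; rewrite inE => /D0 t0.
by rewrite posE.
Qed.

Lemma state_tonelli (D : set TR) (k : R -> R) u : measurable D -> (forall t, D t -> 0 <= t) ->
  measurable_fun setT k -> (forall t, 0 <= k t) ->
  [/\ (\int[P]_w \int[mu]_(t in D) (k t * Cp (Xx u t w))%:E =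
       \int[mu]_(t in D) ((k t)%:E * state_cost W C x u (pos t)))%E,
      measurable_fun setT (fun w => \int[mu]_(t in D) (k t * Cp (Xx u t w))%:E)%E &
      measurable_fun setT (fun t : TR => state_cost W C x u (pos t))].
Proof.
move=> mD D0 mk k0.
have mX := joint_measurable_reflected u.
have mCX : measurable_fun setT (fun z : TR * Omega => Cp (Xx u (pos z.1) z.2)).
  exact: (measurableT_comp mC mX).
have [_ _ m3] := @tonelli_time _ _ _ P mu D (fun t w => Cp (Xx u (pos t) w)) mD mCX (fun _ _ => Cp0 _).
have mg : measurable_fun setT (fun z : TR * Omega => k z.1 * Cp (Xx u (pos z.1) z.2)).
  apply: measurable_funM => //.
  by apply: (measurableT_comp (f := k : TR -> R)) => //; exact: measurable_fst.
have [e m1 _] := @tonelli_time _ _ _ P mu D (fun t w => k t * Cp (Xx u (pos t) w)) mD mg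
  (fun _ _ => mulr_ge0 (k0 _) (Cp0 _)).
have eD w : (\int[mu]_(t in D) (k t * Cp (Xx u t w))%:E =
    \int[mu]_(t in D) (k t * Cp (Xx u (pos t) w))%:E)%E.
  by apply: eq_integral => t; rewrite inE => /D0 t0; rewrite posE.
split.
- under eq_integral do rewrite eD.
  rewrite e; apply: eq_integral => t; rewrite inE => /D0 t0.
  under eq_integral do rewrite EFinM.
  rewrite ge0_integralZl//.
  - by apply/measurable_EFinP; exact: (measurableT_comp mCX (measurable_pair1 t)).
  - by move=> w _; rewrite lee_fin.
  - by rewrite lee_fin.
- by rewrite (funext eD).
- exact: m3.
Qed.

(** The drifts at which the long-run cost is known to be finite. Drift 0 is included for bounded C
    because it can be a limit point of positive drifts. *)
Definition admissible_drift (u : R) := 0 < u \/ u = 0 /\ exists M, forall y, 0 <= y -> C y <= M.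

Definition limit_cost (u : R) : \bar R := ereal_sup [set G u t | t in [set t : R | 0 <= t]].

Lemma limit_cost_ge u t : 0 <= t -> (G u t <= limit_cost u)%E.
Proof. by move=> t0; apply: ereal_sup_ubound; exists t. Qed.

Lemma limit_cost_ge0 u : (0 <= limit_cost u)%E.
Proof. by apply: le_trans (limit_cost_ge u (lexx 0)); exact: max_cost_ge0. Qed.

Lemma limit_cost_fin u : admissible_drift u -> limit_cost u \is a fin_num.
Proof.
move=> gu; have [B BE] : exists B : R, forall t, 0 <= t -> (G u t <= B%:E)%E.
  case: gu => [u0|[-> [M CM]]].
    have [B _ BE] := max_cost_bounded hH hW C_ge0 C_cont hK hgamma C_growth u0.
    by exists B.
  exists M => t t0; rewrite /max_cost.
  rewrite -[leRHS]mule1 -[X in (_ * X)%E](@probability_setT _ _ _ P) -integral_cst//.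
  apply: ge0_le_integral => //.
  - by move=> w _; rewrite lee_fin.
  - by apply/measurable_EFinP; apply: (measurableT_comp mC); exact: (measurable_running_max hW).
  - by move=> w _; rewrite lee_fin; exact: CM.
rewrite ge0_fin_numE ?limit_cost_ge0// (@le_lt_trans _ _ B%:E) ?ltry//.
by apply: ge_ereal_sup => _ [t /= t0 <-]; exact: BE.
Qed.

(** For u > 0 the excess B / (1 + u t / 2) drops below e once t >= B / e / (u / 2); for u = 0 the
    bound on C replaces it. *)
Lemma state_cost_upper u e : admissible_drift u -> 0 < e ->
  exists B t0 : R, [/\ 0 <= B, 0 <= t0, forall t, 0 <= t -> (state_cost W C x u t <= B%:E)%E &
    forall t, t0 <= t -> (state_cost W C x u t <= limit_cost u + e%:E)%E].
Proof.
move=> gu e0; have fin := limit_cost_fin gu; case: gu => [u0|[u0 [M CM]]].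
  have [B B0 BE] := state_cost_upper_pos hH hW C_ge0 C_cont C_nd hK hgamma C_growth hx u0.
  have v0 : 0 < u / 2 by rewrite divr_gt0.
  have d1 t : 0 <= t -> 0 < 1 + u / 2 * t by move=> t0; rewrite ltr_pwDl// mulr_ge0// ltW.
  exists (fine (limit_cost u) + B), (B / e / (u / 2)); split.
  - by rewrite addr_ge0// fine_ge0// limit_cost_ge0.
  - by rewrite !divr_ge0// ltW.
  - move=> t t0; apply: le_trans (BE t t0) _.
    rewrite EFinD fineK// leeD ?limit_cost_ge// lee_fin ler_pdivrMr ?d1//.
    by rewrite ler_peMr// lerDl mulr_ge0// ltW.
  - move=> t tt; have t0 : 0 <= t by apply: le_trans tt; rewrite !divr_ge0// ltW.
    apply: le_trans (BE t t0) _; rewrite leeD ?limit_cost_ge// lee_fin ler_pdivrMr ?d1//.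
    have : B <= t * (u / 2) * e by move: tt; rewrite !ler_pdivrMr.
    have -> : e * (1 + u / 2 * t) = e + t * (u / 2) * e by ring.
    move: (_ * e) => c; lra.
have [t1 t10 tE] := state_cost_upper_0 hH hW C_ge0 C_cont C_nd hx CM e0.
exists (Num.max 0 M), t1; split=> //.
  move=> t t0; rewrite /state_cost.
  rewrite -[leRHS]mule1 -[X in (_ * X)%E](@probability_setT _ _ _ P) -integral_cst//.
  apply: ge0_le_integral => //.
  - by move=> w _; rewrite lee_fin.
  - by apply/measurable_EFinP; apply: (measurableT_comp mC); exact: (measurable_reflected_fbm hW).
  - by move=> w _; rewrite lee_fin le_max CM// orbT.
move=> t tt; rewrite u0; apply: le_trans (tE t tt) _.
by rewrite leeD// limit_cost_ge// (le_trans t10).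
Qed.

(** The term b x is the price of the starting point, and 1 - b s the kernel mass left after the
    cut-off s. The bound is explicit in u because it is applied along a sequence of drifts. *)
Definition normalized_lower (N : \bar R) (b u : R) := forall s, 0 <= s -> b * s <= 1 ->
  ((h u + p * (u - b * x))%:E + (1 - b * s)%:E * G u s <= N)%E.

(** One B serves all b, while it may depend on u and e: the estimate is only used at a fixed drift
    as b tends to 0. *)
Definition normalized_upper (N : R -> \bar R) (u : R) := forall e, 0 < e ->
  exists2 B : R, 0 <= B & forall b, 0 < b ->
    (N b <= (h u + p * u + e + B * b)%:E + limit_cost u)%E.

Definition kernel_cost (D : set TR) (k : R -> R) u : \bar R :=
  (\int[P]_w \int[mu]_(t in D) (k t * Cp (Xx u t w))%:E)%E.

Section kernel.
Variables (D : set TR) (k : R -> R) (b : R).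
Hypotheses (mD : measurable D) (D0 : forall t, D t -> 0 <= t)
  (mk : measurable_fun setT k) (k0 : forall t, 0 <= k t) (kb : forall t, D t -> k t <= b)
  (k1 : (\int[mu]_(t in D) (k t)%:E = 1)%E) (b0 : 0 < b).

Lemma kernel_cost_lower u s : 0 <= s -> b * s <= 1 ->
  ((1 - b * s)%:E * G u s <= kernel_cost D k u)%E.
Proof.
move=> s0 bs; have [AE _ mf] := state_tonelli u mD D0 mk k0; rewrite /kernel_cost AE.
apply: (kernel_average_lower mD D0 mk k0 kb k1 (ltW b0) (f := fun t => state_cost W C x u (pos t))) => //.
- by move=> t; exact: state_cost_ge0.
- exact: max_cost_ge0.
- move=> t st; have t0 := le_trans s0 st; rewrite posE//.
  apply: le_trans (state_cost_lower hH hW C_ge0 C_cont C_nd hx u t0).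
  exact: (max_cost_nd hW).
Qed.

Lemma kernel_cost_upper u e B t0 : 0 < e -> 0 <= B -> 0 <= t0 -> limit_cost u \is a fin_num ->
  (forall t, 0 <= t -> (state_cost W C x u t <= B%:E)%E) ->
  (forall t, t0 <= t -> (state_cost W C x u t <= limit_cost u + e%:E)%E) ->
  (kernel_cost D k u <= limit_cost u + (e + B * (b * t0))%:E)%E.
Proof.
move=> e0 B0 t00 fin fB fe; have [AE _ mf] := state_tonelli u mD D0 mk k0; rewrite /kernel_cost AE.
rewrite -(fineK fin) -EFinD addrA.
apply: (kernel_average_upper mD D0 mk k0 kb k1 (ltW b0) (f := fun t => state_cost W C x u (pos t))) => //.
- by rewrite addr_ge0 ?(ltW e0)// fine_ge0// limit_cost_ge0.
- by move=> t; exact: state_cost_ge0.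
- by move=> t t0'; rewrite posE// fB.
- move=> t tt; have t0' := le_trans t00 tt; rewrite posE// EFinD fineK//.
  exact: fe.
Qed.

End kernel.
End normalized_costs.

Section regulator_measure.
Context {R : realType}.
Local Notation TR := (measurableTypeR R).

Lemma lebesgue_stieltjes_itv_oc (F : cumulative R R) (a b : R) : a <= b ->
  lebesgue_stieltjes_measure F [set` `]a, b]%R] = (F b - F a)%:E.
Proof.
move=> ab; rewrite /lebesgue_stieltjes_measure /measure_extension measurable_mu_extE/=; last exact: is_ocitv.
by rewrite wlength_itv_bnd.
Qed.

(* There is no mass at the origin, as the regulator vanishes on ]-oo, 0]. *)
Lemma regulator_stieltjes (x u : R) (w : R -> R) (F : cumulative R R) s :
  0 <= x -> w 0 = 0 -> {within `[0, +oo[, continuous w} -> regulator x u w = F -> 0 <= s ->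
  lebesgue_stieltjes_measure F [set` `[0, s]%R] = (regulator x u w s)%:E.
Proof.
move=> x0 w0 cw FE s0.
have L0 : regulator x u w 0 = 0.
  apply/eqP; rewrite eq_le regulator_ge0 andbT; apply/(regulator_leP cw) => // r.
  by rewrite -eq_le => /eqP<-; rewrite mulr0 w0; lra.
have LN : regulator x u w (-1) = 0.
  apply/eqP; rewrite eq_le regulator_ge0 andbT -L0.
  by have [nd _] := regulator_nondecreasing_rc u x0 w0 cw; apply: nd; lra.
have m (a b : bool) (y z : R) : (measurable ([set` Interval (BSide a y) (BSide b z)] : set TR)).
  exact: measurable_itv.
apply/eqP; rewrite eq_le; apply/andP; split.
  apply: (@le_trans _ _ (lebesgue_stieltjes_measure F [set` `](-1)%R, s]%R])).
    apply: le_measure; rewrite ?inE; [exact: m|exact: m|].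
    by apply: subset_itvr; rewrite bnd_simp; lra.
  rewrite lebesgue_stieltjes_itv_oc; last lra.
  by rewrite -FE LN subr0.
apply: (@le_trans _ _ (lebesgue_stieltjes_measure F [set` `]0, s]%R])).
  by rewrite lebesgue_stieltjes_itv_oc// -FE L0 subr0.
apply: le_measure; rewrite ?inE; [exact: m|exact: m|].
by apply: subset_itvr; rewrite bnd_simp.
Qed.

End regulator_measure.

(** * Normalised costs as drift cost, regulator rate and kernel average *)

Section cost_decompositions.
Context {d} {Omega : measurableType d} {R : realType}.
Variables (P : probability Omega R) (H : R) (W : R -> {RV P >-> R}).
Variables (p : R) (h C : R -> R) (K gamma x : R).
Hypotheses (hH : 2^-1 <= H < 1) (hW : fractional_brownian_motion H W).
Hypothesis hp : 0 <= p.
Hypotheses (C_ge0 : forall y, 0 <= y -> 0 <= C y)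
  (C_cont : {within `[0, +oo[, continuous C})
  (C_nd : forall y z, 0 <= y -> y <= z -> C y <= C z)
  (hK : 0 < K) (hgamma : 0 < gamma)
  (C_growth : forall y, 0 <= y -> C y <= K * (1 + y `^ gamma))
  (hx : 0 <= x).
Local Notation mu := (@lebesgue_measure R).
Local Notation TR := (measurableTypeR R).
Local Notation Cp := (extended_cost C).
Local Notation LL u t w := (regulator x u (W ^~ w) t).
Local Notation Xx u t w := (reflected x u (W ^~ w) t).
Local Notation pos t := (Num.max 0 t).
Local Notation kernel_cost := (kernel_cost W C x).
Local Notation normalized_lower := (normalized_lower W p h C x).
Local Notation normalized_upper := (normalized_upper W p h C).
Local Notation EL u t := (\int[P]_w (LL u t w)%:E)%E.

Let W0 w : W 0 w = 0. Proof. by have [_ _ _ + _] := hW; apply. Qed.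
Let cW w : {within `[0, +oo[, continuous (fun t => W t w)}.
Proof. by have [_ _ _ _] := hW; apply. Qed.
Let pos0 (t : R) : 0 <= pos t. Proof. by rewrite le_max lexx. Qed.
Let posE (t : R) : 0 <= t -> pos t = t. Proof. by move=> t0; rewrite max_r. Qed.
Let Cp0 y : 0 <= Cp y. Proof. exact: extended_cost_ge0. Qed.
Let XC u t w : 0 <= t -> C (Xx u t w) = Cp (Xx u t w).
Proof. by move=> t0; rewrite extended_costE// (reflected_ge0 (@cW w)). Qed.
Let mL u t : 0 <= t -> measurable_fun setT (fun w => (LL u t w)%:E).
Proof. by move=> t0; apply/measurable_EFinP; exact: (measurable_regulator_fbm hW). Qed.
Let L0 u t w : (0 <= (LL u t w)%:E)%E. Proof. by rewrite lee_fin regulator_ge0. Qed.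

Lemma kernel_cost_ge0 D (k : R -> R) u : (forall t, 0 <= k t) -> (0 <= kernel_cost D k u)%E.
Proof.
by move=> k0; apply: integral_ge0 => w _; apply: integral_ge0 => t _; rewrite lee_fin mulr_ge0.
Qed.

Definition averaging_kernel (D : set TR) (k : R -> R) b :=
  [/\ measurable D, (forall t, D t -> 0 <= t), measurable_fun setT k &
   [/\ (forall t, 0 <= k t), (forall t, D t -> k t <= b) &
    (\int[mu]_(t in D) (k t)%:E = 1)%E]].

Lemma decomposition_lower D (k : R -> R) b u (l : \bar R) : averaging_kernel D k b -> 0 < b ->
  ((u - b * x)%:E <= l)%E ->
  normalized_lower ((h u)%:E + p%:E * l + kernel_cost D k u)%E b u.
Proof.
move=> [mD D0 mk [k0 kb k1]] b0 lb s s0 bs; apply: leeD; last first.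
  exact: (kernel_cost_lower hH hW C_ge0 C_cont C_nd hx mD D0 mk k0 kb k1 b0).
by rewrite EFinD leeD2l// EFinM lee_wpmul2l.
Qed.

Lemma decomposition_upper (D : R -> set TR) (k : R -> R -> R) u (l : R -> \bar R) :
  admissible_drift C u -> (forall b, 0 < b -> averaging_kernel (D b) (k b) b) ->
  (forall v, u <= v -> 0 < v -> exists2 B : R, 0 <= B & forall b, 0 < b -> (l b <= (v + B * b)%:E)%E) ->
  normalized_upper (fun b => (h u)%:E + p%:E * l b + kernel_cost (D b) (k b) u)%E u.
Proof.
move=> gu kP lP e e0; have e20 : 0 < e / 2 by rewrite divr_gt0.
have u0 : 0 <= u by case: gu => [/ltW//|[-> _]].
have fin := limit_cost_fin hH hW C_ge0 C_cont hK hgamma C_growth gu.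
have [B [t0 [B0 t00 BE tE]]] := state_cost_upper hH hW C_ge0 C_cont C_nd hK hgamma C_growth hx gu e20.
(* A drift positive even for u = 0, whose extra regulator cost p (v - u) is at most e / 2; the other
   half of e is left to the running cost. *)
pose v := u + e / 2 / (p + 1).
have p1 : 0 < p + 1 by rewrite ltr_wpDl.
have vu : 0 < e / 2 / (p + 1) by rewrite !divr_gt0.
have v0 : 0 < v by rewrite ltr_wpDl.
have uv : u <= v by rewrite lerDl ltW.
have [B' B'0 lB] := lP v uv v0.
exists (p * B' + B * t0) => [|b b0]; first by rewrite addr_ge0// mulr_ge0.
have [mD D0 mk [k0 kb k1]] := kP b b0.
have ub : (kernel_cost (D b) (k b) u <= limit_cost W C u + (e / 2 + B * (b * t0))%:E)%E.
  exact: (kernel_cost_upper hW C_ge0 C_cont hx mD D0 mk k0 kb k1 b0).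
apply: (@le_trans _ _ ((h u)%:E + p%:E * (v + B' * b)%:E + (limit_cost W C u + (e / 2 + B * (b * t0))%:E))%E).
  by apply: leeD => //; rewrite leeD2l// lee_wpmul2l// lB.
rewrite -EFinM -EFinD [(limit_cost W C u + _)%E]addeC addeA leeD2r//.
rewrite -EFinD lee_fin.
have : p * (e / 2 / (p + 1)) <= e / 2.
  by rewrite mulrA ler_pdivrMr// mulrC ler_wpM2l//; lra.
rewrite /v mulrDr [p * (u + _)]mulrDr; move: (p * (e / 2 / (p + 1))) => c ce.
have -> : (p * B' + B * t0) * b = p * (B' * b) + B * (b * t0) by ring.
by lra.
Qed.

Lemma horizon_kernel (b : R) : 0 < b -> averaging_kernel [set` `[0, b^-1]%R] (cst b) b.
Proof.
move=> b0; split=> //; first by move=> t /=; rewrite in_itv/= => /andP[].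
split=> //; first by move=> t; exact: ltW.
transitivity (b%:E * mu [set` `[0, b^-1]%R])%E; first exact: (integral_cst mu (measurable_itv _) b%:E).
rewrite lebesgue_measure_itv/= lte_fin invr_gt0 b0 -EFinB subr0 -EFinM.
by rewrite divff// gt_eqF.
Qed.

Lemma exponential_kernel (b : R) : 0 < b -> averaging_kernel [set` `[0, +oo[%R] (exp_kernel b) b.
Proof.
move=> b0; split => //.
- by move=> t /=; rewrite in_itv/= andbT.
- exact: measurable_exp_kernel.
split; [exact: exp_kernel_ge0| |exact: integral_exp_kernel].
move=> t /=; rewrite in_itv/= andbT => t0; rewrite /exp_kernel -[leRHS]mulr1.
by rewrite ler_pM2l// -expR0 ler_expR oppr_le0 mulr_ge0// ltW.
Qed.

Lemma time_integral_scale (D : set TR) (c : R) u w : measurable D -> (forall t, D t -> 0 <= t) -> 0 <= c ->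
  (\int[mu]_(t in D) (c * Cp (Xx u t w))%:E = c%:E * \int[mu]_(t in D) (C (Xx u t w))%:E)%E.
Proof.
move=> mD D0 c0; rewrite -ge0_integralZl//.
- by apply: eq_integral => t; rewrite inE => /D0 t0; rewrite XC.
- apply/measurable_EFinP; apply: eq_measurable_fun (measurable_state_path hW C_cont hx u w mD D0).
  by move=> t; rewrite inE => /D0 t0; rewrite XC.
- by move=> t /D0 t0; rewrite lee_fin XC.
Qed.

Lemma measurable_time_integral (D : set TR) u : measurable D -> (forall t, D t -> 0 <= t) ->
  measurable_fun setT (fun w => \int[mu]_(t in D) (C (Xx u t w))%:E)%E.
Proof.
move=> mD D0; have [_ + _] := state_tonelli hW C_ge0 C_cont hx u mD D0 (measurable_cst (1 : R)) (fun=> ler01).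
apply: eq_measurable_fun => w _; rewrite (@time_integral_scale D 1)// mul1e//.
Qed.

Lemma constant_kernel_cost (D : set TR) (b : R) u : measurable D -> (forall t, D t -> 0 <= t) -> 0 < b ->
  kernel_cost D (cst b) u = (b%:E * \int[P]_w \int[mu]_(t in D) (C (Xx u t w))%:E)%E.
Proof.
move=> mD D0 b0; rewrite -ge0_integralZl ?lee_fin ?(ltW b0)//.
- by apply: eq_integral => w _; exact: (time_integral_scale _ _ mD D0 (ltW b0)).
- exact: measurable_time_integral.
- by move=> w _; apply: integral_ge0 => s /D0 s0; rewrite lee_fin XC.
Qed.

Lemma time_average_decomposition (D : set TR) (b : R) u t : measurable D -> (forall t, D t -> 0 <= t) ->
  0 <= t -> 0 < b ->
  (b%:E * \int[P]_w ((\int[mu]_(t in D) (C (Xx u t w))%:E) + (p * LL u t w)%:E) =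
   p%:E * (b%:E * EL u t) + kernel_cost D (cst b) u)%E.
Proof.
move=> mD D0 t0 b0; have mI := measurable_time_integral u mD D0.
have I0 w : (0 <= \int[mu]_(t in D) (C (Xx u t w))%:E)%E.
  by apply: integral_ge0 => s /D0 s0; rewrite lee_fin XC.
rewrite constant_kernel_cost// muleCA -ge0_muleDr; first last.
- by apply: integral_ge0.
- by rewrite mule_ge0 ?lee_fin// integral_ge0.
congr (_ * _)%E; rewrite -ge0_integralZl ?lee_fin//; last exact: mL.
rewrite -ge0_integralD//.
- by apply: eq_integral => w _; rewrite addeC.
- by move=> w _; rewrite mule_ge0.
- by apply: emeasurable_funM => //; exact: mL.
Qed.

Lemma horizon_decomposition (b : R) u : 0 < b -> 0 <= h u ->
  (b%:E * horizon_cost W p h C u x b^-1 =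
   (h u)%:E + p%:E * (b%:E * EL u b^-1) + kernel_cost [set` `[0, b^-1]%R] (cst b) u)%E.
Proof.
move=> b0 hu; have [mD D0 _ _] := horizon_kernel b0.
have bV : 0 <= b^-1 by rewrite invr_ge0 ltW.
have I0 : (0 <= \int[P]_w \int[mu]_(t in `[0%R, b^-1%R]) (C (Xx u t w))%:E)%E.
  by apply: integral_ge0 => w _; apply: integral_ge0 => s /D0 s0; rewrite lee_fin XC.
have E0 : (0 <= p%:E * EL u b^-1)%E by rewrite mule_ge0 ?lee_fin// integral_ge0.
have h0 : (0 <= (h u * b^-1)%:E)%E by rewrite lee_fin mulr_ge0.
rewrite /horizon_cost expectation.unlock constant_kernel_cost//.
rewrite (ge0_muleDr _ (adde_ge0 h0 E0) I0) (ge0_muleDr _ h0 E0) -EFinM mulrCA divff ?gt_eqF// mulr1.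
by rewrite muleCA.
Qed.

Lemma horizon_regulator_lower (b : R) u : 0 < b -> ((u - b * x)%:E <= b%:E * EL u b^-1)%E.
Proof.
move=> b0; have bV : 0 <= b^-1 by rewrite invr_ge0 ltW.
apply: (@le_trans _ _ (b%:E * (u * b^-1 - x)%:E)%E); last first.
  by rewrite lee_wpmul2l ?lee_fin ?(ltW b0)// (regulator_mean_lower x hW).
by rewrite -EFinM mulrBr mulrCA divff ?gt_eqF// mulr1.
Qed.

Lemma horizon_regulator_upper u v : u <= v -> 0 < v -> exists2 B : R, 0 <= B &
  forall b, 0 < b -> (b%:E * EL u b^-1 <= (v + B * b)%:E)%E.
Proof.
move=> uv v0; have [B B0 BE] := regulator_mean_upper hH hW hx uv v0.
exists B => // b b0; have bV : 0 <= b^-1 by rewrite invr_ge0 ltW.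
apply: (@le_trans _ _ (b%:E * (v * b^-1 + B)%:E)%E).
  by rewrite lee_wpmul2l ?lee_fin ?(ltW b0)// BE.
by rewrite -EFinM mulrDr mulrCA divff ?gt_eqF// mulr1 [b * B]mulrC.
Qed.

(** The regulator measure gives [0, s] the mass L s, so exchanging integrals turns the discounted
    regulator cost into an average of L against the exponential kernel. *)
Lemma exponential_regulator_path (b : R) u w : 0 < b ->
  (\int[stieltjes (regulator x u (W ^~ w))]_(t in `[0%R, +oo[) (expR (- (b * t)))%:E =
   \int[mu]_(s in `[0%R, +oo[) (exp_kernel b s * LL u s w)%:E)%E.
Proof.
move=> b0; have [F FE ->] := regulator_cumulative u hx (W0 w) (@cW w).
by apply: integral_exp_stieltjes => // s s0; exact: regulator_stieltjes.
Qed.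

Lemma measurable_mean_regulator u (D : set TR) : measurable D -> (forall t, D t -> 0 <= t) ->
  measurable_fun D (fun t : TR => EL u t).
Proof.
move=> mD D0; have mg := joint_measurable_regulator hW hx u.
have [_ _ m] := @tonelli_time _ _ _ P mu _ (fun t w => LL u (pos t) w) mD mg (fun _ _ => regulator_ge0 _ _ _ _).
by apply: eq_measurable_fun (measurable_funTS m) => t; rewrite inE => /D0 t0; rewrite posE.
Qed.

Definition exponential_regulator (b : R) u : \bar R :=
  (\int[mu]_(s in `[0%R, +oo[) ((exp_kernel b s)%:E * EL u s))%E.

(** Writing e^(-b t) as 1 / b times the kernel makes the constant h u average to itself. The
    regulator average still carries the factor b, which makes it a rate: the mean of L grows like u
    t and the kernel has mean time 1 / b. *)
Lemma discounted_decomposition (b : R) u : 0 < b -> 0 <= h u ->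
  (b%:E * discounted_cost W p h C b u x =
   (h u)%:E + p%:E * (b%:E * exponential_regulator b u) + kernel_cost [set` `[0, +oo[%R] (exp_kernel b) u)%E.
Proof.
move=> b0 hu; have [mD D0 mk [k0 kb k1]] := exponential_kernel b0.
have mkE (D : set TR) : measurable_fun D (fun t : TR => (exp_kernel b t)%:E).
  by apply/measurable_EFinP/measurable_funTS.
have [_ m1 _] := state_tonelli hW C_ge0 C_cont hx u mD D0 mk k0.
pose F1 w := (\int[mu]_(t in `[0%R, +oo[) (exp_kernel b t * Cp (Xx u t w))%:E)%E.
pose F2 w := (\int[mu]_(t in `[0%R, +oo[) (exp_kernel b t * LL u t w)%:E)%E.
have F10 w : (0 <= F1 w)%E by apply: integral_ge0 => t _; rewrite lee_fin mulr_ge0.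
have F20 w : (0 <= F2 w)%E by apply: integral_ge0 => t _; rewrite lee_fin mulr_ge0// regulator_ge0.
have mg : measurable_fun setT (fun z : TR * Omega => exp_kernel b z.1 * LL u (pos z.1) z.2).
  apply: measurable_funM; last exact: (joint_measurable_regulator hW hx).
  by apply: (measurableT_comp (f := exp_kernel b : TR -> R)) => //; exact: measurable_fst.
have [e2 m2 _] := @tonelli_time _ _ _ P mu _ (fun t w => exp_kernel b t * LL u (pos t) w) mD mg
  (fun _ _ => mulr_ge0 (k0 _) (regulator_ge0 _ _ _ _)).
have F2E w : F2 w = (\int[mu]_(t in `[0%R, +oo[) (exp_kernel b t * LL u (pos t) w)%:E)%E.
  by apply: eq_integral => t; rewrite inE => /D0 t0; rewrite posE.
have {}m2 : measurable_fun setT F2.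
  by apply: eq_measurable_fun m2 => w _; rewrite -F2E.
have IF2 : (\int[P]_w F2 w = exponential_regulator b u)%E.
  under eq_integral do rewrite F2E.
  rewrite e2; apply: eq_integral => t; rewrite inE => /D0 t0.
  rewrite posE// -ge0_integralZl ?lee_fin//; last exact: mL.
have F1E w : (\int[mu]_(t in `[0%R, +oo[) (expR (- (b * t)) * (h u + C (Xx u t w)))%:E =
    (b^-1)%:E * ((h u)%:E + F1 w))%E.
  have mX : measurable_fun ([set` `[0, +oo[%R] : set TR) (fun t : TR => (exp_kernel b t * Cp (Xx u t w))%:E).
    apply/measurable_EFinP; apply: measurable_funM; first exact: measurable_funTS.
    exact: (measurable_state_path hW C_cont hx u w mD D0).
  rewrite -[(h u)%:E]mule1 -k1 -ge0_integralZl ?lee_fin//; last by move=> t _; rewrite lee_fin.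
  rewrite -ge0_integralD//; first last.
  - by move=> t _; rewrite lee_fin mulr_ge0.
  - exact: emeasurable_funM.
  - by move=> t _; rewrite mule_ge0// lee_fin.
  rewrite -ge0_integralZl ?lee_fin ?invr_ge0 ?(ltW b0)//; first last.
  - by move=> t _; rewrite -EFinM -EFinD lee_fin addr_ge0 ?(mulr_ge0 hu) ?(mulr_ge0 (k0 _)).
  - by apply: emeasurable_funD => //; exact: emeasurable_funM.
  apply: eq_integral => t; rewrite inE => /D0 t0; rewrite XC//.
  rewrite -[RHS]/((b^-1 * (h u * exp_kernel b t + exp_kernel b t * Cp (Xx u t w)))%:E).
  by congr EFin; rewrite /exp_kernel; field; rewrite gt_eqF.
have -> : discounted_cost W p h C b u x =
    (\int[P]_w ((b^-1)%:E * ((h u)%:E + F1 w) + p%:E * F2 w))%E.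
  by apply: eq_integral => w _; rewrite F1E exponential_regulator_path.
have hF0 w : (0 <= (h u)%:E + F1 w)%E by rewrite adde_ge0.
have mhF : measurable_fun setT (fun w => (h u)%:E + F1 w)%E by exact: emeasurable_funD.
have bV : (0 <= (b^-1)%:E)%E by rewrite lee_fin invr_ge0 ltW.
rewrite ge0_integralD//; first last.
- exact: emeasurable_funM.
- by move=> w _; rewrite mule_ge0.
- exact: emeasurable_funM.
- by move=> w _; rewrite mule_ge0.
rewrite !ge0_integralZl// IF2 ge0_integralD//.
rewrite integral_cst// [X in ((h u)%:E * X)%E]probability_setT mule1.
have I1 : (0 <= kernel_cost [set` `[0, +oo[%R] (exp_kernel b) u)%E by exact: kernel_cost_ge0.
rewrite -[(\int[P]_w F1 w)%E]/(kernel_cost [set` `[0, +oo[%R] (exp_kernel b) u).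
have I2 : (0 <= exponential_regulator b u)%E by rewrite -IF2 integral_ge0.
have hE : (0 <= (h u)%:E)%E by rewrite lee_fin.
rewrite ge0_muleDr; [|exact: mule_ge0 bV (adde_ge0 hE I1)|exact: mule_ge0].
rewrite muleA -EFinM divff ?gt_eqF// mul1e muleCA.
by rewrite -addeA [X in (_ + X)%E]addeC addeA.
Qed.

Lemma exponential_regulator_lower (b : R) u : 0 < b -> 0 <= u ->
  ((u - b * x)%:E <= b%:E * exponential_regulator b u)%E.
Proof.
move=> b0 u0; have [mD D0 mk [k0 kb k1]] := exponential_kernel b0.
have mkE (D : set TR) : measurable_fun D (fun t : TR => (exp_kernel b t)%:E).
  by apply/measurable_EFinP/measurable_funTS.
have mEL := measurable_mean_regulator u mD D0.
have EL0 t : (0 <= EL u t)%E by exact: integral_ge0.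
have xE : (0 <= x%:E)%E by rewrite lee_fin.
have kE0 t : (0 <= (exp_kernel b t)%:E)%E by rewrite lee_fin.
have mid : measurable_fun ([set` `[0, +oo[%R] : set TR) (fun t : TR => (exp_kernel b t * t)%:E).
  apply/measurable_EFinP; apply: measurable_funM; first exact: measurable_funTS.
  exact: measurable_funTS.
(* The constant x is moved to the right so that only nonnegative functions are integrated. *)
have : ((u * b^-1)%:E <= exponential_regulator b u + x%:E)%E.
  rewrite EFinM -(integral_exp_kernel_id b0) -ge0_integralZl//; first last.
  - by move=> t /D0 t0; rewrite lee_fin mulr_ge0.
  rewrite -[X in (_ <= _ + X)%E]mule1 -k1 -ge0_integralZl ?lee_fin//.
  rewrite /exponential_regulator -ge0_integralD//; first last.
  - exact: emeasurable_funM.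
  - by move=> t _; rewrite mule_ge0 ?lee_fin.
  - by apply: emeasurable_funM.
  - by move=> t _; rewrite mule_ge0.
  apply: ge0_le_integral => //.
  - by move=> t /D0 t0; rewrite -EFinM lee_fin mulr_ge0// mulr_ge0.
  - exact: emeasurable_funM.
  - by apply: emeasurable_funD; apply: emeasurable_funM.
  - move=> t /D0 t0; rewrite [leRHS](_ : _ = (exp_kernel b t)%:E * (EL u t + x%:E))%E; last first.
      by rewrite (muleC x%:E) (ge0_muleDr _ (EL0 t) xE).
    rewrite (_ : _ * _ = (exp_kernel b t)%:E * (u * t)%:E)%E; last first.
      by rewrite -!EFinM mulrCA.
    rewrite lee_wpmul2l// -leeBlDr// -EFinB; exact: (regulator_mean_lower x hW).
rewrite -leeBlDr// -EFinB => /(lee_wpmul2l (x := b%:E)); rewrite lee_fin => /(_ (ltW b0)).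
by rewrite -EFinM mulrBr mulrCA divff ?gt_eqF// mulr1.
Qed.

Lemma exponential_regulator_upper u v : u <= v -> 0 < v -> exists2 B : R, 0 <= B &
  forall b, 0 < b -> (b%:E * exponential_regulator b u <= (v + B * b)%:E)%E.
Proof.
move=> uv v0; have [B B0 BE] := regulator_mean_upper hH hW hx uv v0.
exists B => // b b0; have [mD D0 mk [k0 kb k1]] := exponential_kernel b0.
have mkE (D : set TR) : measurable_fun D (fun t : TR => (exp_kernel b t)%:E).
  by apply/measurable_EFinP/measurable_funTS.
have kE0 t : (0 <= (exp_kernel b t)%:E)%E by rewrite lee_fin.
have mid : measurable_fun ([set` `[0, +oo[%R] : set TR) (fun t : TR => (exp_kernel b t * t)%:E).
  apply/measurable_EFinP; apply: measurable_funM; first exact: measurable_funTS.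
  exact: measurable_funTS.
have mEL := measurable_mean_regulator u mD D0.
have vE0 : (0 <= v%:E)%E by rewrite lee_fin ltW.
have : (exponential_regulator b u <= (v * b^-1)%:E + B%:E)%E.
  rewrite EFinM -(integral_exp_kernel_id b0) -ge0_integralZl//; first last.
  - by move=> t /D0 t0; rewrite lee_fin mulr_ge0.
  rewrite -[X in (_ <= _ + X)%E]mule1 -k1 -ge0_integralZl ?lee_fin//.
  rewrite -ge0_integralD//; first last.
  - exact: emeasurable_funM.
  - by move=> t _; rewrite mule_ge0 ?lee_fin.
  - by apply: emeasurable_funM.
  - by move=> t /D0 t0; rewrite mule_ge0// lee_fin mulr_ge0.
  apply: ge0_le_integral => //.
  - by move=> t _; rewrite mule_ge0// integral_ge0.
  - exact: emeasurable_funM.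
  - by apply: emeasurable_funD; apply: emeasurable_funM.
  - move=> t /D0 t0; rewrite -!EFinM -EFinD.
    rewrite (_ : v * _ + _ = exp_kernel b t * (v * t + B)); last by ring.
    by rewrite [leRHS]EFinM lee_wpmul2l// BE.
move=> /(lee_wpmul2l (x := b%:E)); rewrite lee_fin => /(_ (ltW b0)) H1; apply: le_trans H1 _.
by rewrite -EFinD -EFinM mulrDr mulrCA divff ?gt_eqF// mulr1 [b * B]mulrC.
Qed.

End cost_decompositions.

(** * Optimal drifts *)

Section limit_superior.
Context {R : realType} (f : R -> \bar R) (F : set_system R).

Lemma limf_esup_le_near (y : \bar R) : (\forall t \near F, (f t <= y)%E) -> (limf_esup f F <= y)%E.
Proof.
move=> fy; apply: (@le_trans _ _ (ereal_sup (f @` [set t | (f t <= y)%E]))).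
  by apply: ereal_inf_lbound; exists [set t | (f t <= y)%E].
by apply: ge_ereal_sup => _ [t /= ft <-].
Qed.

Lemma limf_esup_ge_near (y : \bar R) : ProperFilter F ->
  (\forall t \near F, (y <= f t)%E) -> (y <= limf_esup f F)%E.
Proof.
move=> PF fy; apply: le_ereal_inf_tmp => _ [V FV <-].
have [t [Vt yt]] := filter_ex (filterI FV fy).
by apply: le_trans yt _; apply: ereal_sup_ubound; exists t.
Qed.

End limit_superior.

Section optimal_controls.
Context {d} {Omega : measurableType d} {R : realType}.
Variables (P : probability Omega R) (H : R) (W : R -> {RV P >-> R}).
Variables (p : R) (h C : R -> R) (K gamma x : R).
Hypotheses (hH : 2^-1 <= H < 1) (hW : fractional_brownian_motion H W).
Hypotheses (hp : 0 <= p) (h_ge0 : forall u, 0 <= u -> 0 <= h u).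
Hypotheses (C_ge0 : forall y, 0 <= y -> 0 <= C y)
  (C_cont : {within `[0, +oo[, continuous C})
  (C_nd : forall y z, 0 <= y -> y <= z -> C y <= C z)
  (hK : 0 < K) (hgamma : 0 < gamma)
  (C_growth : forall y, 0 <= y -> C y <= K * (1 + y `^ gamma))
  (hx : 0 <= x).
Local Notation mu := (@lebesgue_measure R).
Local Notation normalized_lower := (normalized_lower W p h C x).
Local Notation normalized_upper := (normalized_upper W p h C).
Local Notation G u t := (max_cost W C u t).
Local Notation Gsup u := (limit_cost W C u).

Let adm0 u : admissible_drift C u -> 0 <= u.
Proof. by case=> [/ltW//|[-> _]]. Qed.
Let Gfin u : admissible_drift C u -> Gsup u \is a fin_num.
Proof. exact: (limit_cost_fin hH hW C_ge0 C_cont hK hgamma C_growth). Qed.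

Definition normalized_horizon (b u : R) : \bar R := (b%:E * horizon_cost W p h C u x b^-1)%E.
Definition normalized_discounted (b u : R) : \bar R := (b%:E * discounted_cost W p h C b u x)%E.

Lemma horizon_normalized_lower b u : 0 < b -> 0 <= u -> normalized_lower (normalized_horizon b u) b u.
Proof.
move=> b0 u0; rewrite /normalized_horizon (horizon_decomposition hW)// ?h_ge0//.
apply: (decomposition_lower h hH hW) => //; first exact: horizon_kernel.
exact: (horizon_regulator_lower x hW).
Qed.

Lemma horizon_normalized_upper u : admissible_drift C u -> normalized_upper (normalized_horizon^~ u) u.
Proof.
move=> gu e e0; have u0 := adm0 gu.
have [B B0 BE] := decomposition_upper h hH hW hp C_ge0 C_cont C_nd hK hgamma C_growth hx gu
  horizon_kernel (horizon_regulator_upper hH hW hx (u := u)) e0.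
exists B => // b b0; rewrite /normalized_horizon (horizon_decomposition hW)// ?h_ge0//.
exact: BE.
Qed.

Lemma discounted_normalized_lower b u : 0 < b -> 0 <= u -> normalized_lower (normalized_discounted b u) b u.
Proof.
move=> b0 u0; rewrite /normalized_discounted (discounted_decomposition hW)// ?h_ge0//.
apply: (decomposition_lower h hH hW) => //; first exact: exponential_kernel.
exact: (exponential_regulator_lower hW).
Qed.

Lemma discounted_normalized_upper u : admissible_drift C u -> normalized_upper (normalized_discounted^~ u) u.
Proof.
move=> gu e e0; have u0 := adm0 gu.
have [B B0 BE] := decomposition_upper h hH hW hp C_ge0 C_cont C_nd hK hgamma C_growth hx gu
  exponential_kernel (exponential_regulator_upper hH hW hx (u := u)) e0.
exists B => // b b0; rewrite /normalized_discounted (discounted_decomposition hW)// ?h_ge0//.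
exact: BE.
Qed.

Definition time_average u T : \bar R :=
  (T^-1%:E * \int[P]_w ((\int[mu]_(t in `[0%R, T]) (C (reflected x u (W ^~ w) t))%:E) +
                       (p * regulator x u (W ^~ w) T)%:E))%E.

Lemma time_average_horizon u T : 0 <= u -> 0 < T ->
  ((h u)%:E + time_average u T = normalized_horizon T^-1 u)%E.
Proof.
move=> u0 T0; have TV : 0 < T^-1 by rewrite invr_gt0.
rewrite /normalized_horizon (horizon_decomposition hW)// ?h_ge0//.
rewrite /time_average (time_average_decomposition hW) ?invrK ?addeA//; last exact: ltW.
by move=> t /=; rewrite in_itv/= => /andP[].
Qed.

(** Adding h u turns the time average up to T into the normalised horizon cost with b = 1 / T. The
    upper estimate bounds the limit superior from above; the lower one bounds it from below by p u +
    G u s for each fixed s, and the supremum over s is taken last. *)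
Lemma ergodic_cost_limit u : admissible_drift C u ->
  ergodic_cost W p h C u x = ((h u + p * u)%:E + Gsup u)%E.
Proof.
move=> gu; have u0 := adm0 gu; have fin := Gfin gu; rewrite EFinD -addeA.
rewrite -[ergodic_cost _ _ _ _ _ _]/((h u)%:E + limf_esup (time_average u) (pinfty_nbhs R))%E.
congr (_ + _)%E; apply/eqP; rewrite eq_le; apply/andP; split.
  apply/lee_addgt0Pr => e e0; have e20 : 0 < e / 2 by rewrite divr_gt0.
  have [B B0 BE] := horizon_normalized_upper gu e20.
  apply: limf_esup_le_near; near=> T.
  have T0 : 0 < T by near: T; apply: nbhs_pinfty_gt; exact: num_real.
  have TB : 2 * B / e <= T by near: T; apply: nbhs_pinfty_ge; exact: num_real.
  have := BE T^-1; rewrite invr_gt0 => /(_ T0); rewrite -time_average_horizon// -(fineK fin) -!EFinD.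
  rewrite -leeBrDl// -EFinB => /le_trans; apply; rewrite lee_fin.
  have : B * T^-1 <= e / 2; last by move: (B * T^-1) => c; lra.
  by rewrite ler_pdivrMr//; move: TB; rewrite ler_pdivrMr//; lra.
rewrite -leeBrDl//; apply: ge_ereal_sup => _ [s /= s0 <-].
have gfin : G u s \is a fin_num.
  rewrite ge0_fin_numE ?max_cost_ge0//; apply: le_lt_trans (limit_cost_ge W C u s0) _.
  by rewrite -ge0_fin_numE// limit_cost_ge0.
have g0 : 0 <= fine (G u s) by rewrite fine_ge0// max_cost_ge0.
rewrite EFinN leeBrDl//; apply/lee_addgt0Pr => e e0; rewrite -leeBlDr//.
apply: limf_esup_ge_near; near=> T.
have T0 : 0 < T by near: T; apply: nbhs_pinfty_gt; exact: num_real.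
have Ts : s <= T by near: T; apply: nbhs_pinfty_ge; exact: num_real.
(* Beyond this time the starting point and the cut-off cost at most e together, being (p x + s G u
   s) / T. *)
have TB : (p * x + s * fine (G u s)) / e <= T by near: T; apply: nbhs_pinfty_ge; exact: num_real.
have TV : 0 < T^-1 by rewrite invr_gt0.
have := @horizon_normalized_lower T^-1 u TV u0 s s0.
rewrite mulrC ler_pdivrMr// mul1r => /(_ Ts).
rewrite -time_average_horizon// -(fineK gfin) -EFinM -EFinD -leeBlDl// -EFinB.
apply: le_trans; rewrite -EFinD lee_fin.
have : (p * x + s * fine (G u s)) * T^-1 <= e.
  by rewrite ler_pdivrMr// [leRHS]mulrC -ler_pdivrMr.
have : p * (u - T^-1 * x) + (1 - s / T) * fine (G u s) =
  p * u + fine (G u s) - (p * x + s * fine (G u s)) * T^-1 by ring.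
set q1 := _ * T^-1; set q2 := p * (u - _); set q3 := (1 - _) * _; lra.
Unshelve. all: by end_near. Qed.

End optimal_controls.

(** * Limit points of near-optimal drifts *)

Section near_optimal_limits.
Context {d} {Omega : measurableType d} {R : realType}.
Variables (P : probability Omega R) (H : R) (W : R -> {RV P >-> R}).
Variables (p : R) (h C : R -> R) (K gamma x eps : R).
Hypotheses (hH : 2^-1 <= H < 1) (hW : fractional_brownian_motion H W).
Hypotheses (hp : 0 <= p) (h_ge0 : forall u, 0 <= u -> 0 <= h u)
  (h_cont : {within `[0, +oo[, continuous h})
  (h_infty : h u @[u --> +oo] --> +oo).
Hypotheses (C_ge0 : forall y, 0 <= y -> 0 <= C y)
  (C_cont : {within `[0, +oo[, continuous C})
  (C_nd : forall y z, 0 <= y -> y <= z -> C y <= C z)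
  (hK : 0 < K) (hgamma : 0 < gamma)
  (C_growth : forall y, 0 <= y -> C y <= K * (1 + y `^ gamma))
  (hx : 0 <= x) (heps : 0 < eps).
Local Notation G u t := (max_cost W C u t).
Local Notation Gsup u := (limit_cost W C u).
Local Notation J u := ((h u + p * u)%:E + Gsup u)%E.
Local Notation V0 := (ergodic_value W p h C x).

Let Gfin u : admissible_drift C u -> Gsup u \is a fin_num.
Proof. exact: (limit_cost_fin hH hW C_ge0 C_cont hK hgamma C_growth). Qed.
Let ergodicE u : admissible_drift C u -> ergodic_cost W p h C u x = J u.
Proof. exact: (ergodic_cost_limit hH hW hp h_ge0 C_ge0 C_cont C_nd hK hgamma C_growth hx). Qed.
Let adm_pos u : 0 < u -> admissible_drift C u. Proof. by left. Qed.

Lemma ergodic_value_le v : 0 < v -> (V0 <= J v)%E.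
Proof. by move=> v0; rewrite -ergodicE; [apply: ereal_inf_lbound; exists v|exact: adm_pos]. Qed.

(** At l = 0, comparison with drift 1 bounds G 0, hence C by [max_cost_0_bounded]; so 0 is
    admissible and its ergodic cost is J 0. The infimum over positive drifts comes down to J 0
    because h is continuous at 0 and G v <= G 0. *)
Lemma optimal_drift l : 0 <= l -> (forall v, 0 < v -> (J l <= J v)%E) ->
  ergodic_optimal W p h C x l \/
    [/\ l = 0, ergodic_cost W p h C 0 x = V0 & exists M, forall y, 0 <= y -> C y <= M].
Proof.
move=> l0 lv.
have lV : (J l <= V0)%E.
  by apply: le_ereal_inf_tmp => _ [v /= v0 <-]; rewrite ergodicE; [exact: lv|exact: adm_pos].
move: l0; rewrite le_eqVlt => /predU1P[l0|l0]; [right|left]; last first.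
  split=> //; apply/eqP; rewrite eq_le; apply/andP; split.
    by rewrite ergodicE//; exact: adm_pos.
  by apply: ereal_inf_lbound; exists l.
rewrite -{}l0 in lv lV *.
have CM : exists M, forall y, 0 <= y -> C y <= M.
  have fin1 := Gfin (adm_pos ltr01).
  exists (4 * fine (J 1)) => y y0.
  apply: (max_cost_0_bounded hH hW C_ge0 C_cont C_nd) y0 => t t0.
  rewrite fineK ?fin_numD ?fin1//.
  apply: le_trans (lv 1 ltr01); apply: le_trans (limit_cost_ge W C 0 t0) _.
  by rewrite leeDr// lee_fin mulr0 addr0 h_ge0.
have gu : admissible_drift C 0 by right.
split=> //; rewrite (ergodicE gu); apply/eqP; rewrite eq_le lV/=.
apply/lee_addgt0Pr => e e0.
have e20 : 0 < e / 2 by rewrite divr_gt0.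
have [δ δ0 dP] := (within_ge0_continuousP h).1 h_cont 0 (e / 2) (lexx _) e20.
(* Small enough that h v and p v each cost at most e / 2 more than at 0. *)
pose v := Num.min (δ / 2) (e / 2 / (p + 1)).
have p1 : 0 < p + 1 by rewrite ltr_wpDl.
have v0 : 0 < v by rewrite lt_min !divr_gt0.
apply: le_trans (ergodic_value_le v0) _.
have hv : h v <= h 0 + e / 2.
  have vd : v < δ by rewrite (@le_lt_trans _ _ (δ / 2)) ?ge_min ?lexx//; lra.
  have := dP v (ltW v0); rewrite subr0 gtr0_norm// => /(_ vd).
  by rewrite ltr_norml => /andP[_]; lra.
have pv : p * v <= e / 2.
  have : v <= e / 2 / (p + 1) by rewrite ge_min lexx orbT.
  rewrite ler_pdivlMr// => H1; apply: le_trans H1; rewrite [leRHS]mulrC ler_wpM2r ?(ltW v0)//; lra.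
have GG : (Gsup v <= Gsup 0)%E.
  apply: ge_ereal_sup => _ [t /= t0 <-]; apply: le_trans (limit_cost_ge W C 0 t0).
  by apply: (max_cost_ni hW C_ge0 C_cont C_nd) => //; exact: ltW.
have f0 := Gfin gu; have fv := Gfin (adm_pos v0).
move: GG; rewrite -(fineK f0) -(fineK fv) -!EFinD !lee_fin mulr0.
by move: (fine _) (fine _) => ? ?; lra.
Qed.

Variables (N : R -> R -> \bar R) (b u : nat -> R).
Hypotheses (NL : forall b u, 0 < b -> 0 <= u -> normalized_lower W p h C x (N b u) b u)
  (NU : forall u, admissible_drift C u -> normalized_upper W p h C (N^~ u) u)
  (b0 : forall n, 0 < b n) (b_cvg : b n @[n --> \oo] --> 0) (u0 : forall n, 0 < u n)
  (u_opt : forall n v, 0 < v -> (N (b n) (u n) <= N (b n) v + (b n * eps)%:E)%E).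

Lemma near_optimal_bounded : exists M, forall n, `|u n| <= M.
Proof.
have [Bb Bb0 /= bB] := pinfty_ex_gt0 (cvg_seq_bounded (cvgP _ b_cvg)).
have bBb n : b n <= Bb by apply: le_trans (ler_norm _) _; exact: bB.
have g1 := adm_pos ltr01; have fin := Gfin g1.
have [B B0 BE] := NU g1 ltr01.
(* The lower estimate at u n with s = 0, where G and p u n are dropped, against the upper estimate
   at drift 1 with e = 1 and b n <= Bb. *)
pose M := p * x * Bb + h 1 + p + 1 + B * Bb + fine (Gsup 1) + Bb * eps.
have hM n : h (u n) <= M.
  have := NL (b0 n) (ltW (u0 n)) (lexx 0); rewrite mulr0 => /(_ ler01).
  move=> /le_trans /(_ (u_opt n ltr01)) /le_trans.
  move=> /(_ _ (leeD2r _ (BE _ (b0 n)))).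
  rewrite subr0 mul1e.
  move=> /(le_trans (leeDl _ (max_cost_ge0 W C_ge0 _ _))).
  rewrite -(fineK fin) -!EFinD !lee_fin.
  have c1 : b n * (p * x + B + eps) <= Bb * (p * x + B + eps).
    by rewrite ler_wpM2r// !addr_ge0// ?mulr_ge0// ltW.
  have c2 : 0 <= p * u n by rewrite mulr_ge0// ltW.
  have -> : p * (u n - b n * x) = p * u n - b n * (p * x) by ring.
  move: c1 c2; rewrite /M mulr1 [B * b n]mulrC [p * x * Bb]mulrC [B * Bb]mulrC.
  rewrite !mulrDr; set m1 := b n * (p * x); set m2 := b n * B; set m3 := b n * eps.
  set m4 := Bb * (p * x); set m5 := Bb * B; set m6 := Bb * eps; set m7 := p * u n; lra.
have [A [_ AP]] : \forall v \near +oo, M < h v by move/cvgryPgt : h_infty; exact.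
exists A => n; rewrite gtr0_norm// leNgt; apply/negP => /AP.
by rewrite ltNge hM.
Qed.

(** The cut-off s is fixed first, then n is chosen with u n close to l and b n small, so that all
    terms multiplied by b n vanish; the supremum over s is formed at the end. *)
Lemma near_optimal_cluster l : cluster (u n @[n --> \oo]) l ->
  0 <= l /\ (forall v, 0 < v -> (J l <= J v)%E).
Proof.
move=> lu.
have l0 : 0 <= l.
  rewrite leNgt; apply/negP => l0.
  have [z [/= z0 zl]] : [set z : R | 0 < z] `&` [set z : R | z < 0] !=set0.
    have u0n : \forall n \near \oo, 0 < u n by exact: nearW.
    apply: lu; [exact: u0n|exact: lt_nbhsl].
  by move: (lt_trans z0 zl); rewrite ltxx.
split; [exact: l0|move=> v v0]; have gv := adm_pos v0; have fin := Gfin gv.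
rewrite -leeBrDl//; apply: ge_ereal_sup => _ [s /= s0 <-].
(* The u n near l may lie on either side of it. Any m > l is above those close enough, which gives G
   (u n) s >= G m s, and m is then lowered to l by right continuity. *)
rewrite EFinN; apply: (max_cost_right_limit hW C_ge0 C_cont C_nd) => // m lm.
have m0 : 0 < m by exact: le_lt_trans lm.
have fm : G m s \is a fin_num.
  rewrite ge0_fin_numE ?max_cost_ge0//; apply: le_lt_trans (limit_cost_ge W C m s0) _.
  rewrite -ge0_fin_numE; first exact: (Gfin (adm_pos m0)).
  exact: limit_cost_ge0.
pose g := fine (G m s); have g0 : 0 <= g by rewrite fine_ge0// max_cost_ge0.
rewrite leeBrDl//; apply/lee_addgt0Pr => e' e'0.
(* The errors add up to 3 e + p e: one e each from the upper estimate, from h and from the terms in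
   b n, and p e from the drift. *)
pose e := e' / (3 + p); have p3 : 0 < 3 + p by rewrite ltr_pwDl.
have e0 : 0 < e by rewrite divr_gt0.
have [B B0 BE] := NU gv e0.
have [δ δ0 dP] := (within_ge0_continuousP h).1 h_cont l e l0 e0.
(* The sum of all coefficients of b n: starting point, mass lost before s, constant of the upper
   estimate, and eps. *)
pose Q := p * x + s * g + B + eps.
have Q0 : 0 < Q by rewrite ltr_wpDl// !addr_ge0// mulr_ge0.
have bsmall c : 0 < c -> \forall n \near \oo, b n < c.
  move=> c0; move/(@cvgrPdist_lt _ R^o) : b_cvg => /(_ _ c0).
  by apply: filterS => n; rewrite sub0r normrN; apply: le_lt_trans; exact: ler_norm.
have bsQ : \forall n \near \oo, b n * s <= 1 /\ b n * Q <= e.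
  near=> n; split.
    have : b n < (s + 1)^-1 by near: n; apply: bsmall; rewrite invr_gt0 ltr_wpDl.
    rewrite -[_^-1]mul1r ltr_pdivlMr ?ltr_wpDl// mulrDr mulr1; have := b0 n.
    by set c := b n * s; lra.
  have : b n < e / Q by near: n; apply: bsmall; rewrite divr_gt0.
  by rewrite ltr_pdivlMr// => /ltW.
have [z [[n [<- bs bQ]] [ul um un]]] :
    [set z | exists n, [/\ u n = z, b n * s <= 1 & b n * Q <= e]] `&`
    [set z | [/\ `|l - z| < e, z < m & `|l - z| < δ]] !=set0.
  apply: lu.
    by apply: filterS bsQ => n [bs bQ]; exists n.
  near=> z; split.
  - by near: z; exact: nbhsx_ballx.
  - by near: z; exact: lt_nbhsl.
  - by near: z; exact: nbhsx_ballx.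
have un0 := u0 n; have := NL (b0 n) (ltW un0) s0 bs.
move=> /le_trans /(_ (u_opt n v0)) /le_trans.
move=> /(_ _ (leeD2r _ (BE _ (b0 n)))).
have gu : ((1 - b n * s)%:E * g%:E <= (1 - b n * s)%:E * G (u n) s)%E.
  rewrite lee_wpmul2l ?lee_fin ?subr_ge0// /g fineK//.
  by apply: (max_cost_ni hW C_ge0 C_cont C_nd) => //; exact: ltW.
move=> /(le_trans (leeD2l _ gu)).
rewrite -(fineK fin) -(fineK fm) -/g -EFinM -!EFinD !lee_fin.
have hu : h l - e <= h (u n).
  have := dP (u n) (ltW un0); rewrite distrC => /(_ un).
  by rewrite ltr_norml => /andP[]; lra.
have pu : p * (l - e) <= p * u n.
  by rewrite ler_wpM2l//; move: ul; rewrite ltr_norml => /andP[_]; lra.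
have e'E : e' = 3 * e + p * e by rewrite /e; field; rewrite gt_eqF.
move: bQ; rewrite /Q e'E.
have -> : b n * (p * x + s * g + B + eps) = p * (b n * x) + b n * s * g + B * b n + b n * eps by ring.
move: hu pu; rewrite mulrBl mul1r !mulrBr.
by clearbody g; move: (fine _) => ?; lra.
Unshelve. all: by end_near. Qed.

End near_optimal_limits.

Lemma eps_optimal_scale {R : realType} (J : R -> \bar R) (b eps u v : R) : 0 < b -> 0 < v ->
  (J u < ereal_inf [set J u | u in [set u : R | (0 < u)%R]] + eps%:E)%E ->
  (b%:E * J u <= b%:E * J v + (b * eps)%:E)%E.
Proof.
move=> b0 v0 /ltW uI; rewrite EFinM -muleDr//; last by rewrite fin_num_adde_defl.
rewrite lee_wpmul2l ?lee_fin ?(ltW b0)//; apply: le_trans uI _.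
by rewrite leeD2r//; apply: ereal_inf_lbound; exists v.
Qed.

(** The second alternative is the limit point 0, which is not itself a control. It does occur: with
    C = 0 and h u = u the infimum over positive drifts is approached only at 0. *)
Theorem mainTheorem9 (d : measure_display) (Omega : measurableType d)
    (R : realType) (P : probability Omega R) (H : R) (W : R -> {RV P >-> R})
    (p : R) (h C : R -> R) (K gamma : R) (x eps : R)
    (hH : 2^-1 <= H < 1)
    (hW : fractional_brownian_motion H W)
    (hp : 0 <= p)
    (h_ge0 : forall u, 0 <= u -> 0 <= h u)
    (h_cont : {within `[0, +oo[, continuous h})
    (h_nd : forall u v, 0 <= u -> u <= v -> h u <= h v)
    (h_infty : h u @[u --> +oo] --> +oo)
    (C_ge0 : forall y, 0 <= y -> 0 <= C y)
    (C_cont : {within `[0, +oo[, continuous C})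
    (C_nd : forall y z, 0 <= y -> y <= z -> C y <= C z)
    (hK : 0 < K) (hgamma : 0 < gamma)
    (C_growth : forall y, 0 <= y -> C y <= K * (1 + y `^ gamma))
    (hx : 0 <= x) (heps : 0 < eps) :
  (forall alpha u : nat -> R,
     (forall n, 0 < alpha n) ->
     alpha n @[n --> \oo] --> 0 ->
     (forall n, discounted_eps_optimal W p h C eps (alpha n) x (u n)) ->
     (exists M, forall n, `|u n| <= M) /\
     (forall l, cluster (u n @[n --> \oo]) l ->
        ergodic_optimal W p h C x l \/
        [/\ l = 0, ergodic_cost W p h C 0 x = ergodic_value W p h C x
          & exists M, forall y, 0 <= y -> C y <= M])) /\
  (forall T u : nat -> R,
     (forall n, 0 < T n) ->
     T n @[n --> \oo] --> +oo ->
     (forall n, horizon_eps_optimal W p h C eps x (T n) (u n)) ->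
     (exists M, forall n, `|u n| <= M) /\
     (forall l, cluster (u n @[n --> \oo]) l ->
        ergodic_optimal W p h C x l \/
        [/\ l = 0, ergodic_cost W p h C 0 x = ergodic_value W p h C x
          & exists M, forall y, 0 <= y -> C y <= M])).
Proof.
split=> [alpha u a0 acvg uopt|T u T0 Tcvg uopt].
- have NL b v : 0 < b -> 0 <= v ->
      normalized_lower W p h C x (normalized_discounted W p h C x b v) b v.
    by move=> *; exact: (discounted_normalized_lower hH hW).
  have NU v : admissible_drift C v ->
      normalized_upper W p h C (normalized_discounted W p h C x ^~ v) v.
    exact: (discounted_normalized_upper hH hW hp h_ge0 C_ge0 C_cont C_nd hK hgamma C_growth hx).
  have u0 n : 0 < u n by case: (uopt n).
  have opt n v (v0 : 0 < v) : (normalized_discounted W p h C x (alpha n) (u n) <=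
      normalized_discounted W p h C x (alpha n) v + (alpha n * eps)%:E)%E.
    have [_ un] := uopt n.
    exact: (eps_optimal_scale (J := fun v => discounted_cost W p h C (alpha n) v x) (a0 n) v0 un).
  split=> [|l lu].
    exact: (near_optimal_bounded hH hW hp h_infty C_ge0 C_cont hK hgamma C_growth hx heps NL NU a0 acvg u0 opt).
  have [l0 lv] := near_optimal_cluster hH hW hp h_cont C_ge0 C_cont C_nd hK hgamma C_growth hx heps NL NU a0 acvg u0 opt lu.
  exact: (optimal_drift hH hW hp h_ge0 h_cont C_ge0 C_cont C_nd hK hgamma C_growth hx).
- have NL b v : 0 < b -> 0 <= v ->
      normalized_lower W p h C x (normalized_horizon W p h C x b v) b v.
    by move=> *; exact: (horizon_normalized_lower hH hW).
  have NU v : admissible_drift C v ->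
      normalized_upper W p h C (normalized_horizon W p h C x ^~ v) v.
    exact: (horizon_normalized_upper hH hW hp h_ge0 C_ge0 C_cont C_nd hK hgamma C_growth hx).
  have u0 n : 0 < u n by case: (uopt n).
  have b0 n : 0 < (T n)^-1 by rewrite invr_gt0.
  have bcvg : (T n)^-1 @[n --> \oo] --> 0 by apply/gtr0_cvgV0 => //; exact: nearW.
  have opt n v (v0 : 0 < v) : (normalized_horizon W p h C x (T n)^-1 (u n) <=
      normalized_horizon W p h C x (T n)^-1 v + ((T n)^-1 * eps)%:E)%E.
    have [_ un] := uopt n; rewrite /normalized_horizon invrK.
    exact: (eps_optimal_scale (J := fun v => horizon_cost W p h C v x (T n)) (b0 n) v0 un).
  split=> [|l lu].
    exact: (near_optimal_bounded hH hW hp h_infty C_ge0 C_cont hK hgamma C_growth hx heps NL NU b0 bcvg u0 opt).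
  have [l0 lv] := near_optimal_cluster hH hW hp h_cont C_ge0 C_cont C_nd hK hgamma C_growth hx heps NL NU b0 bcvg u0 opt lu.
  exact: (optimal_drift hH hW hp h_ge0 h_cont C_ge0 C_cont C_nd hK hgamma C_growth hx).
Qed.
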